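(* Let $P=\mathrm{vc}^{k}(\Delta^{n_{1}}\times\ldots\times\Delta^{n_{r}})$ with $n_1\ge\ldots\ge n_r\ge 1$, $r\ge 1$, $k\ge 0$. Then $K_P$ (equivalently, its face ring $\mathbf{k}[K_P]$) is minimally non-Golod if and only if $r\in\{1,2\}$ and $P$ is not a simplex.
   Context: Let $\mathbf{k}$ be a field of characteristic zero or the ring of integers. For a simplicial complex $K$ on $[m]=\{1,\ldots,m\}$, the face (Stanley--Reisner) ring is $\mathbf{k}[K]=\mathbf{k}[v_1,\ldots,v_m]/\mathcal I_K$, $\deg v_i=2$, where $\mathcal I_K$ is generated by the square-free monomials $v_{i_1}\cdots v_{i_q}$ with $\{i_1,\ldots,i_q\}\notin K$. The algebra $\mathrm{Tor}_{\mathbf{k}[v_1,\ldots,v_m]}(\mathbf{k}[K],\mathbf{k})$ is the cohomology of the differential graded algebra $\Lambda[u_1,\ldots,u_m]\otimes\mathbf{k}[K]$ with $\deg u_i=1$, $du_i=v_i$, $dv_i=0$. $\mathbf{k}[K]$ (and $K$ itself) is called Golod if the multiplication (of positive-degree elements) and all higher Massey operations in $\mathrm{Tor}_{\mathbf{k}[v_1,\ldots,v_m]}(\mathbf{k}[K],\mathbf{k})$ are trivial. $\mathbf{k}[K]$ (and $K$) is called minimally non-Golod if $K$ is not Golod but for every vertex $v$ of $K$ the complex $K-v$ (the full subcomplex of $K$ on the vertex set with $v$ removed) is Golod. For a simple polytope $P$ with facets $F_1,\ldots,F_m$, $K_P$ is the boundary complex of the dual simplicial polytope: the simplicial complex on $[m]$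 whose simplices are the subsets $\{i_1,\ldots,i_q\}$ with $F_{i_1}\cap\ldots\cap F_{i_q}\ne\varnothing$. Vertex cut: for a simple polytope $P$ with a vertex $v$, choose a hyperplane $H$ separating $v$ from all other vertices, with $v$ in the halfspace $H_{\ge}$; then $P\cap H_{\le}$ is a simple polytope, denoted $\mathrm{vc}(P)$. $\mathrm{vc}^k(P)$ denotes any polytope obtained from $P$ by iterating the vertex cut operation $k$ times (with arbitrary choices of the vertices cut at each step). $\Delta^n$ is the $n$-simplex. *)

(* Defs.v *)
From HB Require Import structures.
From mathcomp Require Import boolp classical_sets reals.
From mathcomp Require Import all_boot all_order all_algebra ring_quotient.
From mathcomp Require Import mpoly.

Set Implicit Arguments.
Unset Strict Implicit.
Unset Printing Implicit Defensive.

Import Order.TTheory GRing.Theory Num.Theory.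

Local Open Scope ring_scope.
Local Open Scope quotient_scope.

Variant coefficient_ring : comNzRingType -> Prop :=
| CoefField (F : fieldType) of [pchar F] =i pred0 : coefficient_ring F
| CoefInt : coefficient_ring int.

(** * Simplicial complexes *)

(* Ghost vertices (i : 'I_m with [set i] not a face) are allowed. *)
Record simplicial_complex (m : nat) := SimplicialComplex {
  faces :> {set {set 'I_m}};
  faces0 : set0 \in faces;
  facesS : forall I J : {set 'I_m}, I \subset J -> J \in faces -> I \in faces
}.

Section DeleteVertex.
Variables (m : nat) (K : simplicial_complex m) (v : 'I_m).

Definition del_vertex_faces : {set {set 'I_m.-1}} :=
  [set J : {set 'I_m.-1} | (lift v @: J) \in faces K]%SET.

Fact del_vertex_faces0 : set0 \in del_vertex_faces.
Proof. by rewrite inE imset0 faces0. Qed.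

Fact del_vertex_facesS (I J : {set 'I_m.-1}) :
  I \subset J -> J \in del_vertex_faces -> I \in del_vertex_faces.
Proof. by move=> sIJ; rewrite !inE; apply: facesS; apply: imsetS. Qed.

(* The remaining vertices are renumbered along [lift v], so that the removed
   vertex does not survive as a ghost vertex. *)
Definition del_vertex : simplicial_complex m.-1 :=
  SimplicialComplex del_vertex_faces0 del_vertex_facesS.

End DeleteVertex.

(** * Face rings *)

Section FaceRing.
Variables (k : comNzRingType) (m : nat) (K : simplicial_complex m).

Definition face_ideal : {pred {mpoly k[m]}} := fun f =>
  `[< exists q : {set 'I_m} -> {mpoly k[m]},
        f = \sum_(J : {set 'I_m} | J \notin faces K)
              q J * \prod_(j in J) 'X_j >].

Fact face_ideal_closed : idealr_closed face_ideal.
Proof.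
split.
- apply/asboolP; exists (fun=> 0).
  by rewrite big1 // => J _; rewrite mul0r.
- apply/negP => /asboolP[q /(congr1 (fun f : {mpoly k[m]} => f.@[fun=> 0]))].
  rewrite meval1 raddf_sum big1 => [/eqP|J KJ]; first by rewrite oner_eq0.
  have [J0|[j Jj]] := set_0Vmem J; first by rewrite J0 faces0 in KJ.
  by rewrite /= (bigD1 j) //= !mevalM mevalXU mul0r mulr0.
- move=> a u v /asboolP[p ->] /asboolP[q ->]; apply/asboolP.
  exists (fun J => a * p J + q J); rewrite mulr_sumr -big_split /=.
  by apply: eq_bigr => J _; rewrite mulrDl mulrA.
Qed.

HB.instance Definition _ :=
  isIdealr.Build {mpoly k[m]} face_ideal face_ideal_closed.

Definition face_ring : comNzRingType := {ideal_quot face_ideal}.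

Definition face_proj (f : {mpoly k[m]}) : face_ring := \pi_{ideal_quot face_ideal} f.

End FaceRing.

(** * Massey products

  [A] carries a product [mul], a differential [d] of degree 1 and a grading,
  [isdeg p a] meaning that [a] is homogeneous of degree [p].  Cohomology classes
  are given by cocycle representatives. *)

Section Massey.
Variables (A : zmodType) (mul : A -> A -> A) (d : A -> A).
Variable isdeg : nat -> A -> Prop.

Definition cocycle (p : nat) (a : A) : Prop := isdeg p a /\ d a = 0.

Definition coboundary (a : A) : Prop := exists b, a = d b.

(* The degree of the entry (i, j) of a defining system for classes of degrees
   p 0, p 1, ...; there is no truncation when all the p s are positive. *)
Definition massey_deg (p : nat -> nat) (i j : nat) : nat :=
  (\sum_(i <= s < j) p s - (j - i).-1)%N.

Definition massey_sum (p : nat -> nat) (a : nat -> nat -> A) (i j : nat) : A :=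
  \sum_(i.+1 <= s < j) mul (a i s *~ (-1) ^+ massey_deg p i s) (a s j).

(* The entries a i j of a defining system are indexed by i < j <= n,
   (i, j) <> (0, n), the i-th class being represented by a i i.+1. *)
Definition defining_system (n : nat) (p : nat -> nat) (c : nat -> A)
    (a : nat -> nat -> A) : Prop :=
  (forall i, (i < n)%N ->
     cocycle (p i) (a i i.+1) /\ coboundary (a i i.+1 - c i)) /\
  (forall i j, (i.+1 < j <= n)%N -> (i, j) != (0%N, n) ->
     isdeg (massey_deg p i j) (a i j) /\ d (a i j) = massey_sum p a i j).

(* z represents an element of the Massey product of the classes of
   c 0, ..., c n.-1. *)
Definition massey_product (n : nat) (p : nat -> nat) (c : nat -> A) (z : A) :
    Prop :=
  exists2 a, defining_system n p c a & z = massey_sum p a 0 n.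

Definition trivial_multiplication : Prop :=
  forall p q a b, (0 < p)%N -> (0 < q)%N -> cocycle p a -> cocycle q b ->
    coboundary (mul a b).

(* Every n-fold Massey product contains no class but zero.  When this holds
   for all smaller n and the multiplication is trivial, partial defining systems
   always extend, so that the n-fold Massey products are all defined. *)
Definition trivial_massey (n : nat) : Prop :=
  forall (p : nat -> nat) (c : nat -> A),
    (forall i, (i < n)%N -> (0 < p i)%N /\ cocycle (p i) (c i)) ->
  forall z, massey_product n p c z -> coboundary z.

End Massey.

(** * The Koszul algebra of a face ring and the Golod property *)

Section Golod.
Variables (k : comNzRingType) (m : nat) (K : simplicial_complex m).

(* [a : koszul] stands for the sum over J of u_J (x) a J, with u_J the product
   of the u_j, j in J, in increasing order. *)
Definition koszul := {ffun {set 'I_m} -> face_ring k K}.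

Definition inversions (S T : {set 'I_m}) : nat :=
  #|[set x : 'I_m * 'I_m | [&& x.1 \in S, x.2 \in T & (x.2 < x.1)%N]]%SET|.

Definition koszul_mul (a b : koszul) : koszul :=
  [ffun J : {set 'I_m} => \sum_(S : {set 'I_m} | S \subset J)
     (-1) ^+ inversions S (J :\: S) * (a S * b (J :\: S))].

(* The coefficient of u_I in d a: it comes from the terms u_(j |: I) of a, where
   d u_j = v_j and u_j is preceded by the u_i with i in I, i < j. *)
Definition koszul_d (a : koszul) : koszul :=
  [ffun I : {set 'I_m} => \sum_(j | j \notin I)
     (-1) ^+ #|[set i in I | (i < j)%N]%SET| *
       (face_proj K ('X_j : {mpoly k[m]}) * a (j |: I)%SET)].

(* Total degree, with deg u_i = 1 and deg v_i = 2. *)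
Definition koszul_homog (p : nat) (a : koszul) : Prop :=
  forall J : {set 'I_m}, exists2 f : {mpoly k[m]}, a J = face_proj K f &
    {in msupp f, forall e, (#|J| + 2 * mdeg e)%N = p}.

Definition golod : Prop :=
  trivial_multiplication koszul_mul koszul_d koszul_homog /\
  forall n, (3 <= n)%N -> trivial_massey koszul_mul koszul_d koszul_homog n.

End Golod.

Definition minimally_non_golod (k : comNzRingType) (m : nat)
    (K : simplicial_complex m) : Prop :=
  ~ golod k K /\
  forall v : 'I_m, [set v]%SET \in faces K -> golod k (del_vertex K v).

(** * Polytopes *)

Section Polytope.
Variable R : realType.

Definition dotr (n : nat) (x : 'rV[R]_n) (a : 'cV[R]_n) : R := (x *m a) 0 0.

(* Affine independence of the rows of V. *)
Definition affinely_free (p n : nat) (V : 'M[R]_(p, n)) : Prop :=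
  row_free (row_mx (const_mx 1 : 'cV_p) V).

Definition conv_rows (p n : nat) (V : 'M[R]_(p, n)) : set 'rV[R]_n :=
  [set x | exists w : 'rV[R]_p,
     [/\ forall i, 0 <= w 0 i, \sum_i w 0 i = 1 & x = w *m V]]%classic.

Definition is_simplex (n : nat) (P : set 'rV[R]_n) : Prop :=
  exists2 V : 'M[R]_(n.+1, n), affinely_free V & P = conv_rows V.

Definition prod_set (r : nat) (n : 'I_r -> nat)
    (S : forall i, set 'rV[R]_(n i)) : set 'rV[R]_(\sum_(i < r) n i) :=
  [set x | forall i, S i (submxrow x i)]%classic.

Definition is_vertex (n : nat) (P : set 'rV[R]_n) (v : 'rV[R]_n) : Prop :=
  P v /\ exists a : 'cV[R]_n, forall x, P x -> x <> v -> dotr x a < dotr v a.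

(* F is cut out of P by a supporting hyperplane and spans it.  Meant for P of
   full dimension n > 0, so that F is a face of dimension n - 1. *)
Definition is_facet (n : nat) (P F : set 'rV[R]_n) : Prop :=
  exists (a : 'cV[R]_n) (b : R),
    [/\ a != 0, forall x, P x -> dotr x a <= b,
        F = [set x | P x /\ dotr x a = b]%classic &
        exists2 V : 'M[R]_n, affinely_free V & forall i, F (row i V)].

Definition facet_numbering (n : nat) (P : set 'rV[R]_n) (m : nat)
    (F : 'I_m -> set 'rV[R]_n) : Prop :=
  injective F /\ forall G, is_facet P G <-> exists i, F i = G.

Definition vertex_cut (n : nat) (P Q : set 'rV[R]_n) : Prop :=
  exists (v : 'rV[R]_n) (a : 'cV[R]_n) (b : R),
    [/\ is_vertex P v, b < dotr v a,
        forall w, is_vertex P w -> w <> v -> dotr w a < b &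
        Q = [set x | P x /\ dotr x a <= b]%classic].

Fixpoint iter_vertex_cut (k n : nat) (P Q : set 'rV[R]_n) : Prop :=
  if k is k'.+1 then exists2 P', iter_vertex_cut k' P P' & vertex_cut P' Q
  else Q = P.

End Polytope.

(* The nerve of a family of sets, with the empty set always a face.  For the
   facets of a simple polytope P it is K_P. *)
Section Nerve.
Variables (T : Type) (m : nat) (F : 'I_m -> set T).

Definition nerve_faces : {set {set 'I_m}} :=
  [set I : {set 'I_m} | (I == set0) || `[< exists x, forall i, i \in I -> F i x >]]%SET.

Fact nerve_faces0 : set0 \in nerve_faces.
Proof. by rewrite inE eqxx. Qed.

Fact nerve_facesS (I J : {set 'I_m}) :
  I \subset J -> J \in nerve_faces -> I \in nerve_faces.
Proof.
move=> /subsetP sIJ; rewrite !inE => /orP[/eqP J0|/asboolP[x Fx]].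
  apply/orP; left; rewrite -subset0 -J0; exact/subsetP.
by apply/orP; right; apply/asboolP; exists x => i /sIJ; apply: Fx.
Qed.

Definition nerve : simplicial_complex m :=
  SimplicialComplex nerve_faces0 nerve_facesS.

End Nerve.

(* Main.v *)
Require Import Defs.
From HB Require Import structures.
From mathcomp Require Import boolp classical_sets reals.
From mathcomp Require Import all_boot all_order all_algebra.
From mathcomp Require Import ring_quotient ssrAC mpoly.
From mathcomp Require Import zify ring lra.

(** Dually, a product of simplices becomes the join of the boundaries of simplices
    [block i], and cutting off a vertex becomes the stellar subdivision at a facet
    ([cut_facets]); [N] is the number of vertices of a facet.  Three facts decide the
    question.

    Deletions are Golod for one or two blocks ([del_golod]).  The Koszul algebra of a face
    ring is lifted to polynomial coefficients ([golod_lift]).  Its cohomology lives in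
    squarefree multidegrees ([squarefree_exact]), and there it is the simplicial cohomology
    of the full subcomplexes.  Once a vertex of the sphere is deleted, no full subcomplex
    has cohomology in the top dimension ([top_cohomology]).  Below it, the faces are those
    of a complex [T] in which the facets cut off have not been removed, so that the new
    vertices are the apexes of cones over simplices ([elimination], [stacked]); its
    cohomology only consists of classes of components and of the spheres [block i].  These
    classes have representatives whose products are exact for reasons of support.  A Massey
    product is a sum that comes from a solution of the Maurer-Cartan equation.  Its
    entries can be moved onto such representatives one by one by gauge transformations,
    which do not change the class of the sum ([massey_exact]).  Hence [golod_criterion],
    which also gives that the boundary of a simplex is Golod ([simplex_golod]).

    Products survive cuts.  In a join of two boundaries of simplices the product of the two
    fundamental classes is the fundamental class ([join_nontrivial]), and it remains nonzero
    after a subdivision, because the first factor can be moved off the subdivided facet and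
    multiplied by the new exterior variable ([stellar_nontrivial]).  This applies to two
    blocks, and to a simplex that has been cut at least once, its first cut being a prism
    ([cut_simplex_detects]).

    With three blocks or more, the join of the first two has too small a dimension to be
    touched by a cut.  It is a full subcomplex that avoids the vertices of the third block,
    so deleting one of these does not make the complex Golod ([spare_join_del]).

    The geometry is used through [realizes]: points and linear inequalities with the
    incidences of the abstract complex.  This determines the vertices and the facets of the
    polytope ([is_vertexP], [is_facetP]), hence its nerve ([nerve_push]), and it is preserved
    by vertex cuts ([cut_realizes]).  In dimension 1, and for one block without cuts, there
    are only [N.+1] vertices, and the polytope is a simplex ([few_vertices_simplex]). *)

Set Implicit Arguments.
Unset Strict Implicit.
Unset Printing Implicit Defensive.

Import Order.TTheory GRing.Theory Num.Theory.

Local Open Scope ring_scope.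

(** * Signs of exterior monomials *)

Section SubsetSums.
Variables (T : finType) (V : nmodType).

Lemma sub_subset_sum (J : {set T}) (g : {set T} -> {set T} -> V) :
  \sum_(S : {set T} | S \subset J) \sum_(U : {set T} | U \subset S) g U S =
  \sum_(U : {set T} | U \subset J) \sum_(W : {set T} | W \subset J :\: U) g U (U :|: W).
Proof.
rewrite (exchange_big_dep (fun U : {set T} => U \subset J)) /=; last first.
  by move=> S U SJ US; exact: subset_trans SJ.
apply: eq_bigr => U UJ.
rewrite (reindex_onto (fun W : {set T} => U :|: W) (fun S : {set T} => S :\: U)) /=; last first.
  by move=> S /andP[_ US]; rewrite setDE setUIr setUCr setIT; apply/setUidPr.
apply: eq_bigl => W.
rewrite subUset UJ subsetUl andbT /= setDUl setDv set0U.
apply/andP/idP => [[WJ /eqP <-]|]; first by apply/subsetP => x; rewrite !inE => /andP[-> /(subsetP WJ)].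
rewrite subsetD => /andP[-> dWU]; split=> //; apply/eqP/setDidPl; exact: dWU.
Qed.

End SubsetSums.

Lemma sum_if1 (T : finType) (V : nmodType) (P : pred T) (i : T) (g : T -> V) :
  P i -> (forall j, P j -> j != i -> g j = 0) -> \sum_(j | P j) g j = g i.
Proof. by move=> Pi z; rewrite (bigD1 i) //= big1 ?addr0 // => j /andP[]; exact: z. Qed.

Section Inversions.
Variable m : nat.
Implicit Types (I S T U : {set 'I_m}) (i j : 'I_m).

Lemma inversionsE S T :
  inversions S T = (\sum_(x in S) \sum_(y in T) (y < x)%N)%N.
Proof.
rewrite /inversions -sum1_card pair_big_dep /= big_mkcond [RHS]big_mkcond /=.
apply: eq_bigr => -[x y] _; rewrite inE /=.
by case: (x \in S); case: (y \in T); case: (y < x)%N.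
Qed.

Lemma sum_nat_setU S T (g : 'I_m -> nat) : [disjoint S & T] ->
  (\sum_(x in S :|: T) g x = \sum_(x in S) g x + \sum_(x in T) g x)%N.
Proof. by move=> d; rewrite (eq_bigl [predU S & T]) ?bigU // => x; rewrite !inE. Qed.

Lemma inversionsUl S T U : [disjoint S & T] ->
  inversions (S :|: T) U = (inversions S U + inversions T U)%N.
Proof. by move=> d; rewrite !inversionsE; exact: sum_nat_setU. Qed.

Lemma inversionsUr S T U : [disjoint S & T] ->
  inversions U (S :|: T) = (inversions U S + inversions U T)%N.
Proof.
move=> d; rewrite !inversionsE -big_split /=.
by apply: eq_bigr => x _; exact: sum_nat_setU.
Qed.

Lemma inversions0l T : inversions set0 T = 0%N.
Proof. by rewrite inversionsE big_set0. Qed.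

Lemma inversions0r S : inversions S set0 = 0%N.
Proof. by rewrite inversionsE big1 // => x _; rewrite big_set0. Qed.

(** The number of transpositions that bring [u_j] to its place in the monomial [u_I]. *)
Definition below (I : {set 'I_m}) (j : 'I_m) : nat := #|[set i in I | (i < j)%N]|.

Lemma inversions1l I j : inversions [set j] I = below I j.
Proof.
rewrite inversionsE big_set1 /below -sum1_card [RHS]big_mkcond [LHS]big_mkcond /=.
by apply: eq_bigr => i _; rewrite inE; case: (i \in I); case: (i < j)%N.
Qed.

Lemma inversions1C I j : j \notin I ->
  (inversions [set j] I + inversions I [set j] = #|I|)%N.
Proof.
move=> jI; rewrite !inversionsE big_set1 -big_split -sum1_card /=.
apply: eq_bigr => i iI; rewrite big_set1.
have : i != j by apply: contraNneq jI => <-.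
by rewrite -val_eqE /= neq_ltn; case: ltngtP.
Qed.

Lemma belowU S T j : [disjoint S & T] -> below (S :|: T) j = (below S j + below T j)%N.
Proof. by move=> d; rewrite -!inversions1l inversionsUr. Qed.

Lemma below1C i j : i != j -> (below [set i] j + below [set j] i = 1)%N.
Proof.
move=> ij; have := @inversions1C [set j] i; rewrite inE => /(_ ij).
by rewrite cards1 inversions1l => <-; rewrite -(inversions1l [set i]) addnC.
Qed.

End Inversions.

(** * Exterior algebras and the Koszul differential *)

Section Exterior.
Variables (m : nat) (R : comNzRingType).
Implicit Types (I J S T U : {set 'I_m}) (i j w : 'I_m).

(** The element [a] stands for the sum of the [a I * u_I]; the product has the signs
    of [koszul_mul], with which it is an associative ring. *)
Definition ext := {ffun {set 'I_m} -> R}.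
HB.instance Definition _ := GRing.Zmodule.on ext.
Implicit Types a b c : ext.

Definition ext_mul a b : ext := [ffun J : {set 'I_m} =>
  \sum_(S : {set 'I_m} | S \subset J)
     (-1) ^+ inversions S (J :\: S) * (a S * b (J :\: S))].

Definition ext_one : ext := [ffun J : {set 'I_m} => (J == set0)%:R].

Lemma ext_mulA : associative ext_mul.
Proof.
move=> a b c; apply/ffunP => J; rewrite !ffunE.
under [RHS]eq_bigr => S SJ do rewrite ffunE mulrA [X in X * _]mulr_sumr mulr_suml.
rewrite sub_subset_sum; apply: eq_bigr => U UJ.
rewrite ffunE !mulr_sumr; apply: eq_bigr => W; rewrite subsetD => /andP[WJ dWU].
have dUW : [disjoint U & W] by rewrite disjoint_sym.
have e1 : (U :|: W) :\: U = W by rewrite setDUl setDv set0U; apply/setDidPl.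
rewrite e1 setDDl; set X := J :\: (U :|: W).
have e2 : J :\: U = W :|: X.
  apply/setP => x; rewrite /X !inE.
  have [xW|_] := boolP (x \in W); last by rewrite orbF.
  by rewrite (subsetP WJ _ xW) (disjointFl dUW xW).
have dWX : [disjoint W & X].
  by rewrite /X disjoints_subset setDE setCI setCK; apply/subsetP => x; rewrite !inE => ->; rewrite !orbT.
rewrite e2 inversionsUr // inversionsUl // !exprD.
ring.
Qed.

Lemma ext_mul1 : left_id ext_one ext_mul.
Proof.
move=> a; apply/ffunP => J; rewrite !ffunE (sum_if1 (i := set0)) ?sub0set //.
  by rewrite ffunE eqxx inversions0l setD0 expr0 !mul1r.
by move=> S _ /negbTE S0; rewrite ffunE S0 mul0r mulr0.
Qed.

Lemma ext_1mul : right_id ext_one ext_mul.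
Proof.
move=> a; apply/ffunP => J; rewrite !ffunE (sum_if1 (i := J)) //.
  by rewrite ffunE setDv eqxx inversions0r expr0 mulr1 mul1r.
move=> S SJ SJ'; rewrite ffunE setD_eq0.
have -> : (J \subset S) = false by apply/negbTE; apply: contraNN SJ' => JS; rewrite eqEsubset SJ.
by rewrite !mulr0.
Qed.

Lemma ext_mulDl : left_distributive ext_mul +%R.
Proof.
move=> a b c; apply/ffunP => J; rewrite !ffunE -big_split /=.
by apply: eq_bigr => S _; rewrite ffunE mulrDl mulrDr.
Qed.

Lemma ext_mulDr : right_distributive ext_mul +%R.
Proof.
move=> a b c; apply/ffunP => J; rewrite !ffunE -big_split /=.
by apply: eq_bigr => S _; rewrite ffunE !mulrDr.
Qed.

Lemma ext_one_neq0 : ext_one != 0.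
Proof. by apply/eqP => /ffunP/(_ set0)/eqP; rewrite !ffunE eqxx oner_eq0. Qed.

HB.instance Definition _ := GRing.Zmodule_isNzRing.Build ext
  ext_mulA ext_mul1 ext_1mul ext_mulDl ext_mulDr ext_one_neq0.

Lemma extM a b J : (a * b) J = \sum_(S : {set 'I_m} | S \subset J)
     (-1) ^+ inversions S (J :\: S) * (a S * b (J :\: S)).
Proof. by rewrite ffunE. Qed.

Lemma ext0E J : (0 : ext) J = 0. Proof. by rewrite ffunE. Qed.
Lemma extDE a b J : (a + b) J = a J + b J. Proof. by rewrite ffunE. Qed.
Lemma extNE a J : (- a) J = - a J. Proof. by rewrite ffunE. Qed.
Lemma extBE a b J : (a - b) J = a J - b J. Proof. by rewrite !ffunE. Qed.
Lemma ext_sumE (K : Type) (r : seq K) (P : pred K) (F : K -> ext) J :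
  (\sum_(i <- r | P i) F i) J = \sum_(i <- r | P i) F i J.
Proof.
by apply: (big_morph (fun a : ext => a J)) => [a b|]; rewrite ?extDE ?ext0E.
Qed.

(** The grading automorphism by the number of [u]s; in a Koszul algebra the [v]s have
    even degree, so that it is also the sign of the total degree. *)
Definition psi a : ext := [ffun J : {set 'I_m} => (-1) ^+ #|J| * a J].

Fact psi_is_zmod : zmod_morphism psi.
Proof. by move=> a b; apply/ffunP => J; rewrite !ffunE mulrBr. Qed.
HB.instance Definition _ := GRing.isZmodMorphism.Build ext ext psi psi_is_zmod.

Fact psi_is_monoid : monoid_morphism psi.
Proof.
split; first by apply/ffunP => J; rewrite !ffunE; case: eqP => [->|]; rewrite ?mulr0 ?cards0 ?mul1r.
move=> a b; apply/ffunP => J; rewrite ffunE !extM mulr_sumr; apply: eq_bigr => S SJ.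
rewrite !ffunE (_ : #|J| = (#|S| + #|J :\: S|)%N); first by rewrite exprD; ring.
by rewrite -(cardsID S J) (setIidPr SJ).
Qed.
HB.instance Definition _ := GRing.isMonoidMorphism.Build ext ext psi psi_is_monoid.

Lemma psiK : involutive psi.
Proof. by move=> a; apply/ffunP => J; rewrite !ffunE signrMK. Qed.

(** Contraction with the dual of [u_j]. *)
Definition iota_ j a : ext := [ffun I : {set 'I_m} =>
  if j \notin I then (-1) ^+ below I j * a (j |: I) else 0].

Fact iota_is_zmod j : zmod_morphism (iota_ j).
Proof. by move=> a b; apply/ffunP => J; rewrite !ffunE; case: ifP; rewrite ?subr0 // mulrBr. Qed.
HB.instance Definition _ j :=
  GRing.isZmodMorphism.Build ext ext (iota_ j) (iota_is_zmod j).

(** The Koszul differential is a combination of contractions, so that its Leibniz rule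
    reduces to this one. *)
Lemma iotaM j a b : iota_ j (a * b) = iota_ j a * b + psi a * iota_ j b.
Proof.
apply/ffunP => I; rewrite extDE !extM ffunE; case: ifPn => [jI|]; last first.
  rewrite negbK => jI; apply/esym/eqP; rewrite addr_eq0 -sumrN; apply/eqP.
  (* The terms of u_j a_(j |: S) b and of a_(j |: S) u_j b cancel. *)
  rewrite (bigID (fun S : {set 'I_m} => j \in S)) /= big1 ?add0r; last first.
    by move=> S /andP[_ jS]; rewrite ffunE jS mul0r mulr0.
  rewrite [RHS](bigID (fun S : {set 'I_m} => j \in S)) /= [X in _ = _ + X]big1 ?addr0; last first.
    by move=> S /andP[_ jS]; rewrite !ffunE in_setD jS jI !mulr0 oppr0.
  rewrite [RHS](reindex_onto (fun S : {set _} => j |: S) (fun S : {set _} => S :\ j)) /=; last first.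
    by move=> S /andP[_ jS]; rewrite setD1K.
  apply: eq_big => [S|S].
    rewrite setU11 andbT; apply/andP/andP => [[SI jS]|[jSI /eqP e]].
      by rewrite setU1K // eqxx subUset sub1set jI.
    split; first by move: jSI; rewrite subUset => /andP[].
    by rewrite -e !inE eqxx.
  move=> /andP[SI jS]; rewrite !ffunE jS in_setD setU11 /= cardsU1 jS.
  have -> : I :\: (j |: S) = (I :\: S) :\ j.
    by apply/setP => x; rewrite !inE negb_or andbA.
  have jIS : j \in I :\: S by rewrite in_setD jS.
  set I' := (I :\: S) :\ j.
  have -> : I :\: S = j |: I' by rewrite setD1K.
  have jI' : j \notin I' by rewrite !inE eqxx.
  rewrite inversionsUr ?disjoints1 // inversionsUl ?disjoints1 // inversions1l.
  rewrite exprS !exprD.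
  have e := inversions1C jS; rewrite inversions1l in e.
  rewrite -e exprD.
  transitivity ((-1) ^+ below I' j * (-1) ^+ below I' j * ((-1) ^+ inversions S [set j] *
    (-1) ^+ inversions S I' * ((-1) ^+ below S j * a (j |: S) * b (j |: I')))); last by ring.
  by rewrite -expr2 sqrr_sign; ring.
rewrite extM (bigID (fun S : {set 'I_m} => j \in S)) /= mulrDr; congr (_ + _).
  rewrite (reindex_onto (fun S : {set _} => j |: S) (fun S : {set _} => S :\ j)) /=; last first.
    by move=> S /andP[_ jS]; rewrite setD1K.
  rewrite mulr_sumr; apply: eq_big => [S|S].
    rewrite !inE eqxx andbT /= setUC; apply/andP/idP => [[/subsetP h /eqP e]|SI].
      apply/subsetP => x xS; have := h x; rewrite !inE xS /= => /(_ isT).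
      by have : x \in S by []; rewrite -{1}e !inE => /andP[/negPf->].
    have jS : j \notin S by apply: contra jI; exact: subsetP.
    rewrite setUC setU1K // eqxx setUS //.
  move=> /andP[/andP[sj _] /eqP e].
  have jS : j \notin S by rewrite -e !inE eqxx.
  have eD : (j |: I) :\: (j |: S) = I :\: S.
    by apply/setP => x; rewrite !inE negb_or -andbA; case: (x =P j) => [->|_] //=; rewrite (negPf jI) andbF.
  have SI : S \subset I by move: sj; rewrite subUset => /andP[_ /subsetP h]; apply/subsetP => x xS; have := h x xS; rewrite !inE; case: eqP => // xj; rewrite -xj xS in jS.
  rewrite eD ffunE jS /=.
  have -> : below I j = (below S j + below (I :\: S) j)%N.
    rewrite -belowU ?setDE ?setUIr ?setUCr ?setIT; first by move/setUidPr: SI => ->.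
    by rewrite disjoints_subset setCI setCK subsetUr.
  rewrite inversionsUl; last by rewrite disjoints1.
  rewrite inversions1l !exprD.
  transitivity ((-1) ^+ below (I :\: S) j * (-1) ^+ below (I :\: S) j *
    ((-1) ^+ below S j * ((-1) ^+ inversions S (I :\: S) * (a (j |: S) * b (I :\: S))))); first by ring.
  by rewrite -expr2 sqrr_sign; ring.
rewrite mulr_sumr; apply: eq_big => [S|S].
  apply/andP/idP => [[/subsetP h jS]|SI].
    apply/subsetP => x xS; have := h x xS; rewrite !inE; case: eqP => // xj.
    by rewrite -xj xS in jS.
  split; first by apply: subset_trans SI (subsetUr _ _).
  by apply: contra jI; exact: subsetP.
move=> /andP[sj jS].
have eD : (j |: I) :\: S = j |: (I :\: S).
  by apply/setP => x; rewrite !inE; case: (x =P j) => [->|_] //=; rewrite jS.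
have SI : S \subset I by move: sj => /subsetP h; apply/subsetP => x xS; have := h x xS; rewrite !inE; case: eqP => // xj; rewrite -xj xS in jS.
rewrite eD !ffunE in_setD (negPf jI) andbF /=.
have -> : below I j = (below S j + below (I :\: S) j)%N.
  rewrite -belowU ?setDE ?setUIr ?setUCr ?setIT; first by move/setUidPr: SI => ->.
  by rewrite disjoints_subset setCI setCK subsetUr.
rewrite inversionsUr; last by rewrite disjoints1 in_setD (negPf jI) andbF.
have e := inversions1C jS; rewrite inversions1l in e.
by rewrite !exprD -e exprD; ring.
Qed.

Lemma iota_iota i j a : iota_ i (iota_ j a) = - iota_ j (iota_ i a).
Proof.
apply/ffunP => I; rewrite !ffunE.
case: (eqVneq i j) => [<-|ij]; first by rewrite !inE eqxx /=; case: ifP; rewrite ?mulr0 oppr0.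
rewrite !inE [j == i]eq_sym (negPf ij) /=.
case: (boolP (i \in I)) => iI /=; first by case: ifP; rewrite ?mulr0 ?oppr0.
case: (boolP (j \in I)) => jI /=; rewrite ?mulr0 ?oppr0 //.
rewrite !belowU ?disjoints1 // setUCA !exprD.
have -> : (-1) ^+ below [set i] j = - (-1) ^+ below [set j] i :> R.
  have := below1C ij; case: (below [set i] j) (below [set j] i) => [|[|?]] [|[|?]] // _.
  by rewrite expr1 opprK.
ring.
Qed.

Lemma iota_iota0 i a : iota_ i (iota_ i a) = 0.
Proof. by apply/ffunP => I; rewrite !ffunE !inE eqxx /=; case: ifP; rewrite ?mulr0. Qed.

Lemma psi_iota j a : psi (iota_ j a) = - iota_ j (psi a).
Proof.
apply/ffunP => I; rewrite !ffunE; case: ifPn => jI; last by rewrite mulr0 oppr0.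
by rewrite cardsU1 jI exprS; ring.
Qed.

Definition ext_const (r : R) : ext := [ffun J : {set 'I_m} => if J == set0 then r else 0].

Lemma ext_constM r a J : (ext_const r * a) J = r * a J.
Proof.
rewrite extM (sum_if1 (i := set0)) ?sub0set //.
  by rewrite ffunE eqxx inversions0l setD0 expr0 mul1r.
by move=> S _ /negbTE S0; rewrite ffunE S0 mul0r mulr0.
Qed.

Lemma ext_Mconst r a J : (a * ext_const r) J = r * a J.
Proof.
rewrite extM (sum_if1 (i := J)) //.
  by rewrite ffunE setDv eqxx inversions0r expr0 mul1r mulrC.
move=> S SJ SJ'; rewrite ffunE setD_eq0.
have -> : (J \subset S) = false by apply/negbTE; apply: contraNN SJ' => JS; rewrite eqEsubset SJ.
by rewrite !mulr0.
Qed.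

Lemma ext_constC r a : ext_const r * a = a * ext_const r.
Proof. by apply/ffunP => J; rewrite ext_constM ext_Mconst. Qed.

Lemma psi_const r : psi (ext_const r) = ext_const r.
Proof. by apply/ffunP => J; rewrite !ffunE; case: eqP => [->|]; rewrite ?cards0 ?mul1r ?mulr0. Qed.

Lemma iota_const j r : iota_ j (ext_const r) = 0.
Proof.
apply/ffunP => J; rewrite !ffunE; case: ifP => // jJ.
by rewrite -[_ == set0]subset0 subUset sub1set inE /= mulr0.
Qed.

Lemma iota_constM j r a : iota_ j (ext_const r * a) = ext_const r * iota_ j a.
Proof. by rewrite iotaM iota_const mul0r add0r psi_const. Qed.

Definition uvar w : ext := [ffun S : {set 'I_m} => (S == [set w])%:R].

Lemma iota_uvar j w : iota_ j (uvar w) = (j == w)%:R.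
Proof.
apply/ffunP => J; rewrite !ffunE.
have -> : (((j == w)%:R : ext) J) = ((j == w) && (J == set0))%:R.
  by case: (j == w); rewrite /= ?mulr0n ?mulr1n ?ffunE.
case: (boolP (j \in J)) => jJ /=.
  have -> : (J == set0) = false by apply/eqP => J0; rewrite J0 inE in jJ.
  by rewrite andbF.
case: (eqVneq J set0) => [->|J0] /=.
  rewrite andbT setU0 /below (_ : [set i in set0 | _] = set0) ?cards0 ?mul1r; last by apply/setP => i; rewrite !inE.
  by rewrite (inj_eq set1_inj).
rewrite andbF (_ : (j |: J == [set w]) = false) ?mulr0 //.
apply/eqP => /setP e; case/set0Pn: J0 => x xJ.
have := e x; rewrite !inE xJ orbT => /esym/eqP xw.
by have := e j; rewrite !inE eqxx => /esym/eqP jw; move: jJ; rewrite jw -xw xJ.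
Qed.

Lemma uvarM w c S : (uvar w * c) S =
  if w \in S then (-1) ^+ below (S :\ w) w * c (S :\ w) else 0.
Proof.
rewrite extM; case: ifPn => wS.
  rewrite (sum_if1 (i := [set w])) ?sub1set //.
    by rewrite ffunE eqxx mul1r inversions1l.
  by move=> T _ /negPf Tw; rewrite ffunE Tw mul0r mulr0.
rewrite big1 // => T TS; rewrite ffunE; case: eqP => [Tw|]; last by rewrite mul0r mulr0.
by move: wS; rewrite -sub1set -Tw TS.
Qed.

Lemma psi_uvar w : psi (uvar w) = - uvar w.
Proof. by apply/ffunP => S; rewrite !ffunE; case: eqP => [->|_]; rewrite ?cards1 ?mulr0 ?oppr0 // expr1 mulN1r. Qed.

Section Koszul.
Variable x : 'I_m -> R.

(** Contraction with the vector [x], restricted to the coordinates in [A]. *)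
Definition ext_dI (A : {set 'I_m}) a : ext := \sum_(j in A) ext_const (x j) * iota_ j a.
Definition ext_d a : ext := ext_dI setT a.

Fact ext_dI_is_zmod A : zmod_morphism (ext_dI A).
Proof. by move=> a b; rewrite -sumrB; apply: eq_bigr => j _; rewrite raddfB mulrBr. Qed.
HB.instance Definition _ A :=
  GRing.isZmodMorphism.Build ext ext (ext_dI A) (ext_dI_is_zmod A).
Fact ext_d_is_zmod : zmod_morphism ext_d.
Proof. exact: ext_dI_is_zmod. Qed.
HB.instance Definition _ := GRing.isZmodMorphism.Build ext ext ext_d ext_d_is_zmod.

Lemma ext_dIE A a I : ext_dI A a I =
  \sum_(j in A | j \notin I) (-1) ^+ below I j * (x j * a (j |: I)).
Proof.
rewrite ext_sumE big_mkcondr; apply: eq_bigr => j _; rewrite ext_constM ffunE.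
by case: ifP; rewrite ?mulr0 // mulrCA.
Qed.

Lemma ext_dE a I : ext_d a I =
  \sum_(j | j \notin I) (-1) ^+ below I j * (x j * a (j |: I)).
Proof. by rewrite /ext_d ext_dIE; apply: eq_bigl => j; rewrite inE. Qed.

Lemma ext_dIM A a b : ext_dI A (a * b) = ext_dI A a * b + psi a * ext_dI A b.
Proof.
rewrite mulr_suml mulr_sumr -big_split; apply: eq_bigr => j _ /=.
by rewrite iotaM mulrDr !mulrA; congr (_ + _); rewrite ext_constC.
Qed.

Lemma ext_dM a b : ext_d (a * b) = ext_d a * b + psi a * ext_d b.
Proof. exact: ext_dIM. Qed.

Lemma psi_dI A a : psi (ext_dI A a) = - ext_dI A (psi a).
Proof.
rewrite raddf_sum -sumrN; apply: eq_bigr => j _ /=.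
by rewrite rmorphM /= psi_const psi_iota mulrN.
Qed.

Lemma psi_d a : psi (ext_d a) = - ext_d (psi a).
Proof. exact: psi_dI. Qed.

Lemma iota_dI A w a : iota_ w (ext_dI A a) = - ext_dI A (iota_ w a).
Proof.
rewrite raddf_sum -sumrN; apply: eq_bigr => j _ /=.
by rewrite iota_constM iota_iota mulrN.
Qed.

Lemma iota_d w a : iota_ w (ext_d a) = - ext_d (iota_ w a).
Proof. exact: iota_dI. Qed.

Lemma ext_constM_dI A r a : ext_dI A (ext_const r * a) = ext_const r * ext_dI A a.
Proof.
rewrite mulr_sumr; apply: eq_bigr => j _; rewrite iota_constM !mulrA.
by congr (_ * _); rewrite ext_constC.
Qed.

Lemma ext_constM_d r a : ext_d (ext_const r * a) = ext_const r * ext_d a.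
Proof. exact: ext_constM_dI. Qed.

Lemma dI_dIC A B a : ext_dI A (ext_dI B a) = - ext_dI B (ext_dI A a).
Proof.
transitivity (\sum_(j in A) - ext_dI B (ext_const (x j) * iota_ j a)).
  by apply: eq_bigr => j _; rewrite iota_dI mulrN ext_constM_dI.
by rewrite sumrN -raddf_sum.
Qed.

(* The terms (i, j) and (j, i) cancel; 2 may not be regular in R. *)
Lemma dI_dI A a : ext_dI A (ext_dI A a) = 0.
Proof.
have h1 (r : seq 'I_m) : \sum_(i <- r) ext_const (x i) * iota_ i
      (\sum_(j <- r) ext_const (x j) * iota_ j a) = 0 :> ext.
  elim: r => [|i r IH]; first by rewrite big_nil.
  have -> : \sum_(j <- i :: r) ext_const (x j) * iota_ j a =
      ext_const (x i) * iota_ i a + \sum_(j <- r) ext_const (x j) * iota_ j a.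
    by rewrite big_cons.
  rewrite big_cons raddfD /= iota_constM iota_iota0 mulr0 add0r.
  under [X in _ + X]eq_bigr => j _ do rewrite raddfD mulrDr /=.
  rewrite big_split /= IH addr0 raddf_sum mulr_sumr -big_split big1 //= => j _.
  rewrite !iota_constM [iota_ j (iota_ i a)]iota_iota !mulrN !mulrA.
  by rewrite [ext_const (x j) * _]ext_constC subrr.
have e b : ext_dI A b = \sum_(i <- enum A) ext_const (x i) * iota_ i b.
  by rewrite /ext_dI big_enum.
by rewrite 2!e h1.
Qed.

Lemma d_d a : ext_d (ext_d a) = 0.
Proof. exact: dI_dI. Qed.

Lemma d_uvar w : ext_d (uvar w) = ext_const (x w).
Proof.
rewrite /ext_d /ext_dI (sum_if1 (i := w)) ?inE //; first by rewrite iota_uvar eqxx mulr1.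
by move=> j _ /negPf jw; rewrite iota_uvar jw mulr0.
Qed.

Lemma d_uvarM w c : ext_d (uvar w * c) = ext_const (x w) * c - uvar w * ext_d c.
Proof. by rewrite ext_dM d_uvar psi_uvar mulNr. Qed.

End Koszul.
End Exterior.

(** * Massey sums and gauge transformations *)

Section Convolution.
Variable R : pzRingType.
Implicit Types a b c : nat -> nat -> R.

(** The product of strictly upper triangular matrices. *)
Definition conv a b i j : R := \sum_(i.+1 <= s < j) a i s * b s j.

Lemma conv_eq (a a' b b' : nat -> nat -> R) i j :
  (forall s, (i < s < j)%N -> a i s = a' i s) ->
  (forall s, (i < s < j)%N -> b s j = b' s j) -> conv a b i j = conv a' b' i j.
Proof. by move=> ea eb; apply: eq_big_nat => s si; rewrite ea ?eb. Qed.

Lemma conv_mem (S : R -> Prop) a b i j : S 0 -> (forall x y, S x -> S y -> S (x + y)) ->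
  (forall s, (i < s < j)%N -> S (a i s * b s j)) -> S (conv a b i j).
Proof. by move=> S0 SD h; rewrite /conv big_nat_cond; apply: big_ind => // s /andP[+ _]; exact: h. Qed.

Lemma conv_ord N a b i j : (j <= N)%N ->
  conv a b i j = \sum_(s < N | (i < s < j)%N) a i s * b s j.
Proof.
move=> jN; rewrite /conv (big_nat_widen _ _ _ _ _ jN) big_geq_mkord.
by apply: eq_bigl => s; rewrite andbC.
Qed.

Lemma convA a b c i j : conv (conv a b) c i j = conv a (conv b c) i j.
Proof.
rewrite !(@conv_ord j) //.
under eq_bigr => s _ do rewrite (@conv_ord j) 1?ltnW // mulr_suml.
under [RHS]eq_bigr => s _ do rewrite (@conv_ord j) // mulr_sumr.
rewrite (exchange_big_dep (fun t : 'I_j => (i < t < j)%N)) /=; last first.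
  by move=> s t /andP[h1 h2] /andP[h3 h4]; rewrite h3 ltn_ord.
apply: eq_bigr => t /andP[it tj]; apply: eq_big => [s|s _]; last by rewrite mulrA.
by rewrite it ltn_ord !andbT andb_idl // => /(ltn_trans it).
Qed.

Lemma convDl a a' b i j : conv (fun s t => a s t + a' s t) b i j = conv a b i j + conv a' b i j.
Proof. by rewrite /conv -big_split; apply: eq_bigr => s _; rewrite mulrDl. Qed.

Lemma convDr a b b' i j : conv a (fun s t => b s t + b' s t) i j = conv a b i j + conv a b' i j.
Proof. by rewrite /conv -big_split; apply: eq_bigr => s _; rewrite mulrDr. Qed.

Lemma convNl a b i j : conv (fun s t => - a s t) b i j = - conv a b i j.
Proof. by rewrite /conv -sumrN; apply: eq_bigr => s _; rewrite mulNr. Qed.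

Lemma convNr a b i j : conv a (fun s t => - b s t) i j = - conv a b i j.
Proof. by rewrite /conv -sumrN; apply: eq_bigr => s _; rewrite mulrN. Qed.

End Convolution.

Section Gauge.
Variable R : pzRingType.
Variables (d : {additive R -> R}) (psi : {rmorphism R -> R}).
Hypothesis psiK : involutive psi.
Hypothesis d_d : forall x, d (d x) = 0.
Hypothesis dM : forall x y, d (x * y) = d x * y + psi x * d y.
Hypothesis psi_d : forall x, psi (d x) = - d (psi x).

Definition addg (S : R -> Prop) := S 0 /\ forall x y, S x -> S y -> S (x - y).
Definition ideal2 (S : R -> Prop) := addg S /\ forall x y, S x -> S (x * y) /\ S (y * x).

Lemma addg0 S : addg S -> S 0. Proof. by case. Qed.
Lemma addgB S x y : addg S -> S x -> S y -> S (x - y). Proof. by case=> _; exact. Qed.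
Lemma addgN S x : addg S -> S x -> S (- x).
Proof. by move=> hS Sx; rewrite -sub0r; apply: addgB => //; exact: addg0. Qed.
Lemma addgD S x y : addg S -> S x -> S y -> S (x + y).
Proof. by move=> hS Sx Sy; rewrite -(opprK y); apply: addgB => //; exact: addgN. Qed.

(* The working precision is [Null]: solutions are only wanted up to that ideal.  Modulo
   [H] and coboundaries, cocycles have representatives in [M], whose products land in
   [MM], where closedness up to the finer [Zero] implies exactness. *)
Variables Null Zero M H P MM : R -> Prop.
Hypotheses (NullI : ideal2 Null) (ZeroA : addg Zero) (MA : addg M)
  (PI : ideal2 P) (MMA : addg MM).
Hypothesis psi_Null : forall x, Null x -> Null (psi x).
Hypothesis psi_M : forall x, M x -> M (psi x).
Hypothesis psi_H : forall x, H x -> H (psi x).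
Hypothesis MP : forall x, M x -> P x.
Hypothesis dP : forall x, P (d x).
Hypothesis NullM : forall x y, Null x -> M y -> Zero (x * y) /\ Zero (y * x).
Hypothesis HH : forall x y, H x -> H y -> Null (x * y).
Hypothesis HM : forall x y, H x -> M y -> Null (x * y) /\ Null (y * x).
Hypothesis M_M : forall x y, M x -> M y -> MM (x * y).
Hypothesis decompose : forall x, P x -> Null (d x) ->
  exists m b, [/\ M m, Null (d m) & H (x - m - d b)].
Hypothesis exactMM : forall w, MM w -> Zero (d w) -> exists2 y, M y & Null (w - d y).

Let NA : addg Null. Proof. by case: NullI. Qed.
Let PA : addg P. Proof. by case: PI. Qed.
Let Nsym x y : Null (x - y) -> Null (y - x).
Proof. by move=> h; rewrite -opprB; exact: addgN. Qed.
Let Ntrans y x z : Null (x - y) -> Null (y - z) -> Null (x - z).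
Proof. by move=> h h'; rewrite -(subrKA y); exact: addgD. Qed.
Let Neq x y : x = y -> Null (x - y).
Proof. by move=> ->; rewrite subrr; exact: addg0. Qed.
Let ND x y x' y' : Null (x - x') -> Null (y - y') -> Null ((x + y) - (x' + y')).
Proof. by move=> h h'; rewrite opprD addrACA; exact: addgD. Qed.
Let NN x x' : Null (x - x') -> Null (- x - - x').
Proof. by move=> h; rewrite -opprD; exact: addgN. Qed.
Let NM x y x' y' : Null (x - x') -> Null (y - y') -> Null (x * y - x' * y').
Proof.
move=> h h'; have -> : x * y - x' * y' = (x - x') * y + x' * (y - y').
  by rewrite mulrBl mulrBr addrA subrK.
case: NullI => _ id; apply: addgD => //; first by case: (id _ y h).
by case: (id _ x' h').
Qed.
Let Nconv (a a' b b' : nat -> nat -> R) i j :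
  (forall s, (i < s < j)%N -> Null (a i s - a' i s)) ->
  (forall s, (i < s < j)%N -> Null (b s j - b' s j)) ->
  Null (conv a b i j - conv a' b' i j).
Proof.
move=> h h'; rewrite /conv -sumrB big_nat_cond; apply: big_ind => [|x y|s /andP[hs _]].
- exact: addg0.
- exact: addgD.
- by apply: NM; [exact: h|exact: h'].
Qed.

Local Notation "'PSI' a" := (fun i j : nat => psi (a i j)) (at level 9, a at level 8).
Local Notation "'DD' a" := (fun i j : nat => d (a i j)) (at level 9, a at level 8).

Let psi_conv a b i j : psi (conv a b i j) = conv (PSI a) (PSI b) i j.
Proof. by rewrite raddf_sum; apply: eq_bigr => s _ /=; rewrite rmorphM. Qed.

Let d_conv a b i j : d (conv a b i j) = conv (DD a) b i j + conv (PSI a) (DD b) i j.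
Proof. by rewrite raddf_sum /conv -big_split; apply: eq_bigr => s _; rewrite dM. Qed.

(** The defect [nu] of the Maurer-Cartan equation measures how far the products
    are from being cocycles; this is the Bianchi identity. *)
Lemma d_conv_defect c i j (nu := fun i j => d (c i j) - conv (PSI c) c i j) :
  d (conv (PSI c) c i j) = conv c nu i j - conv (PSI nu) c i j.
Proof.
rewrite d_conv.
have -> : conv (DD (PSI c)) c i j = - conv (PSI (DD c)) c i j.
  by rewrite -convNl; apply: conv_eq => // s _; rewrite psi_d opprK.
have e1 : conv (PSI (DD c)) c i j = conv (PSI nu) c i j + conv (conv c (PSI c)) c i j.
  rewrite -convDl; apply: conv_eq => // s _; rewrite /nu raddfB /= psi_conv.
  set X := conv c _ _ _; set Y := conv _ _ _ _.
  suff -> : Y = X by rewrite subrK.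
  by apply: conv_eq => // u _; rewrite psiK.
have e2 : conv (PSI (PSI c)) (DD c) i j = conv c nu i j + conv c (conv (PSI c) c) i j.
  by rewrite -convDr; apply: conv_eq => s _; rewrite ?psiK // /nu subrK.
by rewrite e1 e2 convA opprD addrACA addNr addr0 addrC.
Qed.

(* The entry (i, j) of a' = a + d b + a b - psi(b) a', which says that a' is the
   transform of a by the gauge transformation 1 + b; the products only involve
   entries closer to the diagonal. *)
Definition gauge a b a' i j : R :=
  a i j + d (b i j) + conv a b i j - conv (PSI b) a' i j.

Definition MC a i j := Null (d (a i j) - conv (PSI a) a i j).

(** Both [a] and its transform solve the Maurer-Cartan equation below the diagonal of
    [(i, j)], so the correction terms of [gauge] have the differential that the
    transform needs at [(i, j)]. *)
Lemma gauge_d (a b a' : nat -> nat -> R) i j :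
  (forall s t, (i <= s)%N -> (s < t)%N -> (t <= j)%N -> (t - s < j - i)%N ->
     [/\ MC a s t, MC a' s t & a' s t = gauge a b a' s t]) ->
  Null (d (conv a b i j - conv (PSI b) a' i j) -
        (conv (PSI a') a' i j - conv (PSI a) a i j)).
Proof.
move=> h.
have hl s : (i < s < j)%N -> [/\ MC a i s, MC a' i s & a' i s = gauge a b a' i s].
  by move=> /andP[is_ sj]; apply: h => //; lia.
have hr s : (i < s < j)%N -> [/\ MC a s j, MC a' s j & a' s j = gauge a b a' s j].
  by move=> /andP[is_ sj]; apply: h => //; lia.
have eR : conv (PSI a') a' i j - conv (PSI a) a i j =
    conv (conv (PSI a) a) b i j + conv (PSI a) (DD b) i j +
    conv (PSI (DD b)) a' i j - conv b (conv (PSI a') a') i j.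
  have e1 : conv (PSI a') a' i j = conv (PSI a) a' i j + conv (PSI (DD b)) a' i j +
      conv (PSI a) (conv (PSI b) a') i j - conv b (conv (PSI a') a') i j.
    rewrite -!convA -!convDl -convNl -convDl; apply: conv_eq => // s /hl[_ _ ->].
    rewrite /gauge raddfB !raddfD /= !psi_conv; congr (_ - _).
    by apply: conv_eq => // t _; rewrite psiK.
  have e2 : conv (PSI a) a' i j = conv (PSI a) a i j + conv (PSI a) (DD b) i j +
      conv (conv (PSI a) a) b i j - conv (PSI a) (conv (PSI b) a') i j.
    rewrite convA -!convDr -convNr -convDr; apply: conv_eq => // s /hr[_ _ ->] //.
  rewrite e1 e2 [LHS](ACl (1*8*(4*6)*3*2*5*7)) /=.
  by rewrite subrr add0r addNr add0r.
have eL : d (conv a b i j - conv (PSI b) a' i j) =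
    conv (DD a) b i j + conv (PSI a) (DD b) i j + conv (PSI (DD b)) a' i j -
    conv (PSI (PSI b)) (DD a') i j.
  rewrite raddfB /= !d_conv opprD addrA; congr (_ + _ - _).
  by rewrite -convNl; apply: conv_eq => // s _; rewrite psi_d.
rewrite eL eR; apply: (ND _ (NN _)); first apply: ND; first apply: ND.
- by apply: Nconv => s /hl[? _ _] //; apply: Neq.
- exact: Neq.
- exact: Neq.
- by apply: Nconv => s /hr[_ ? _]; [apply: Neq; rewrite psiK|].
Qed.

(** The errors in [H] disappear from products, so the sum for [a'] may be computed with
    the representatives [c], and the products of these are exact by hypothesis. *)
Lemma conv_exact (a' c : nat -> nat -> R) i j :
  (forall s, (i < s < j)%N -> [/\ M (c i s), H (a' i s - c i s) & MC c i s]) ->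
  (forall s, (i < s < j)%N -> [/\ M (c s j), H (a' s j - c s j) & MC c s j]) ->
  Null (conv (PSI a') a' i j - conv (PSI c) c i j) /\
  exists2 y, M y & Null (conv (PSI c) c i j - d y).
Proof.
move=> hl hr.
set w := conv (PSI c) c i j.
have cw : Null (conv (PSI a') a' i j - w).
  rewrite /w /conv -sumrB big_nat_cond; apply: big_ind => [|? ?|s /andP[hs _]].
  - exact: addg0.
  - exact: addgD.
  have [Mc1 Hc1 _] := hl _ hs.
  have [Mc2 Hc2 _] := hr _ hs.
  set u := a' i s - c i s in Hc1; set v := a' s j - c s j in Hc2.
  have -> : psi (a' i s) * a' s j - psi (c i s) * c s j =
     psi u * v + psi u * c s j + psi (c i s) * v.
    have -> : psi (a' i s) = psi u + psi (c i s) by rewrite -raddfD subrK.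
    have -> : a' s j = v + c s j by rewrite subrK.
    by rewrite mulrDr !mulrDl addrA addrK addrAC.
  apply: addgD => //; first apply: addgD => //.
  - by apply: HH => //; exact: psi_H.
  - by case: (HM (psi_H Hc1) Mc2).
  - by case: (HM Hc2 (psi_M Mc1)).
have MMw : MM w.
  apply: (@conv_mem _ MM) => [||s hs]; first exact: addg0.
    by move=> *; exact: addgD.
  have [Mc1 _ _] := hl _ hs.
  have [Mc2 _ _] := hr _ hs.
  by apply: M_M => //; exact: psi_M.
have Zdw : Zero (d w).
  rewrite d_conv_defect; apply: addgB => //;
    apply: (@conv_mem _ Zero) => [||s hs]; do ?[exact: addg0|by move=> *; exact: addgD]; first last.
    have [_ _ Mc1] := hl _ hs.
    have [Mc2 _ _] := hr _ hs.
    by case: (NullM (psi_Null Mc1) Mc2).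
  have [Mc1 _ _] := hl _ hs.
  have [_ _ Mc2] := hr _ hs.
  by case: (NullM Mc2 Mc1).
by split; [exact: cw|exact: exactMM].
Qed.

(** By induction on the distance [t] to the diagonal: the sum of products that an entry has
    to bound is bounded by some [y] in [M]; the difference with [y] is a cocycle up to
    [Null], which [decompose] moves into [M] by a coboundary, and the latter becomes the
    entry of the gauge transformation. *)
Lemma gauge_exists (n : nat) (a : nat -> nat -> R) :
  (forall i j, (i < j <= n)%N -> (j - i < n)%N -> P (a i j) /\ MC a i j) ->
  forall t, (t < n)%N -> exists b a' c, forall i j, (i < j <= n)%N -> (j - i <= t)%N ->
    [/\ a' i j = gauge a b a' i j, P (a' i j), M (c i j), H (a' i j - c i j) &
        MC a' i j /\ MC c i j].
Proof.
move=> ha; elim=> [|t IH] tn.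
  by exists a, a, a => i j; lia.
have [|b [a' [c hc]]] := IH; first exact: ltnW.
have step (p : nat * nat) : exists q : R * R * R, (p.1 < p.2 <= n)%N -> (p.2 - p.1 = t.+1)%N ->
    let x := a p.1 p.2 + conv a b p.1 p.2 - conv (PSI b) a' p.1 p.2 in
    [/\ q.1.2 = x + d q.1.1, P q.1.2, M q.2, H (q.1.2 - q.2) &
      Null (d q.1.2 - conv (PSI a') a' p.1 p.2) /\ Null (d q.2 - conv (PSI c) c p.1 p.2)].
  case: p => i j /=.
  have [/andP[/andP[ij jn] /eqP jit]|hn] := boolP ((i < j <= n)%N && (j - i == t.+1)%N); last first.
    by exists (0, 0, 0) => h1 h2; rewrite h1 h2 eqxx in hn.
  set x := a i j + _ - _.
  have hl s : (i < s < j)%N -> (i < s <= n)%N /\ (s - i <= t)%N by lia.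
  have hr s : (i < s < j)%N -> (s < j <= n)%N /\ (j - s <= t)%N by lia.
  have [Pa Ma] : P (a i j) /\ MC a i j by apply: ha; lia.
  have PD u v i' j' : (forall s, (i' < s < j')%N -> P (v s j')) -> P (conv u v i' j').
    move=> h; apply: (@conv_mem _ P) => [||s hs]; first exact: addg0.
      by move=> *; exact: addgD.
    by case: PI => _ id; case: (id _ (u i' s) (h s hs)).
  have Px : P x.
    apply: addgB => //; first apply: addgD => //.
      rewrite /conv; apply: (@conv_mem _ P); [exact: addg0|by move=> *; exact: addgD|].
      move=> s hs; have [Pas _] : P (a i s) /\ MC a i s by apply: ha; lia.
      by case: PI => _ id; case: (id _ (b s j) Pas).
    by apply: PD => s /hr[h1 h2]; case: (hc _ _ h1 h2).
  have dx : Null (d x - conv (PSI a') a' i j).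
    have := @gauge_d a b a' i j; set LHS := d _; set RHS := conv _ _ _ _ - _ => hg.
    have {}hg : Null (LHS - RHS).
      apply: hg => s u h1 h2 h3 h4; have [hst1 hst2] : (s < u <= n)%N /\ (u - s <= t)%N by lia.
      have [? _ _ _ [? _]] := hc _ _ hst1 hst2.
      by split=> //; case: (ha s u) => //; lia.
    have -> : x = a i j + (conv a b i j - conv (PSI b) a' i j) by rewrite addrA.
    rewrite raddfD /=.
    have -> : conv (PSI a') a' i j = conv (PSI a) a i j + RHS by rewrite addrC subrK.
    exact: ND.
  have [|s /hr[h1 h2]|cw [y My wy]] := @conv_exact a' c i j.
  - by move=> s /hl[h1 h2]; case: (hc _ _ h1 h2) => _ _ ? ? [].
  - by case: (hc _ _ h1 h2) => _ _ ? ? [].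
  set w := conv (PSI c) c i j in cw wy *.
  have [||m [e [Mm dm Hm]]] := decompose (x := x - y).
  - by apply: addgB => //; exact: MP.
  - by rewrite raddfB; exact: Ntrans dx (Ntrans cw wy).
  exists (- e, x - d e, y + m) => _ _ /=; split.
  - by rewrite raddfN.
  - by apply: addgB.
  - exact: addgD.
  - by rewrite opprD addrA (addrAC _ (- _) (- y)) (addrAC _ (- d e)).
  rewrite raddfB /= d_d subr0; split=> //.
  by rewrite raddfD /= -[w]addr0; apply: ND; [exact: Nsym|rewrite subr0].
have [q hq] := boolp.choice step.
pose upd (u : nat -> nat -> R) (v : R * R * R -> R) i j := if (j - i == t.+1)%N then v (q (i, j)) else u i j.
exists (upd b (fun q => q.1.1)), (upd a' (fun q => q.1.2)), (upd c snd) => i j ij jit.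
have cE (u v u' v' : nat -> nat -> R) : (forall s r, (s < r)%N -> (r - s < j - i)%N -> u s r = u' s r) ->
    (forall s r, (s < r)%N -> (r - s < j - i)%N -> v s r = v' s r) ->
    conv u v i j = conv u' v' i j.
  by move=> h1 h2; apply: conv_eq => s hs; [apply: h1|apply: h2]; lia.
have U u v s r : (s < r)%N -> (r - s < j - i)%N -> upd u v s r = u s r.
  by move=> h1 h2; rewrite /upd; case: eqP => // ?; lia.
rewrite /MC /gauge.
rewrite [conv a (upd _ _) i j](cE _ _ a b) //; last exact: U.
rewrite [conv (PSI (upd b _)) (upd _ _) i j](cE _ _ (PSI b) a'); first last.
- exact: U.
- by move=> s r h1 h2; rewrite U.
rewrite [conv (PSI (upd a' _)) (upd _ _) i j](cE _ _ (PSI a') a'); first last.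
- exact: U.
- by move=> s r h1 h2; rewrite U.
rewrite [conv (PSI (upd c _)) (upd _ _) i j](cE _ _ (PSI c) c); first last.
- exact: U.
- by move=> s r h1 h2; rewrite U.
rewrite /upd; case: eqP => [e|ne].
  have [-> ? ? ? [? ?]] := hq (i, j) ij e; split=> //=.
  by rewrite [RHS](ACl (1*3*4*2)).
by apply: hc => //; lia.
Qed.

(** The Massey sums of [a] and of its transform are cohomologous by [gauge_d], and the
    latter is exact. *)
Lemma massey_exact (n : nat) (a : nat -> nat -> R) : (1 < n)%N ->
  (forall i j, (i < j <= n)%N -> (j - i < n)%N -> P (a i j) /\ MC a i j) ->
  exists y, Null (conv (PSI a) a 0 n - d y).
Proof.
move=> n1 ha; have [|b [a' [c hc]]] := @gauge_exists n a ha n.-1; first by lia.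
have hE s t : (0 <= s)%N -> (s < t)%N -> (t <= n)%N -> (t - s < n)%N ->
    [/\ a' s t = gauge a b a' s t, P (a' s t), M (c s t), H (a' s t - c s t) &
        MC a' s t /\ MC c s t].
  by move=> *; apply: hc; lia.
have [s hs|s hs|cw [y _ wy]] := @conv_exact a' c 0 n.
- by have [||||_ _ ? ? []] := hE 0%N s; lia || split.
- by have [||||_ _ ? ? []] := hE s n; lia || split.
have hg := @gauge_d a b a' 0 n; set x := conv a b 0 n - _ in hg.
exists (y - x).
rewrite raddfB /=.
have h := Ntrans cw wy.
have e : Null (d x - (conv (PSI a') a' 0 n - conv (PSI a) a 0 n)).
  apply: hg => s t h1 h2 h3 h4; have [? _ _ _ [? _]] := hE s t h1 h2 h3 ltac:(lia).
  by split=> //; case: (ha s t) => //; lia.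
rewrite (_ : _ - _ = (conv (PSI a') a' 0 n - d y) +
    (d x - (conv (PSI a') a' 0 n - conv (PSI a) a 0 n))); first exact: addgD.
by rewrite !opprB !addrA [RHS](ACl (4*3*2*(1*5))) /= subrr addr0.
Qed.

End Gauge.

(** * Squarefree multidegrees *)

Section SquareFree.
Variable m : nat.
Implicit Types (F G J S : {set 'I_m}) (e : 'X_{1..m}) (i j : 'I_m).

Definition mset F : 'X_{1..m} := [multinom nat_of_bool (i \in F) | i < m].
Definition mnm_supp e : {set 'I_m} := [set i | (0 < e i)%N].

Lemma msetE F i : mset F i = (i \in F). Proof. by rewrite mnmE. Qed.

Lemma mset_suppK F : mnm_supp (mset F) = F.
Proof. by apply/setP => i; rewrite inE msetE lt0b. Qed.

Lemma mset_inj : injective mset.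
Proof. by move=> F G /(congr1 mnm_supp); rewrite !mset_suppK. Qed.

Lemma mset0 : mset set0 = 0%MM.
Proof. by apply/mnmP => i; rewrite msetE inE mnmE. Qed.

Lemma mset1 i : mset [set i] = U_(i)%MM.
Proof. by apply/mnmP => j; rewrite msetE inE mnm1E eq_sym. Qed.

Lemma mnm_suppD e e' : mnm_supp (e + e')%MM = mnm_supp e :|: mnm_supp e'.
Proof. by apply/setP => i; rewrite !inE mnmDE addn_gt0. Qed.

Lemma mset_split F e e' : mset F = (e + e')%MM ->
  [/\ e = mset (mnm_supp e), e' = mset (mnm_supp e'),
      mnm_supp e :|: mnm_supp e' = F & [disjoint mnm_supp e & mnm_supp e']].
Proof.
move=> eF; have h i : (e i + e' i = (i \in F))%N by rewrite -mnmDE -eF msetE.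
split.
- by apply/mnmP => i; rewrite msetE inE; have := h i; case: (i \in F); lia.
- by apply/mnmP => i; rewrite msetE inE; have := h i; case: (i \in F); lia.
- by rewrite -mnm_suppD -eF mset_suppK.
- rewrite -setI_eq0; apply/eqP/setP => i; rewrite !inE.
  by have := h i; case: (i \in F); lia.
Qed.

Lemma mdeg_mset F : mdeg (mset F) = #|F|.
Proof.
rewrite mdegE -sum1_card [RHS]big_mkcond /=; apply: eq_bigr => i _.
by rewrite msetE; case: (i \in F).
Qed.

End SquareFree.

(** * Face ideals *)

Section FaceIdeal.
Variables (k : comNzRingType) (m : nat) (K : simplicial_complex m).

Lemma mcoeffM_neq0 (p q : {mpoly k[m]}) e : (p * q)@_e != 0 ->
  exists e1 e2, [/\ e = (e1 + e2)%MM, p@_e1 != 0 & q@_e2 != 0].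
Proof.
rewrite -mcoeff_msupp => /msuppM_le/allpairsP[[e1 e2] /= [h1 h2 ->]].
by exists e1, e2; rewrite -!mcoeff_msupp.
Qed.

(** Monomial ideals are described by their monomials; this turns all computations in the
    face ring into conditions on coefficients of polynomials. *)
Lemma face_idealP (f : {mpoly k[m]}) :
  reflect (forall e, mnm_supp e \in faces K -> f@_e = 0) (f \in face_ideal K).
Proof.
apply: (iffP idP) => [/asboolP[q ->] e Ke|f0].
  rewrite raddf_sum big1 //= => J KJ.
  apply/eqP; apply: contraNT KJ => /mcoeffM_neq0[e1 [e2 [ee _]]].
  have -> : \prod_(j in J) 'X_j = 'X_[mset J] :> {mpoly k[m]}.
    rewrite mprodXE; congr 'X_[_]; apply/mnmP => i; rewrite msetE mnm_sumE.
    have [iJ|iJ] := boolP (i \in J).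
      rewrite (bigD1 i) //= mnm1E eqxx big1 // => j /andP[_ ji].
      by rewrite mnm1E (negPf ji).
    by rewrite big1 // => j jJ; rewrite mnm1E; case: eqP => // ji; rewrite -ji jJ in iJ.
  rewrite mcoeffX; case: (mset J =P e2) => [e2E|_]; last by rewrite eqxx.
  move=> _; apply: (facesS _ Ke); rewrite ee mnm_suppD -e2E mset_suppK; exact: subsetUr.
apply/asboolP.
exists (fun J => \sum_(e <- msupp f | mnm_supp e == J) f@_e *: 'X_[e - mset J]).
rewrite {1}[f]mpolyE (bigID (fun e => mnm_supp e \in faces K)) /= big1_seq ?add0r; last first.
  by move=> e /andP[Ke _]; rewrite f0 // scale0r.
rewrite (partition_big (@mnm_supp m) (fun J => J \notin faces K)) //=.
apply: eq_bigr => J KJ; rewrite mulr_suml.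
apply: eq_big => [e|e /andP[_ /eqP eJ]]; first by case: eqP => [->|]; rewrite ?KJ ?andbF.
rewrite -scalerAl; congr (_ *: _).
rewrite (_ : \prod_(j in J) 'X_j = 'X_[\sum_(j in J) U_(j)]); last by rewrite mprodXE.
rewrite -mpolyXD; congr 'X_[_]; apply/mnmP => i.
rewrite mnmDE mnmBE msetE mnm_sumE -eJ inE.
have [iJ|] := ltnP 0 (e i).
  rewrite (bigD1 i) ?inE //= mnm1E eqxx big1 => [|j /andP[_ ji]]; first by rewrite addn0 subnK.
  by rewrite mnm1E (negPf ji).
rewrite leqn0 => /eqP ei; rewrite ei big1 // => j; rewrite inE mnm1E.
by case: eqP => // ->; rewrite ei.
Qed.

Lemma face_projE (f g : {mpoly k[m]}) :
  face_proj K f = face_proj K g <-> f - g \in face_ideal K.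
Proof. by rewrite Quotient.idealrBE; split=> [/eqP|] // /eqP. Qed.

Lemma face_proj_surj (x : face_ring k K) : exists f, x = face_proj K f.
Proof. by exists (repr x); rewrite /face_proj reprK. Qed.

Lemma face_projB : {morph @face_proj k m K : f g / f - g}.
Proof. by move=> f g; rewrite /face_proj raddfB. Qed.

Lemma face_projM : {morph @face_proj k m K : f g / f * g}.
Proof. by move=> f g; rewrite /face_proj rmorphM. Qed.

Lemma face_proj0 : face_proj K (0 : {mpoly k[m]}) = 0.
Proof. by rewrite /face_proj raddf0. Qed.

Lemma face_proj_sum (I : Type) (r : seq I) (P : pred I) (f : I -> {mpoly k[m]}) :
  face_proj K (\sum_(i <- r | P i) f i) = \sum_(i <- r | P i) face_proj K (f i).
Proof. by rewrite /face_proj raddf_sum. Qed.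

Lemma face_proj_sign (f : {mpoly k[m]}) n :
  face_proj K ((-1) ^+ n * f) = (-1) ^+ n * face_proj K f.
Proof. by rewrite /face_proj rmorphM rmorph_sign. Qed.

End FaceIdeal.

(** * The Koszul algebra of the polynomial ring *)

Section PolyKoszul.
Variables (k : comNzRingType) (m : nat).
Implicit Types (F G J S : {set 'I_m}) (e : 'X_{1..m}) (i j : 'I_m).

Definition pkoszul := ext m {mpoly k[m]}.
HB.instance Definition _ := GRing.NzRing.on pkoszul.
Implicit Types a b x y z : pkoszul.

Definition pd : pkoszul -> pkoszul := ext_d (fun j => 'X_j).
HB.instance Definition _ := GRing.Additive.on pd.

Lemma pdD : {morph pd : x y / x + y}. Proof. exact: raddfD. Qed.

Lemma mcoeff_sign n (p : {mpoly k[m]}) e : ((-1) ^+ n * p)@_e = (-1) ^+ n * p@_e.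
Proof. by rewrite -signr_odd -[in RHS]signr_odd !mulr_sign; case: ifP; rewrite ?mcoeffN. Qed.

Lemma mcoeffXM (p : {mpoly k[m]}) j e :
  ('X_j * p)@_e = if (0 < e j)%N then p@_(e - U_(j)) else 0.
Proof.
case: ifP => ej; last first.
  apply/eqP; apply: contraFT ej => /mcoeffM_neq0[e1 [e2 [-> + _]]].
  by rewrite mcoeffX; case: (U_(j)%MM =P e1) => [<-|]; rewrite ?eqxx // mnmDE mnm1E eqxx.
have le : (U_(j) <= e)%MM by apply/mnm_lepP => i; rewrite mnm1E; case: eqP => // <-.
by rewrite mulrC -{1}(submK le) addmC mcoeffMX.
Qed.

Lemma msetD1 F j : j \in F -> (mset F - U_(j))%MM = mset (F :\ j).
Proof.
move=> jF; apply/mnmP => i; rewrite mnmBE !msetE mnm1E !inE eq_sym.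
by case: (eqVneq i j) => [->|]; rewrite /= ?jF ?subn0.
Qed.

Lemma dI_coef (A : {set 'I_m}) a S e : (ext_dI (fun j => 'X_j) A a S)@_e =
  \sum_(j in A | (j \notin S) && (0 < e j)%N) (-1) ^+ below S j * (a (j |: S))@_(e - U_(j)).
Proof.
rewrite ext_dIE raddf_sum big_mkcond [RHS]big_mkcond; apply: eq_bigr => j _ /=.
case: (j \in A) => //=; case: (j \notin S) => //=.
by rewrite mcoeff_sign mcoeffXM; case: ifP; rewrite ?mulr0.
Qed.

Lemma pd_coef a S e : (pd a S)@_e =
  \sum_(j | (j \notin S) && (0 < e j)%N) (-1) ^+ below S j * (a (j |: S))@_(e - U_(j)).
Proof. by rewrite [LHS]dI_coef; apply: eq_bigl => j; rewrite inE. Qed.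

Lemma pkM_coef a b S e : (((a * b) : pkoszul) S)@_e != 0 ->
  exists S1 e1 e2, [/\ S1 \subset S, e = (e1 + e2)%MM, (a S1)@_e1 != 0 & (b (S :\: S1))@_e2 != 0].
Proof.
rewrite extM raddf_sum /= => h.
have [S1 [S1S hS]] : exists S1 : {set 'I_m}, S1 \subset S /\
    ((-1) ^+ inversions S1 (S :\: S1) * (a S1 * b (S :\: S1)))@_e != 0.
  apply/not_existsP => hn; move/eqP: h; apply; rewrite big1 // => S1 S1S.
  by apply/eqP; apply: contra_notT (hn S1) => ?.
have : (a S1 * b (S :\: S1))@_e != 0.
  by move: hS; rewrite -signr_odd mulr_sign; case: ifP; rewrite // mcoeffN oppr_eq0.
by move=> /mcoeffM_neq0[e1 [e2 [? ? ?]]]; exists S1, e1, e2.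
Qed.

(** The part of squarefree multidegree [J]: [u_S v_F] with [S] and [F] complementary in
    [J] only depends on [F]. *)
Definition mcomp J a F : k := (a (J :\: F))@_(mset F).

Definition sg J F j : k := (-1) ^+ below (J :\: F) j.
(** The simplicial coboundary: in multidegree [J] the Koszul differential of a face ring
    is that of the cochains on the full subcomplex on [J]. *)
Definition dc J (c : {set 'I_m} -> k) F : k := \sum_(j in F) sg J F j * c (F :\ j).

Lemma mcomp_is_zmod J F : zmod_morphism (fun a => mcomp J a F).
Proof. by move=> a b; rewrite /mcomp extBE mcoeffB. Qed.
Lemma mcompB J a b F : mcomp J (a - b) F = mcomp J a F - mcomp J b F.
Proof. exact: (mcomp_is_zmod J F). Qed.
Lemma mcomp0 J F : mcomp J 0 F = 0.
Proof. by rewrite /mcomp ext0E mcoeff0. Qed.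

Lemma mcomp_d J a F : F \subset J -> mcomp J (pd a) F = dc J (mcomp J a) F.
Proof.
move=> FJ; rewrite /mcomp pd_coef; apply: eq_big => [j|j /andP[jS ej]].
  by rewrite msetE lt0b in_setD negb_and negbK; case: (j \in F); rewrite /= ?andbF.
rewrite msetE lt0b in ej.
have -> : j |: J :\: F = J :\: (F :\ j).
  apply/setP => i; rewrite !inE; case: (eqVneq i j) => //= ->.
  by rewrite (subsetP FJ).
by rewrite msetD1.
Qed.

(** The product multiplies multidegrees, so only disjoint pairs contribute to a
    squarefree one. *)
Lemma mcomp_mul J a b F : F \subset J -> mcomp J (a * b) F != 0 ->
  exists J1 J2 F1 F2, [/\ [/\ J1 :|: J2 = J, [disjoint J1 & J2], F1 \subset J1 & F2 \subset J2],
    F1 :|: F2 = F, [disjoint F1 & F2], mcomp J1 a F1 != 0 & mcomp J2 b F2 != 0].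
Proof.
move=> FJ /pkM_coef[S1 [e1 [e2 [S1S ee h1 h2]]]].
have [E1 E2 eF dF] := mset_split ee.
move: (mnm_supp e1) (mnm_supp e2) E1 E2 eF dF => F1 F2 E1 E2 eF dF.
have F1F : F1 \subset F by rewrite -eF subsetUl.
have F2F : F2 \subset F by rewrite -eF subsetUr.
have SF : [disjoint S1 & F].
  by apply: disjointWl S1S _; rewrite disjoints_subset setDE subsetIr.
have S2F : [disjoint (J :\: F) :\: S1 & F].
  by rewrite disjoints_subset setDE subIset // setDE subsetIr.
exists (S1 :|: F1), (((J :\: F) :\: S1) :|: F2), F1, F2.
have e1' : (S1 :|: F1) :\: F1 = S1.
  rewrite setDUl setDv setU0; apply/setDidPl; exact: disjointWr SF.
have e2' : ((J :\: F) :\: S1 :|: F2) :\: F2 = (J :\: F) :\: S1.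
  rewrite setDUl setDv setU0; apply/setDidPl; exact: disjointWr S2F.
split=> //; last by rewrite /mcomp e2' -E2.
  split; try exact: subsetUr.
    rewrite setUACA eF (_ : S1 :|: _ = J :\: F); last by rewrite -{1}(setIidPr S1S) setID.
    by rewrite setUC -{1}(setIidPr FJ) setID.
  rewrite -setI_eq0; apply/eqP/setP => i; rewrite !inE.
  have [iS|_] := boolP (i \in S1) => /=.
    by apply/negP => iF2; have := disjointFr SF iS; rewrite (subsetP F2F _ iF2).
  have [iF1|//] := boolP (i \in F1) => /=.
  by rewrite (subsetP F1F _ iF1) /= (disjointFr dF iF1).
by rewrite /mcomp e1' -E1.
Qed.

Definition el J (c : {set 'I_m} -> k) : pkoszul :=
  [ffun S : {set 'I_m} => if S \subset J then c (J :\: S) *: 'X_[mset (J :\: S)] else 0].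

Lemma setDDsub (A B : {set 'I_m}) : A \subset B -> B :\: (B :\: A) = A.
Proof. by move=> AB; rewrite setDDr setDv set0U; apply/setIidPr. Qed.

Lemma mcomp_el J J' c F : F \subset J' -> mcomp J' (el J c) F = if J' == J then c F else 0.
Proof.
move=> FJ; rewrite /mcomp ffunE.
case: eqP => [<-|JJ]; first by rewrite subsetDl setDDsub // mcoeffZ mcoeffX eqxx mulr1.
case: ifP => h; last by rewrite mcoeff0.
rewrite mcoeffZ mcoeffX (inj_eq (@mset_inj m)).
case: eqP => [eF|]; last by rewrite mulr0.
case: JJ; apply/setP => i; have /setP/(_ i) := eF.
have := subsetP h i; have := subsetP FJ i; rewrite !inE.
by case: (i \in F); case: (i \in J); case: (i \in J') => //= H1 H2; do [by have := H1 isT|by have := H2 isT].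
Qed.

Lemma el_coef J c S e : (el J c S)@_e != 0 ->
  [/\ S \subset J, e = mset (J :\: S) & c (J :\: S) != 0].
Proof.
rewrite ffunE; case: ifP => SJ; last by rewrite mcoeff0 eqxx.
by rewrite mcoeffZ mcoeffX; case: (mset (J :\: S) =P e) => [->|_]; rewrite ?mulr0 ?eqxx // mulr1.
Qed.

Definition els (c : {set 'I_m} -> {set 'I_m} -> k) : pkoszul := \sum_J el J (c J).

Lemma mcomp_els c J F : F \subset J -> mcomp J (els c) F = c J F.
Proof.
move=> FJ; rewrite /mcomp ext_sumE raddf_sum (sum_if1 (i := J)) //=.
  by have := mcomp_el J (c J) FJ; rewrite eqxx.
by move=> J' _ JJ; have := mcomp_el J' (c J') FJ; rewrite eq_sym (negPf JJ).
Qed.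

Lemma eq_dc J c c' F : (forall j, j \in F -> c (F :\ j) = c' (F :\ j)) -> dc J c F = dc J c' F.
Proof. by move=> h; apply: eq_bigr => j jF; rewrite h. Qed.

Lemma dcB J c c' F : dc J (fun G => c G - c' G) F = dc J c F - dc J c' F.
Proof. by rewrite -sumrB; apply: eq_bigr => j _; rewrite mulrBr. Qed.

Lemma dc0 J F : dc J (fun=> 0) F = 0.
Proof. by rewrite /dc big1 // => j _; rewrite mulr0. Qed.

Lemma dc_dc J c F : F \subset J -> dc J (dc J c) F = 0.
Proof.
move=> FJ; have FJ' j : F :\ j \subset J by apply: subset_trans FJ; exact: subsetDl.
have eF G : G \subset J -> c G = mcomp J (el J c) G by move=> GJ; rewrite mcomp_el // eqxx.
rewrite (@eq_dc _ _ (mcomp J (pd (el J c)))); last first.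
  move=> j _; rewrite mcomp_d //; apply: eq_dc => i _; apply: eF.
  by apply: subset_trans (FJ' j); exact: subsetDl.
by rewrite -mcomp_d // /pd d_d mcomp0.
Qed.

Lemma sgM J F j : sg J F j * sg J F j = 1.
Proof. by rewrite -expr2 sqrr_sign. Qed.

End PolyKoszul.

(** * Lifting Massey products to polynomial coefficients *)

Section Lift.
Variables (k : comNzRingType) (m : nat) (K : simplicial_complex m).
Implicit Types (F G J S : {set 'I_m}) (e : 'X_{1..m}).
Implicit Types x y z : pkoszul k m.

Definition kface x : Prop := forall S, x S \in face_ideal K.

Lemma kfaceP x : kface x <-> forall S e, mnm_supp e \in faces K -> (x S)@_e = 0.
Proof.
split=> h S; last by apply/face_idealP => e; exact: h.
by move=> e Ke; apply: (elimT (face_idealP _ _) (h S)).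
Qed.

Lemma kface_ideal : ideal2 kface.
Proof.
split; first split.
- by move=> S; rewrite ext0E rpred0.
- by move=> x y hx hy S; rewrite extBE rpredB.
move=> x y hx; split=> S; rewrite extM; apply: rpred_sum => T TS; rewrite mulrA.
- by rewrite -mulrA [x T * _]mulrC mulrA; apply: idealMr.
- by apply: idealMr.
Qed.

Lemma kface_psi x : kface x -> kface (psi x).
Proof. by move=> hx S; rewrite ffunE; apply: idealMr. Qed.

Definition kproj x : koszul k K := [ffun S : {set 'I_m} => face_proj K (x S)].

Lemma kprojE x y : kproj x = kproj y <-> kface (x - y).
Proof.
split=> [/ffunP h S|h].
  by have := h S; rewrite !ffunE => /face_projE.
by apply/ffunP => S; rewrite !ffunE; apply/face_projE; have := h S; rewrite !ffunE.
Qed.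

Lemma kprojB x y : kproj (x - y) = kproj x - kproj y.
Proof. by apply/ffunP => S; rewrite !ffunE face_projB. Qed.
HB.instance Definition _ := GRing.isZmodMorphism.Build (pkoszul k m) (koszul k K) kproj kprojB.

Lemma kprojM x y : kproj (x * y) = koszul_mul (kproj x) (kproj y).
Proof.
apply/ffunP => S; rewrite !ffunE face_proj_sum; apply: eq_bigr => T TS.
by rewrite !ffunE face_proj_sign face_projM.
Qed.

Lemma kproj_d x : kproj (pd x) = koszul_d (kproj x).
Proof.
apply/ffunP => S; rewrite !ffunE ext_dE face_proj_sum; apply: eq_bigr => j jS.
by rewrite !ffunE face_proj_sign face_projM.
Qed.

Lemma kproj_surj (a : koszul k K) : exists x, a = kproj x.
Proof.
have [f hf] := choice (fun S => face_proj_surj (a S)).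
by exists [ffun S => f S]; apply/ffunP => S; rewrite !ffunE.
Qed.

Lemma coboundary_kproj x :
  coboundary (@koszul_d k m K) (kproj x) <-> exists y, kface (x - pd y).
Proof.
split=> [[b]|[y h]].
  by have [y ->] := kproj_surj b; rewrite -kproj_d => /kprojE ?; exists y.
by exists (kproj y); rewrite -kproj_d; apply/kprojE.
Qed.

Definition khomog p x := forall S e, (x S)@_e != 0 -> (#|S| + 2 * mdeg e)%N = p.

Lemma kproj_homog p (a : koszul k K) : koszul_homog p a -> exists2 x, a = kproj x & khomog p x.
Proof.
move=> h; have [f hf] := choice (fun S => (let: ex_intro2 f h1 h2 := h S in ex_intro (fun f => a S = face_proj K f /\ {in msupp f, forall e, (#|S| + 2 * mdeg e)%N = p}) f (conj h1 h2))).
exists [ffun S => f S]; first by apply/ffunP => S; rewrite !ffunE; case: (hf S).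
by move=> S e; rewrite ffunE -mcoeff_msupp; case: (hf S) => _; exact.
Qed.

Lemma homog_kproj p x : khomog p x -> koszul_homog p (kproj x).
Proof.
by move=> h S; exists (x S); rewrite ?ffunE // => e; rewrite mcoeff_msupp => /h.
Qed.

Lemma homog_psi p x : khomog p x -> psi x = (-1) ^+ p * x.
Proof.
move=> h; apply/ffunP => S; rewrite ffunE; apply/mpolyP => e.
have -> : ((-1) ^+ p * x) S = (-1) ^+ p * x S.
  by rewrite -signr_odd -[in RHS]signr_odd !mulr_sign; case: ifP; rewrite ?ffunE.
rewrite -signr_odd -[in RHS]signr_odd !mulr_sign.
have [x0|/h <-] := eqVneq ((x S)@_e) 0.
  by do 2?case: ifP => _; rewrite ?mcoeffN x0 ?oppr0.
by rewrite oddD oddM /= addbF; case: ifP.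
Qed.

Lemma kproj_sign n x : kproj ((-1) ^+ n * x) = kproj x *~ (-1) ^+ n.
Proof.
rewrite -signr_odd -[in RHS]signr_odd mulr_sign.
by case: (odd n); rewrite ?expr1 ?expr0 ?mulr1z // mulrN1z raddfN.
Qed.

(** A defining system is a solution of the Maurer-Cartan equation, the sign of the degree
    being [psi] on homogeneous elements.  Lifted to polynomial coefficients it solves the
    equation modulo the face ideal, and of the degrees only the vanishing of constant
    terms is retained. *)
Lemma golod_lift :
  (forall n (a : nat -> nat -> pkoszul k m), (1 < n)%N ->
     (forall i j, (i < j <= n)%N -> (j - i < n)%N ->
        (a i j set0)@_0 = 0 /\
        kface (pd (a i j) - conv (fun i j => psi (a i j)) a i j)) ->
     exists y, kface (conv (fun i j => psi (a i j)) a 0 n - pd y)) ->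
  golod k K.
Proof.
move=> hyp; split.
  move=> p q a b p0 q0 [+ da] [+ db].
  move=> /kproj_homog[x ax hx] /kproj_homog[y bY hy]; subst a b.
  pose u i j := if (i == 0%N) && (j == 1%N) then x else if (i == 1%N) && (j == 2%N) then y else 0.
  have [//|i j /andP[ij j2] ji|z] := hyp 2%N u.
    have -> : conv (fun i j => psi (u i j)) u i j = 0.
      by rewrite /conv big_geq //; lia.
    rewrite subr0 /u.
    have h t r : (0 < r)%N -> khomog r t -> koszul_d (kproj t) = 0 -> (t set0)@_0 = 0 /\ kface (pd t).
      move=> r0 ht dt; split.
        apply: contraTeq r0 => /ht; rewrite cards0 mdeg0 => <-; by [].
      rewrite -[pd t]subr0; apply/kprojE; rewrite kproj_d dt; apply/ffunP => S.
      by rewrite !ffunE face_proj0.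
    case: i ij ji => [|[|i]]; case: j j2 => [|[|[|j]]] //= *; try lia; first exact: h hx da.
    exact: h hy db.
  have -> : conv (fun i j => psi (u i j)) u 0 2 = psi x * y.
    by rewrite /conv big_nat1 /u /=.
  move=> hz; rewrite -kprojM; apply/coboundary_kproj; exists ((-1) ^+ p * z).
  rewrite (homog_psi hx) -mulrA in hz.
  have -> : pd ((-1) ^+ p * z) = (-1) ^+ p * pd z.
    by rewrite -signr_odd !mulr_sign; case: ifP; rewrite ?raddfN.
  have -> : x * y - (-1) ^+ p * pd z = (-1) ^+ p * ((-1) ^+ p * (x * y) - pd z).
    by rewrite mulrBr mulrA -expr2 sqrr_sign mul1r.
  by case: kface_ideal => _ /(_ _ ((-1) ^+ p) hz)[].
move=> n n3 p c hc z [a [ha1 ha2] ->].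
have deg1 i j : (i < j <= n)%N -> (0 < massey_deg p i j)%N.
  move=> /andP[ij jn]; rewrite /massey_deg.
  suff : (j - i <= \sum_(i <= s < j) p s)%N by lia.
  rewrite -[X in (X <= _)%N]muln1 -sum_nat_const_nat big_nat_cond [X in (_ <= X)%N]big_nat_cond.
  by apply: leq_sum => s /andP[/andP[_ sj] _]; case: (hc s) => //; lia.
have hom i j : (i < j <= n)%N -> (j - i < n)%N -> koszul_homog (massey_deg p i j) (a i j).
  move=> /andP[ij jn] ji; have [ji1|ne] := eqVneq j i.+1.
    rewrite ji1 /massey_deg big_nat1 subSnn subn0; rewrite ji1 in jn.
    by case: (ha1 i jn) => -[].
  by case: (ha2 i j); [lia|apply/eqP => -[]; lia|].
have mc i j : (i < j <= n)%N -> (j - i < n)%N -> koszul_d (a i j) = massey_sum (@koszul_mul k m K) p a i j.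
  move=> /andP[ij jn] ji; have [ji1|ne] := eqVneq j i.+1.
    rewrite ji1 /massey_sum big_geq //; rewrite ji1 in jn.
    by case: (ha1 i jn) => -[].
  by case: (ha2 i j); [lia|apply/eqP => -[]; lia|].
have lift (q : nat * nat) : exists x, a q.1 q.2 = kproj x /\
    ((q.1 < q.2 <= n)%N -> (q.2 - q.1 < n)%N -> khomog (massey_deg p q.1 q.2) x).
  case: q => i j /=; have [/andP[ij ji]|hn] := boolP ((i < j <= n)%N && (j - i < n)%N).
    by have [x ? ?] := kproj_homog (hom i j ij ji); exists x.
  have [x ?] := kproj_surj (a i j); exists x; split=> // h1 h2.
  by rewrite h1 h2 in hn.
have [u hu] := choice lift; pose v i j := u (i, j).
have av i j : a i j = kproj (v i j) by case: (hu (i, j)).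
have hv i j : (i < j <= n)%N -> (j - i < n)%N -> khomog (massey_deg p i j) (v i j) by case: (hu (i, j)).
have cv i j : (i < j <= n)%N -> kproj (conv (fun i j => psi (v i j)) v i j) = massey_sum (@koszul_mul k m K) p a i j.
  move=> ij; rewrite /conv raddf_sum /massey_sum !big_nat; apply: eq_bigr => s /andP[is_ sj].
  by rewrite /= kprojM !av (homog_psi (hv i s _ _)) ?kproj_sign //; lia.
have [||y hy] := hyp n v; first by lia.
  move=> i j ij ji; split.
    have := deg1 i j ij; apply: contraTeq => /(hv i j ij ji).
    by rewrite cards0 mdeg0 => <-.
  by apply/kprojE; rewrite kproj_d cv // -av mc.
rewrite -cv; last by lia.
by apply/coboundary_kproj; exists y.
Qed.

End Lift.

(** * Multidegrees that are not squarefree *)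

Section NonSquareFree.
Variables (k : comNzRingType) (m : nat) (K : simplicial_complex m).

Lemma mpoly_shift (f : {mpoly k[m]}) (i : 'I_m) (P : pred 'X_{1..m}) :
  exists g : {mpoly k[m]}, forall e, g@_e = if P e then f@_(e + U_(i)) else 0.
Proof.
exists (\sum_(e <- msupp f | (U_(i) <= e)%MM && P (e - U_(i))%MM) f@_e *: 'X_[e - U_(i)]) => e.
rewrite raddf_sum /=.
have h e' : (U_(i) <= e')%MM -> ((e' - U_(i))%MM == e) = (e' == (e + U_(i))%MM).
  move=> le; apply/eqP/eqP => [<-|->]; first by rewrite submK.
  by rewrite addmK.
have [ein|eout] := boolP ((e + U_(i))%MM \in msupp f); last first.
  rewrite big_seq_cond big1 => [|e' /and3P[e'f le _]].
    by case: ifP => // _; apply/esym/eqP; rewrite mcoeff_eq0.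
  rewrite mcoeffZ mcoeffX h //; case: eqP => [ee|]; last by rewrite mulr0.
  by rewrite -ee e'f in eout.
rewrite big_mkcond (bigD1_seq _ ein (msupp_uniq f)) /= big1 ?addr0.
  have le : (U_(i) <= e + U_(i))%MM by apply/mnm_lepP => j; rewrite mnmDE leq_addl.
  by rewrite le addmK /=; case: ifP => // _; rewrite mcoeffZ mcoeffX eqxx mulr1.
move=> e' ne; case: ifP => // /andP[le _].
by rewrite mcoeffZ mcoeffX h // (negPf ne) mulr0.
Qed.

(** In a multidegree with an exponent at least 2, say at [i], every monomial is
    divisible by [v_i], so [v_i -> u_i] is a contracting homotopy: cocycles of the
    Koszul algebra of a face ring live in squarefree multidegrees. *)
Lemma squarefree_exact (z : pkoszul k m) :
  (forall J F : {set 'I_m}, F \subset J -> F \in faces K -> mcomp J z F = 0) ->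
  kface K (pd z) -> exists y, kface K (z - pd y).
Proof.
move=> sqf dz.
pose bad (e : 'X_{1..m}) : option 'I_m := [pick i | (1 < e i)%N].
have [g hg] := choice (fun q : {set 'I_m} * 'I_m =>
  mpoly_shift (z (q.1 :\ q.2)) q.2 (fun e => bad (mset q.1 + e)%MM == Some q.2)).
pose y : pkoszul k m := [ffun T : {set 'I_m} => \sum_(i in T) (-1) ^+ below (T :\ i) i * g (T, i)].
have yE (T : {set 'I_m}) e : (y T)@_e = \sum_(i in T | bad (mset T + e)%MM == Some i)
    (-1) ^+ below (T :\ i) i * (z (T :\ i))@_(e + U_(i)).
  rewrite ffunE raddf_sum big_mkcondr; apply: eq_bigr => i iT.
  by rewrite /= mcoeff_sign hg /=; case: ifP; rewrite ?mulr0.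
have mdegE (S : {set 'I_m}) (e : 'X_{1..m}) j : j \notin S -> (0 < e j)%N ->
    (mset (j |: S) + (e - U_(j)) = mset S + e)%MM.
  move=> jS ej; apply/mnmP => i; rewrite !mnmDE mnmBE !msetE mnm1E !inE eq_sym.
  by case: (eqVneq i j) => [->|_] /=; rewrite ?(negPf jS) ?subn0 //=; lia.
have step1 (S : {set 'I_m}) e : mnm_supp e \in faces K ->
    (forall i, bad (mset S + e)%MM = Some i -> i \notin S) -> ((z - pd y) S)@_e = 0.
  move=> Ke nS; rewrite extBE mcoeffB pd_coef.
  case eb: (bad (mset S + e)%MM) => [i|]; last first.
    rewrite big1 ?subr0 => [|j /andP[jS ej]].
      have e1 i : ((mset S + e)%MM i <= 1)%N.
        by move: eb; rewrite /bad; case: pickP => // /(_ i); rewrite ltnNge => /negbFE.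
      have eF : e = mset (mnm_supp e).
        by apply/mnmP => i; have := e1 i; rewrite mnmDE !msetE inE; case: (i \in S); lia.
      have dSF : [disjoint S & mnm_supp e].
        rewrite -setI_eq0; apply/eqP/setP => i; rewrite !inE; have := e1 i.
        by rewrite mnmDE msetE; case: (i \in S) => //=; lia.
      have := sqf (S :|: mnm_supp e) (mnm_supp e) (subsetUr _ _) Ke.
      rewrite /mcomp -eF (_ : _ :\: _ = S) //.
      by rewrite setDUl setDv setU0; apply/setDidPl.
    by rewrite yE mdegE // eb big1 ?mulr0 // => i /andP[_].
  have iS := nS i eb.
  have ei : (1 < e i)%N.
    move: eb; rewrite /bad; case: pickP => // i' + [ii]; rewrite ii.
    by rewrite mnmDE msetE (negPf iS).
  rewrite (sum_if1 (i := i)); first last.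
  - move=> j /andP[jS ej] ji; rewrite yE mdegE // eb big1 ?mulr0 // => i' /andP[+ /eqP[ii]].
    by rewrite -ii !inE eq_sym (negPf ji) (negPf iS).
  - by rewrite iS /=; lia.
  rewrite yE mdegE ?eb //; last by lia.
  rewrite (sum_if1 (i := i)); first last.
  - by move=> j /andP[_ /eqP[->]]; rewrite eqxx.
  - by rewrite setU11 eqxx.
  rewrite setU1K // submK; last by apply/mnm_lepP => j; rewrite mnm1E; case: eqP => // <-; lia.
  by rewrite mulrA -expr2 sqrr_sign mul1r subrr.
have dz' : kface K (pd (z - pd y)).
  by rewrite raddfB /= /pd d_d subr0.
exists y; apply/kfaceP => S e Ke.
case eb: (bad (mset S + e)%MM) => [i|]; last by apply: step1 => //; rewrite eb.
have [iS|iS] := boolP (i \in S); last by apply: step1 => // j; rewrite eb => -[<-].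
have ei : (0 < e i)%N.
  move: eb; rewrite /bad; case: pickP => // i' + [ii]; rewrite ii.
  by rewrite mnmDE msetE iS.
have sE : mnm_supp (e + U_(i))%MM = mnm_supp e.
  rewrite mnm_suppD -mset1 mset_suppK; apply/setUidPl; by rewrite sub1set inE.
have /kfaceP/(_ (S :\ i) (e + U_(i))%MM) := dz'; rewrite sE => /(_ Ke).
rewrite pd_coef (sum_if1 (i := i)); first last.
- move=> j /andP[jS ej] ji; rewrite step1 ?mulr0 //.
    apply: facesS Ke; rewrite -sE; apply/subsetP => t; rewrite !inE mnmBE; lia.
  have := mdegE (S :\ i) (e + U_(i))%MM j jS ej => -> i'.
  have -> : (mset (S :\ i) + (e + U_(i)) = mset S + e)%MM.
    have := mdegE (S :\ i) (e + U_(i))%MM i; rewrite addmK setD1K // => -> //.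
      by rewrite !inE eqxx.
    by rewrite mnmDE mnm1E eqxx addn1.
  by rewrite eb => -[<-]; rewrite !inE eqxx orbF eq_sym.
- by rewrite !inE eqxx mnmDE mnm1E eqxx addn1.
rewrite setD1K // addmK => h.
by rewrite -[LHS]mul1r -(sqrr_sign k (below (S :\ i) i)) expr2 -mulrA h mulr0.
Qed.

End NonSquareFree.

(** * A criterion for Golodness *)

Lemma setU1D1 (T : finType) (F : {set T}) (x j : T) : x != j -> (x |: F) :\ j = x |: F :\ j.
Proof. by move=> xj; rewrite setDUl (setDidPl _) // disjoints1 inE. Qed.

Lemma card_exchange (T : finType) (F : {set T}) (y j : T) :
  j \in F -> y \notin F -> #|y |: F :\ j| = #|F|.
Proof. by move=> jF yF; rewrite cardsU1 !inE (negPf yF) andbF (cardsD1 j F) jF. Qed.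

Fact card_arith (n a b e e' f u v : nat) : (n + 2 <= e + e' -> e = u + a -> e' = v + b ->
  u = 1 -> v = 1 -> a + b <= f -> f.+1 < n -> False)%N.
Proof. lia. Qed.

Section Cone.
Variables (k : comNzRingType) (m : nat) (J : {set 'I_m}).
Implicit Types (F G : {set 'I_m}) (c : {set 'I_m} -> k).

(** Homotopy along the matching of [F] with [t |: F], restricted to the pairs
    in which the larger face satisfies [P]. *)
Definition cone t (P : pred {set 'I_m}) c F : k :=
  if (t \notin F) && P (t |: F) then sg k J (t |: F) t * c (t |: F) else 0.

Lemma dc_cone t (P : pred {set 'I_m}) c G : t \in G -> P G -> dc J (cone t P c) G = c G.
Proof.
move=> tG PG; rewrite /dc (sum_if1 (i := t)) //.
  by rewrite /cone !inE eqxx setD1K // PG mulrA sgM mul1r.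
by move=> j jG jt; rewrite /cone !inE eq_sym jt tG /= mulr0.
Qed.

Lemma dc_cone0 t (P : pred {set 'I_m}) c G :
  (forall j, j \in G -> t \notin G :\ j -> ~~ P (t |: G :\ j)) -> dc J (cone t P c) G = 0.
Proof.
move=> h; rewrite /dc big1 // => j jG; rewrite /cone.
case: ifP => [/andP[h1 h2]|_]; last by rewrite mulr0.
by have := h j jG h1; rewrite h2.
Qed.

Lemma dc_eq0 t c G : t \notin G -> dc J c (t |: G) = 0 ->
  (forall j, j \in G -> c ((t |: G) :\ j) = 0) -> c G = 0.
Proof.
move=> tG + h; rewrite /dc (sum_if1 (i := t)) ?setU11 //; last first.
  by move=> j; rewrite !inE => /orP[->//|jG] jt; rewrite h ?mulr0.
by rewrite setU1K // => e; rewrite -[LHS]mul1r -(sgM k J (t |: G) t) -mulrA e mulr0.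
Qed.

End Cone.

Section Support.
Variables (k : comNzRingType) (m : nat).
Implicit Types (F G J : {set 'I_m}) (x y : pkoszul k m) (Q : {set 'I_m} -> {set 'I_m} -> Prop).

(** All the subgroups to which [massey_exact] is applied are of this form. *)
Definition carried Q x := forall J F, F \subset J -> mcomp J x F != 0 -> Q J F.

Lemma carried_addg Q : addg (carried Q).
Proof.
split=> [J F _|x y hx hy J F FJ]; first by rewrite mcomp0 eqxx.
rewrite mcompB; have [x0|/hx h _] := eqVneq (mcomp J x F) 0; last exact: h.
by rewrite x0 sub0r oppr_eq0; exact: hy.
Qed.

Lemma carried_psi Q x : carried Q x -> carried Q (psi x).
Proof.
move=> h J F FJ pF; apply: (h J F FJ); apply: contra_neq pF => xF.
rewrite /mcomp ffunE -signr_odd mulr_sign.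
by case: ifP; rewrite ?mcoeffN -/(mcomp J x F) xF ?oppr0.
Qed.

Lemma carriedM Q1 Q2 Q x y :
  (forall J1 J2 F1 F2, [disjoint J1 & J2] -> F1 \subset J1 -> F2 \subset J2 ->
     [disjoint F1 & F2] -> Q1 J1 F1 -> Q2 J2 F2 -> Q (J1 :|: J2) (F1 :|: F2)) ->
  carried Q1 x -> carried Q2 y -> carried Q (x * y).
Proof.
move=> h hx hy J F FJ /(mcomp_mul FJ)[J1 [J2 [F1 [F2 [[<- ? ? ?] <- ? xF yF]]]]].
by apply: h => //; [exact: hx|exact: hy].
Qed.

End Support.

Section Elimination.
Variables (I : finType) (rk : I -> nat) (lk : I -> {set I}) (EE T : {set {set I}}) (N : nat).
Implicit Types E F G : {set I}.

(** [T] is a complex on the vertices of rank 0 whose minimal non-faces are the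
    members of [EE], to which the other vertices are added by increasing rank, each
    as the apex of a cone over a simplex [lk w].  The last bound keeps the join of two
    missing faces, each with a vertex removed, from having fewer than [N] vertices. *)
Record elimination : Prop := Elimination {
  el_inj : forall w w', (0 < rk w)%N -> rk w = rk w' -> w = w';
  el_lk : forall w y, (0 < rk w)%N -> y \in lk w -> (rk y < rk w)%N;
  el_sub : forall F G, F \subset G -> G \in T -> F \in T;
  el_base : forall F, (forall x, x \in F -> rk x = 0%N) ->
    F \in T <-> forall E, E \in EE -> ~~ (E \subset F);
  el_top : forall F w, w \in F -> (0 < rk w)%N -> (forall x, x \in F -> (rk x <= rk w)%N) ->
    (F \in T) = (F :\ w \subset lk w);
  el_EE : forall E x, E \in EE -> x \in E -> rk x = 0%N;
  el_gt1 : forall E, E \in EE -> (1 < #|E|)%N;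
  el_disj : forall E E', E \in EE -> E' \in EE -> E != E' ->
    [disjoint E & E'] /\ (N + 2 <= #|E| + #|E'|)%N
}.

End Elimination.

Section GolodCriterion.
Variables (k : comNzRingType) (m : nat) (K : simplicial_complex m) (N : nat).
Variables (rk : 'I_m -> nat) (lk : 'I_m -> {set 'I_m}) (EE T : {set {set 'I_m}}).
Implicit Types (E F G J : {set 'I_m}) (c e : {set 'I_m} -> k).

Hypothesis N_gt1 : (1 < N)%N.
Hypothesis el : elimination rk lk EE T N.
Hypothesis K_T : forall F, (#|F| < N)%N -> (F \in faces K) = (F \in T).
Hypothesis K_vertex : forall v, [set v] \in faces K.
Hypothesis K_dim : forall F, F \in faces K -> (#|F| <= N)%N.
Hypothesis K_top : forall J c, exists e, forall F,
  F \in faces K -> #|F| = N -> F \subset J -> c F = dc J e F.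

Let rk_inj := el_inj el.
Let lk_rk := el_lk el.
Let T_sub := el_sub el.
Let T_top := el_top el.
Let EE_base := el_EE el.
Let EE_gt1 := el_gt1 el.
Let EE_disj := el_disj el.

Let T_base F : (forall x, x \in F -> rk x = 0%N) ->
  reflect (forall E, E \in EE -> ~~ (E \subset F)) (F \in T).
Proof. by move=> F0; apply: (iffP idP) => /(el_base el F0). Qed.

Let top F := [exists x in F, (0 < rk x)%N].
Let V0 := [set x | rk x == 0%N].

(* The faces on which cocycle representatives will be supported: those that leave the
   base, and the facets of the boundary of a simplex [E], whose class only occurs in the
   multidegrees [J] that meet the base in [E]. *)
Let good J F := top F || [exists E in EE, (J :&: V0 == E) && (#|F|.+1 == #|E|)].

Let topN F : ~~ top F -> forall x, x \in F -> rk x = 0%N.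
Proof.
rewrite negb_exists_in => /forall_inP h x /h.
by rewrite -leqNgt leqn0 => /eqP.
Qed.

(* On the base, a point of [J] outside all the missing faces contained in [J] is a cone
   point.  Otherwise coning from [x] in [E] confines the cochain to the faces that contain
   [E :\ x]; coning from a point of another missing face [E'] then clears these as well,
   unless they contain [E' :\ y] too, which their size forbids. *)
Let base_rep J c :
  (forall F, F \in T -> F \subset J -> (#|F| < N)%N -> dc J c F = 0) ->
  (J = set0 -> c set0 = 0) ->
  exists b, forall F, F \in T -> F \subset J -> (#|F|.+1 < N)%N ->
    c F - dc J b F != 0 -> F != set0 /\ good J F.
Proof.
move=> dc0c c0.
pose ok b F := F \in T -> F \subset J -> (#|F|.+1 < N)%N -> c F - dc J b F != 0 -> good J F.
suff [b hb] : exists b, forall F, F != set0 -> ok b F.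
  exists b => F FT FJ FN cF.
  have F0 : F != set0.
    apply: contra_neqN cF => /eqP F0; rewrite F0 in FT FJ FN *.
    have db0 : dc J b set0 = 0 by rewrite /dc big_set0.
    rewrite db0 subr0; have [J0|[j jJ]] := set_0Vmem J; first exact: c0.
    apply: (@dc_eq0 _ _ J j); rewrite ?inE // ?setU0; last by move=> i; rewrite inE.
    apply: dc0c; rewrite ?sub1set ?cards1 //.
    by rewrite -K_T ?K_vertex // cards1.
  by split=> //; exact: hb.
have dcK b F : F \in T -> F \subset J -> (#|F| < N)%N -> dc J (fun G => c G - dc J b G) F = 0.
  by move=> FT FJ FN; rewrite dcB dc_dc // subr0 dc0c.
have [/exists_inP[x xJ xE]|hJ] := boolP [exists x in J, (rk x == 0%N) && [forall E in EE, (x \in E) ==> ~~ (E \subset J)]].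
  have {xE} [x0 xE] := andP xE; pose P F := ~~ top F.
  exists (cone J x P c) => F F0 FT FJ FN; apply: contra_neqT => nF.
  have tF : ~~ top F by apply: contra nF => tF; rewrite /good tF.
  have [xF|xF] := boolP (x \in F); first by rewrite dc_cone ?subrr.
  have Px j : P (x |: F :\ j).
    apply/negP => /exists_inP[y]; rewrite !inE => /orP[/eqP->|/andP[_ yF]]; first by rewrite (eqP x0).
    by rewrite (topN tF).
  have PxF : P (x |: F).
    apply/negP => /exists_inP[y]; rewrite !inE => /orP[/eqP->|yF]; first by rewrite (eqP x0).
    by rewrite (topN tF).
  have sJ : x |: F \subset J by rewrite subUset sub1set xJ.
  have xFT : x |: F \in T.
    apply/T_base => [y yx|E EEE]; first exact: topN PxF _ yx.
    have [xE'|xE'] := boolP (x \in E).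
      have /forall_inP/(_ E EEE) := xE; rewrite xE' /=.
      by apply: contra => /subset_trans; apply.
    have := elimT (T_base (topN tF)) FT E EEE.
    by apply: contra => /subsetP h; apply/subsetP => y yE; have := h y yE; rewrite !inE; case: eqP => // yx; rewrite -yx yE in xE'.
  apply: (@dc_eq0 _ _ J x (fun G => c G - dc J (cone J x P c) G)) => //; first by apply: dcK; rewrite // cardsU1 xF.
  move=> j jF; have xj : x != j by apply: contraNneq xF => ->.
  by rewrite setU1D1 // dc_cone ?setU11 ?subrr //; exact: Px.
have {}hJ x : x \in J -> rk x = 0%N -> exists E, [/\ E \in EE, x \in E & E \subset J].
  move=> xJ x0; move: hJ; rewrite negb_exists_in => /forall_inP/(_ x xJ).
  rewrite x0 eqxx /= negb_forall_in => /exists_inP[E EE_E].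
  by rewrite negb_imply negbK => /andP[? ?]; exists E.
have [/exists_inP[x xJ /eqP x0]|noV0] := boolP [exists x in J, rk x == 0%N]; last first.
  exists (fun=> 0) => F /set0Pn[x xF] FT FJ FN _; rewrite /good.
  rewrite (_ : top F) //; apply/exists_inP; exists x => //; rewrite lt0n.
  apply: contra noV0 => x0; apply/exists_inP; exists x => //; exact: (subsetP FJ).
have [E [EEE xE EJ]] := hJ x xJ x0.
have nEF F : ~~ top F -> F \in T -> ~~ (E \subset F).
  by move=> tF FT; exact: (elimT (T_base (topN tF)) FT E).
(* The link of x in the base is everything but the faces containing E minus x. *)
pose P1 F := ~~ top F; pose b1 := cone J x P1 c; pose c1 F := c F - dc J b1 F.
have top1 y F : rk y = 0%N -> ~~ top F -> ~~ top (y |: F).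
  move=> y0 tF; apply/negP => /exists_inP[z]; rewrite !inE => /orP[/eqP->|zF]; first by rewrite y0.
  by rewrite (topN tF).
have topS F G : F \subset G -> ~~ top G -> ~~ top F.
  by move=> FG; apply: contra => /exists_inP[z zF z0]; apply/exists_inP; exists z => //; exact: (subsetP FG).
have TxE y E' F : E' \in EE -> y \in E' -> y \in J -> ~~ top F -> F \in T -> y |: F \notin T -> E' :\ y \subset F.
  move=> EE' yE' yJ tF FT; apply: contraNT => nS.
  apply/T_base => [z zx|E2 EE2]; first exact: topN (top1 y F (EE_base EE' yE') tF) z zx.
  apply/negP => sE2.
  have [yE2|yE2] := boolP (y \in E2); last first.
    have /negP := elimT (T_base (topN tF)) FT E2 EE2; apply.
    by apply/subsetP => z zE; have := subsetP sE2 z zE; rewrite !inE; case: eqP => // zy; rewrite -zy zE in yE2.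
  have E2E : E2 = E'.
    apply/eqP; apply: contraT => ne; have [d _] := EE_disj EE2 EE' ne.
    by rewrite (disjointFr d yE2) in yE'.
  move/negP: nS; apply; rewrite -E2E; apply/subsetP => z; rewrite !inE => /andP[zy zE].
  by have := subsetP sE2 z zE; rewrite !inE (negPf zy).
have c1P F : F \in T -> F \subset J -> (#|F|.+1 < N)%N -> ~~ top F -> c1 F != 0 ->
    x \notin F /\ E :\ x \subset F.
  move=> FT FJ FN tF cF; have xF : x \notin F.
    by apply: contra cF => xF; rewrite /c1 dc_cone ?subrr.
  split=> //; apply: (TxE x E F) => //; apply: contra cF => xFT; apply/eqP.
  apply: (@dc_eq0 _ _ J x c1) => //; first by apply: dcK; rewrite ?cardsU1 ?xF // subUset sub1set xJ.
  move=> j jF; have xj : x != j by apply: contraNneq xF => ->.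
  rewrite /c1 setU1D1 // dc_cone ?setU11 ?subrr //.
  by apply: top1 => //; apply: topS tF; exact: subsetDl.
have [/eqP JE|JE] := boolP (J :&: V0 == E).
  exists b1 => F F0 FT FJ FN cF; rewrite /good; case: (boolP (top F)) => //= tF.
  have [xF EF] := c1P F FT FJ FN tF cF; apply/exists_inP; exists E => //.
  rewrite JE eqxx /=; have -> : F = E :\ x.
    apply/eqP; rewrite eqEsubset EF andbT; apply/subsetP => z zF; rewrite !inE.
    rewrite -JE !inE (subsetP FJ) // (topN tF) // andbT.
    by apply: contraNneq xF => <-.
  by rewrite (cardsD1 x E) xE.
have [y [yJ y0 yE]] : exists y, [/\ y \in J, rk y = 0%N & y \notin E].
  have /subsetPn[y] : ~~ (J :&: V0 \subset E).
    apply: contra JE => JE; rewrite eqEsubset JE /=; apply/subsetP => z zE.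
    by rewrite !inE (subsetP EJ) //= (EE_base EEE zE).
  by rewrite !inE => /andP[yJ /eqP y0] yE; exists y.
have [E' [EEE' yE' EJ']] := hJ y yJ y0.
have [dE cE] : [disjoint E & E'] /\ (N + 2 <= #|E| + #|E'|)%N.
  by apply: EE_disj => //; apply: contraNneq yE => ->.
have xy : x != y by apply: contraNneq yE => <-.
pose P2 F := [&& ~~ top F, x \notin F & E :\ x \subset F].
have c1P2 F : F \in T -> F \subset J -> (#|F|.+1 < N)%N -> ~~ top F -> c1 F != 0 -> P2 F.
  by move=> FT FJ FN tF /(c1P F FT FJ FN tF)[? ?]; apply/and3P.
exists (fun F => b1 F + cone J y P2 c1 F) => F F0 FT FJ FN.
have dE2 G : c G - dc J (fun F => b1 F + cone J y P2 c1 F) G = c1 G - dc J (cone J y P2 c1) G.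
  rewrite /c1 -[RHS]addrA -opprD; congr (_ - _); rewrite -big_split; apply: eq_bigr => j _.
  by rewrite mulrDr.
pose c2 G := c1 G - dc J (cone J y P2 c1) G.
have dc2 G : G \in T -> G \subset J -> (#|G| < N)%N -> dc J c2 G = 0.
  by move=> GT GJ GN; rewrite dcB dc_dc // subr0 dcK.
have P2y G j : j != x -> P2 (y |: G :\ j) -> P2 (G :\ j).
  move=> jx /and3P[t1 x1 s1]; apply/and3P; split.
  - by apply: topS t1; exact: subsetUr.
  - by apply: contra x1 => x1; rewrite in_setU x1 orbT.
  - apply/subsetP => z zE; have := subsetP s1 z zE; rewrite in_setU1; case: eqP => // zy.
    by move: zE; rewrite zy !inE (negPf yE) andbF.
have c2P G : G \in T -> G \subset J -> (#|G|.+1 < N)%N -> ~~ top G -> ~~ P2 G -> c2 G = 0.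
  move=> GT GJ GN tG nP; rewrite /c2 dc_cone0 ?subr0.
    by apply/eqP; apply: contraNT nP; exact: c1P2.
  move=> j jG yG; apply/negP => h.
  have [jx|jx] := eqVneq j x; last first.
    have /and3P[t1 x1 s1] := P2y G j jx h.
    move/negP: nP; apply; apply/and3P; split=> //.
      by apply: contra x1 => x1; rewrite !inE eq_sym jx.
    by apply: subset_trans s1 (subsetDl _ _).
  move/negP: (nEF G tG GT); apply; move: h => /and3P[_ _ s1].
  apply/subsetP => z zE; have [->|zx] := eqVneq z x; first by rewrite -jx.
  have := subsetP s1 z; rewrite !inE zx zE => /(_ isT) /orP[/eqP zy|/andP[]//].
  by rewrite -zy zE in yE.
rewrite dE2 -/(c2 F); apply: contra_neqT => nF.
have tF : ~~ top F by apply: contra nF => tF; rewrite /good tF.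
have [PF|] := boolP (P2 F); last exact: c2P.
have [yF|yF] := boolP (y \in F); first by rewrite /c2 dc_cone ?subrr.
have /and3P[_ xF EF] := PF.
have yFT : y |: F \in T.
  apply: contraT => /(TxE y E' F EEE' yE' yJ tF FT) sE'.
  have : (#|(E :\ x) :|: (E' :\ y)| <= #|F|)%N by apply: subset_leq_card; rewrite subUset EF.
  rewrite cardsU (_ : _ :&: _ = set0) ?cards0 ?subn0; last first.
    apply/eqP; rewrite setI_eq0; apply: disjointWl (subsetDl _ _) _.
    exact: disjointWr (subsetDl _ _) dE.
  move=> le; have := card_arith cE (cardsD1 x E) (cardsD1 y E').
  by rewrite xE yE' => /(_ _ erefl erefl le FN).
apply: (@dc_eq0 _ _ J y c2) => //.
  by apply: dc2; rewrite ?cardsU1 ?yF // subUset sub1set yJ.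
move=> j jF; have yj : y != j by apply: contraNneq yF => ->.
have eyj : (y |: F) :\ j = y |: F :\ j by rewrite setU1D1.
have sT : (y |: F) :\ j \subset y |: F by exact: subsetDl.
have tyF := top1 y F y0 tF.
have [P2j|nP2] := boolP (P2 ((y |: F) :\ j)).
  by rewrite /c2 dc_cone ?subrr // eyj setU11.
apply: c2P => //.
- exact: T_sub sT yFT.
- by apply: subset_trans sT _; rewrite subUset sub1set yJ.
- by rewrite eyj card_exchange.
- exact: topS sT tyF.
Qed.

(* By induction on the rank [i] cleared so far: the vertex [w0] of rank [i.+1] is glued
   along a simplex, which is a cone from any of its vertices [t] in [J]; if there is none,
   [w0] is isolated, and only contributes to faces of size 1. *)
Let top_exact J w :
  (forall F, F \in T -> F \subset J -> (#|F| < N)%N -> w F != 0 -> top F /\ (1 < #|F|)%N) ->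
  (forall F, F \in T -> F \subset J -> (#|F| <= N)%N -> dc J w F = 0) ->
  exists e, (forall F, e F != 0 -> top F) /\
    forall F, F \in T -> F \subset J -> (#|F| < N)%N -> w F = dc J e F.
Proof.
move=> wtop dw.
have step i : exists e, (forall F, e F != 0 -> top F) /\
    forall F, F \in T -> F \subset J -> (#|F| < N)%N -> w F - dc J e F != 0 ->
    (exists2 x, x \in F & (i < rk x)%N) /\ (1 < #|F|)%N.
  elim: i => [|i [e [etop he]]].
    exists (fun=> 0); split=> [F|F FT FJ FN]; first by rewrite eqxx.
    by rewrite dc0 subr0 => /(wtop F FT FJ FN)[/exists_inP[x xF x0] ?]; split=> //; exists x.
  pose c F := w F - dc J e F.
  have dcc F : F \in T -> F \subset J -> (#|F| <= N)%N -> dc J c F = 0.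
    by move=> FT FJ FN; rewrite dcB dc_dc // subr0 dw.
  have hc F : F \in T -> F \subset J -> (#|F| < N)%N -> (forall x, x \in F -> (rk x <= i)%N) -> c F = 0.
    move=> FT FJ FN hF; apply/eqP; apply: contraT => /(he F FT FJ FN)[[x xF]].
    by rewrite ltnNge hF.
  have hc2 F : F \in T -> F \subset J -> (#|F| < N)%N -> (#|F| <= 1)%N -> c F = 0.
    move=> FT FJ FN F1; apply/eqP; apply: contraT => /(he F FT FJ FN)[_].
    by rewrite ltnNge F1.
  have [/existsP[w0 /andP[w0J /eqP rw0]]|nw0] := boolP [exists w0, (w0 \in J) && (rk w0 == i.+1)]; last first.
    exists e; split=> // F FT FJ FN cF; have [[x xF ix] F1] := he F FT FJ FN cF.
    split=> //; exists x => //; move: ix; rewrite leq_eqVlt => /orP[/eqP ix|//].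
    case/negP: nw0; apply/existsP; exists x; rewrite -ix eqxx andbT; exact: (subsetP FJ).
  have w0_gt0 : (0 < rk w0)%N by rewrite rw0.
  pose P F := (w0 \in F) && [forall x in F, (rk x <= i.+1)%N].
  have PT F : P F -> (F \in T) = (F :\ w0 \subset lk w0).
    by move=> /andP[wF /forall_inP hF]; apply: T_top => // x xF; rewrite rw0 hF.
  have nP F : ~~ P F -> (forall x, x \in F -> (rk x <= i.+1)%N) -> forall x, x \in F -> (rk x <= i)%N.
    move=> nPF hF x xF; have := hF x xF; rewrite leq_eqVlt ltnS => /orP[/eqP rx|//].
    case/negP: nPF; apply/andP; split; last by apply/forall_inP.
    by rewrite -(rk_inj _ (etrans rx (esym rw0))) // rx.
  have fin c' : (forall F, F \in T -> F \subset J -> (#|F| < N)%N ->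
       (forall x, x \in F -> (rk x <= i.+1)%N) -> c' F = 0) ->
      forall F, F \in T -> F \subset J -> (#|F| < N)%N -> c' F != 0 -> exists2 x, x \in F & (i.+1 < rk x)%N.
    move=> h F FT FJ FN cF; have [/exists_inP //|] := boolP [exists x in F, (i.+1 < rk x)%N].
    rewrite negb_exists_in => /forall_inP hF; case/eqP: cF; apply: h => // x xF.
    by rewrite leqNgt hF.
  have [lJ0|[t]] := set_0Vmem (lk w0 :&: J).
    exists e; split=> // F FT FJ FN cF; split; last by case: (he F FT FJ FN cF).
    apply: (fin c) cF => // G GT GJ GN hG; have [PG|nPG] := boolP (P G); last first.
      by apply: hc => //; exact: nP.
    apply: hc2 => //; have := GT; rewrite PT // => /subsetP sG.
    have /subset_leq_card : G \subset [set w0].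
      apply/subsetP => x xG; rewrite inE; apply: contraT => xw.
      have /setP/(_ x) := lJ0; rewrite !inE (subsetP GJ) // andbT sG //.
      by rewrite !inE xw.
    by rewrite cards1.
  rewrite inE => /andP[tl tJ].
  have rt : (rk t <= i)%N by have := lk_rk w0_gt0 tl; rewrite rw0 ltnS.
  have tw0 : w0 != t by apply: contraTneq rt => <-; rewrite rw0 ltnn.
  have PtU F : P (t |: F) = P F.
    rewrite /P !inE (negPf tw0) /=; case: (w0 \in F) => //=.
    apply/forall_inP/forall_inP => h x; first by move=> xF; apply: h; rewrite !inE xF orbT.
    by rewrite !inE => /orP[/eqP->|/h//]; exact: leqW.
  have PtT F : P F -> F \in T -> t |: F \in T.
    move=> PF; rewrite !PT ?PtU // => FT; apply/subsetP => x.
    by rewrite !inE => /andP[xw /orP[/eqP->//|xF]]; apply: (subsetP FT); rewrite !inE xw.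
  exists (fun F => e F + cone J t P c F); split=> [F|].
    rewrite /cone; case: ifP => [/andP[tF]|_]; last by rewrite addr0; exact: etop.
    rewrite PtU => /andP[wF _] _; apply/exists_inP; exists w0 => //.
  have dE G : w G - dc J (fun F => e F + cone J t P c F) G = c G - dc J (cone J t P c) G.
    rewrite /c -[RHS]addrA -opprD; congr (_ - _); rewrite -big_split; apply: eq_bigr => j _.
    by rewrite mulrDr.
  pose c2 G := c G - dc J (cone J t P c) G.
  have w0out G : w0 \notin G -> dc J (cone J t P c) G = 0.
    move=> wG; apply: dc_cone0 => j jG _; apply/negP; rewrite PtU => /andP[+ _].
    by rewrite !inE (negPf wG) andbF.
  have c2P G : G \in T -> G \subset J -> (#|G| < N)%N -> P G -> t \in G -> c2 G = 0.
    by move=> GT GJ GN PG tG; rewrite /c2 dc_cone ?subrr.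
  have c20 G : G \in T -> G \subset J -> (#|G| < N)%N -> (forall x, x \in G -> (rk x <= i.+1)%N) -> c2 G = 0.
    move=> GT GJ GN hG; have [PG|nPG] := boolP (P G); last first.
      rewrite /c2 hc ?w0out ?subrr //; last by exact: nP.
      by apply: contra nPG => wG; apply/andP; split=> //; apply/forall_inP.
    have [tG|tG] := boolP (t \in G); first exact: c2P.
    have tJG : t |: G \subset J by rewrite subUset sub1set tJ.
    apply: (@dc_eq0 _ _ J t c2) => //.
      rewrite dcB dc_dc // subr0; apply: dcc => //; first exact: PtT.
      by rewrite cardsU1 tG.
    move=> j jG; have tj : t != j by apply: contraNneq tG => ->.
    rewrite setU1D1 //; set G' := t |: G :\ j.
    have G'T : G' \in T.
      by apply: T_sub (PtT G PG GT); rewrite /G' -setU1D1 // subsetDl.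
    have G'J : G' \subset J by rewrite /G' -setU1D1 // (subset_trans _ tJG) // subsetDl.
    have G'N : (#|G'| < N)%N by rewrite /G' card_exchange.
    have [PG'|nPG'] := boolP (P G'); first by apply: c2P; rewrite // setU11.
    have hG' x : x \in G' -> (rk x <= i.+1)%N.
      by rewrite !inE => /orP[/eqP->|/andP[_ /hG//]]; exact: leqW.
    rewrite /c2 hc ?w0out ?subrr //; last by exact: nP.
    by apply: contra nPG' => wG; apply/andP; split=> //; apply/forall_inP.
  move=> F FT FJ FN; rewrite dE => cF; split; first exact: (fin c2).
  rewrite ltnNge; apply: contra cF => F1; rewrite hc2 // sub0r oppr_eq0; apply/eqP.
  have [wF|] := boolP (w0 \in F); last exact: w0out.
  apply: dc_cone0 => j jF _; rewrite PtU; apply/negP => /andP[+ _].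
  rewrite !inE => /andP[wj _]; move: F1; rewrite leqNgt => /negP; apply.
  by rewrite (cardsD1 w0) wF (cardsD1 j) !inE jF eq_sym wj.
have [e [etop he]] := step (\max_x rk x); exists e; split=> // F FT FJ FN.
apply/eqP; rewrite -subr_eq0; apply: contraT => /(he F FT FJ FN)[[x _]].
by rewrite ltnNge (leq_bigmax x).
Qed.

Let Fin n F := F \in T /\ (#|F| < n)%N.
Let Zero := carried (k := k) (fun J F => ~ Fin N.+1 F).
Let Null := carried (k := k) (fun J F => ~ Fin N F).
Let H := carried (k := k) (fun J F => ~ Fin N.-1 F).
Let M := carried (k := k) (fun J F => Fin N.+1 F -> F != set0 /\ good J F).
Let P := carried (k := k) (fun J F => J != set0).
Let MM := carried (k := k) (fun J F => Fin N F -> top F /\ (1 < #|F|)%N).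

Let carried0 (x : pkoszul k m) n : carried (fun J F => ~ Fin n F) x <->
  forall J F, F \subset J -> F \in T -> (#|F| < n)%N -> mcomp J x F = 0.
Proof.
split=> h J F FJ; last by move=> xF [FT Fn]; rewrite h ?eqxx in xF.
by move=> FT Fn; apply/eqP; apply: contraT => /(h J F FJ) [].
Qed.

Let FinU n F1 F2 : Fin n (F1 :|: F2) -> Fin n F1 /\ Fin n F2.
Proof.
move=> [FT Fn]; split; split.
- by apply: T_sub FT; exact: subsetUl.
- by apply: leq_ltn_trans Fn; apply: subset_leq_card; exact: subsetUl.
- by apply: T_sub FT; exact: subsetUr.
- by apply: leq_ltn_trans Fn; apply: subset_leq_card; exact: subsetUr.
Qed.

Let FinUn n n' F1 F2 : [disjoint F1 & F2] -> F2 != set0 -> (n.-1 <= n')%N ->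
  Fin n (F1 :|: F2) -> Fin n' F1.
Proof.
move=> d F20 nn hF; have [[F1T _] _] := FinU hF; split=> //.
case: hF => _; rewrite cardsU (disjoint_setI0 d) cards0 subn0.
by move: F20; rewrite -card_gt0; clear -nn; lia.
Qed.

Let cardU_disj F1 F2 : [disjoint F1 & F2] -> #|F1 :|: F2| = (#|F1| + #|F2|)%N.
Proof. by move=> d; rewrite cardsU (disjoint_setI0 d) cards0 subn0. Qed.

Let M_M x y : M x -> M y -> MM (x * y).
Proof.
apply: carriedM => J1 J2 F1 F2 dJ sF1 sF2 dF h1 h2 hF.
have [hF1 hF2] := FinU hF.
have up F : Fin N F -> Fin N.+1 F by move=> [FT Fn]; split=> //; exact: leqW.
have [F10 g1] := h1 (up _ hF1); have [F20 g2] := h2 (up _ hF2).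
split; last first.
  by rewrite cardU_disj //; move: F10 F20; rewrite -!card_gt0; clear; lia.
have [/exists_inP[x0 xF x00]|t1] := boolP (top F1).
  by apply/exists_inP; exists x0; rewrite // inE xF.
have [/exists_inP[x0 xF x00]|t2] := boolP (top F2).
  by apply/exists_inP; exists x0; rewrite // inE xF orbT.
move: g1 g2; rewrite /good (negPf t1) (negPf t2) /=.
move=> /exists_inP[E1 EE1 /andP[/eqP JE1 /eqP c1]] /exists_inP[E2 EE2 /andP[/eqP JE2 /eqP c2]].
have [_ c] : [disjoint E1 & E2] /\ (N + 2 <= #|E1| + #|E2|)%N.
  apply: EE_disj => //; apply/eqP => E12; have := EE_gt1 EE1.
  rewrite (_ : E1 = set0) ?cards0 //; apply/setP => z; rewrite inE; apply/negP => zE.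
  have zJ1 : z \in J1 by move: zE; rewrite -JE1 inE => /andP[].
  have zJ2 : z \in J2 by move: zE; rewrite E12 -JE2 inE => /andP[].
  by rewrite (disjointFr dJ zJ1) in zJ2.
exfalso; case: hF => _; rewrite cardU_disj //; move: c; rewrite -c1 -c2.
by rewrite addn2 addSn addnS !ltnS leqNgt => /negP.
Qed.

(* The faces of [T] of size [N] are out of reach of [base_rep], hence the truncation. *)
Let decompose x : P x -> Null (pd x) ->
  exists m b, [/\ M m, Null (pd m) & H (x - m - pd b)].
Proof.
move=> Px /carried0 dx.
have x0 J : J = set0 -> mcomp J x set0 = 0.
  by move=> J0; apply/eqP; apply: contraT => /(Px J set0 (sub0set _)); rewrite J0 eqxx.
have [b hb] := choice (fun J => @base_rep J (mcomp J x)
  (fun F FT FJ FN => etrans (esym (mcomp_d x FJ)) (dx J F FJ FT FN)) (x0 J)).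
set x1 := x - pd (els b).
have x1E J F : F \subset J -> mcomp J x1 F = mcomp J x F - dc J (b J) F.
  move=> FJ; rewrite mcompB mcomp_d //; congr (_ - _); apply: eq_dc => j jF.
  by rewrite mcomp_els // (subset_trans (subsetDl _ _)).
pose c J F := if (F \in T) && (#|F|.+1 < N)%N then mcomp J x1 F else 0.
exists (els c), (els b); split.
- move=> J F FJ; rewrite mcomp_els // /c; case: ifP => [/andP[FT FN]|]; last by rewrite eqxx.
  by rewrite x1E // => h _; exact: (hb J F).
- apply/carried0 => J F FJ FT FN; rewrite mcomp_d // (@eq_dc _ _ _ _ (mcomp J x1)).
    by rewrite -mcomp_d // /x1 raddfB /= /pd d_d subr0; exact: dx.
  move=> j jF; rewrite mcomp_els ?(subset_trans (subsetDl _ _)) // /c.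
  by rewrite (T_sub (subsetDl _ _) FT) /= -[#|_|.+1]add1n; have := cardsD1 j F; rewrite jF => <-; rewrite FN.
- apply/carried0 => J F FJ FT FN; rewrite addrAC -/x1 mcompB mcomp_els // /c FT.
  by rewrite (_ : (_.+1 < N)%N) ?subrr //; clear -FN; lia.
Qed.

Let exactMM w : MM w -> Zero (pd w) -> exists2 y, M y & Null (w - pd y).
Proof.
move=> hw /carried0 dw.
have [e he] := choice (fun J => @top_exact J (mcomp J w)
  (fun F FT FJ FN h => hw J F FJ h (conj FT FN))
  (fun F FT FJ FN => etrans (esym (mcomp_d w FJ)) (dw J F FJ FT FN))).
exists (els e).
  move=> J F FJ; rewrite mcomp_els // => /(proj1 (he J)) tF _; rewrite /good tF; split=> //.
  by case/exists_inP: tF => x xF _; apply/set0Pn; exists x.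
apply/carried0 => J F FJ FT FN; rewrite mcompB mcomp_d //.
rewrite (proj2 (he J) F FT FJ FN) (@eq_dc _ _ _ _ (e J)) ?subrr // => j jF.
by rewrite mcomp_els // (subset_trans (subsetDl _ _)).
Qed.

Let NullI : ideal2 Null.
Proof.
split; first exact: carried_addg.
have tr y : carried (k := k) (fun _ _ : {set 'I_m} => True) y by [].
move=> x y hx; split.
  by apply: carriedM hx (tr y) => J1 J2 F1 F2 _ _ _ _ h _ /FinU[].
by apply: carriedM (tr y) hx => J1 J2 F1 F2 _ _ _ _ _ h /FinU[].
Qed.

(** The Massey sum is first made exact in the complex [T], that is up to faces of [K] of
    size [N]; these are taken care of by [K_top], and multidegrees that are not squarefree
    by [squarefree_exact]. *)
Lemma golod_criterion : golod k K.
Proof.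
apply: golod_lift => n a n1 ha.
have kface_null x : kface K x -> Null x.
  move=> /kfaceP h; apply/carried0 => J F FJ FT FN; apply: h.
  by rewrite mset_suppK K_T.
have NS F : Fin N F -> Fin N.+1 F by move=> [FT FN]; split=> //; exact: leqW.
have [y hy] : exists y, Null (conv (fun i j => psi (a i j)) a 0 n - pd y).
  apply: (@massey_exact _ _ _ (@psiK m _) (@d_d m _ _) (@ext_dM m _ _) (@psi_d m _ _)
    Null Zero M H P MM) => //.
  - exact: carried_addg.
  - exact: carried_addg.
  - split; first exact: carried_addg.
    have tr y : carried (k := k) (fun _ _ : {set 'I_m} => True) y by [].
    move=> x y hx; split.
      by apply: carriedM hx (tr y) => J1 J2 F1 F2 _ _ _ _ h _; apply: contra h; rewrite setU_eq0 => /andP[].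
    by apply: carriedM (tr y) hx => J1 J2 F1 F2 _ _ _ _ _ h; apply: contra h; rewrite setU_eq0 => /andP[].
  - exact: carried_addg.
  - exact: carried_psi.
  - exact: carried_psi.
  - exact: carried_psi.
  - move=> x hx J F FJ xF; apply/eqP => J0; have F0 : F = set0 by apply/eqP; rewrite -subset0 -J0.
    have [|] := hx J F FJ xF; last by rewrite F0 eqxx.
    rewrite F0; split; last by rewrite cards0.
    apply/T_base => [z|E EEE]; first by rewrite inE.
    by rewrite subset0 -card_gt0; apply: ltnW; exact: EE_gt1.
  - move=> x J F FJ; rewrite -/(pd x) mcomp_d //; apply: contra_neqN => /eqP J0.
    by rewrite J0 subset0 in FJ; rewrite (eqP FJ) /dc big_set0.
  - move=> x y hx hy; split.
      apply: carriedM hx hy => J1 J2 F1 F2 _ _ _ dF h1 h2 hF; apply: h1.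
      have [_ /h2[F20 _]] := FinU hF; exact: FinUn hF.
    apply: carriedM hy hx => J1 J2 F1 F2 _ _ _ dF h2 h1 hF; apply: h1.
    have [/h2[F10 _] _] := FinU hF.
    by rewrite setUC in hF; rewrite disjoint_sym in dF; exact: FinUn hF.
  - move=> x y hx hy; apply: carriedM hx hy => J1 J2 F1 F2 _ _ _ dF h1 h2 hF.
    have [[F1T _] [F2T _]] := FinU hF.
    have c1 : (N.-1 <= #|F1|)%N by rewrite leqNgt; apply/negP => ?; apply: h1.
    have c2 : (N.-1 <= #|F2|)%N by rewrite leqNgt; apply/negP => ?; apply: h2.
    by case: hF => _; rewrite cardU_disj //; clear -c1 c2 N_gt1; lia.
  - move=> x y hx hy; split.
      apply: carriedM hx hy => J1 J2 F1 F2 _ _ _ dF h1 h2 hF; apply: h1.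
      have [_ /NS/h2[F20 _]] := FinU hF; exact: FinUn hF.
    apply: carriedM hy hx => J1 J2 F1 F2 _ _ _ dF h2 h1 hF; apply: h1.
    have [/NS/h2[F10 _] _] := FinU hF.
    by rewrite setUC in hF; rewrite disjoint_sym in dF; exact: FinUn hF.
  - move=> i j ij ji; have [a0 da] := ha i j ij ji; split; last exact: kface_null.
    move=> J F FJ; apply: contra_neqN => /eqP J0.
    rewrite J0 subset0 in FJ; rewrite J0 (eqP FJ) /mcomp setD0 mset0; exact: a0.
set z := conv _ _ _ _ in hy *.
have dz : kface K (pd z).
  rewrite /z /pd (@d_conv_defect _ _ _ (@psiK m _) (@ext_dM m _ _) (@psi_d m _ _)).
  have [kA kM] := @kface_ideal k m K; have kD x y := addgD kA (x := x) (y := y).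
  apply: (@addgB _ (kface K)) => //; apply: (@conv_mem _ (kface K)) => [|//|s hs];
    do ?[exact: (addg0 kA)].
    have [||_ h] := ha s n; [by lia|by lia|].
    by case: (kM _ (a 0%N s) h).
  have [||_ h] := ha 0%N s; [by lia|by lia|].
  by case: (kM _ (a s n) (kface_psi h)).
have [e he] := choice (fun J => @K_top J (mcomp J (z - pd y))).
pose e' J F := if #|F|.+1 == N then e J F else 0.
have e'E J F : F \subset J -> mcomp J (pd (els e')) F = if #|F| == N then dc J (e J) F else 0.
  move=> FJ; rewrite mcomp_d //.
  have cD j : j \in F -> #|F| = #|F :\ j|.+1 by move=> jF; rewrite (cardsD1 j) jF.
  have sJ j : F :\ j \subset J by apply: subset_trans (subsetDl _ _) FJ.
  case: eqP => [FN|FN].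
    by apply: eq_dc => j jF; rewrite mcomp_els // /e' -cD // FN eqxx.
  rewrite (@eq_dc _ _ _ _ (fun=> 0)) ?dc0 // => j jF.
  by rewrite mcomp_els // /e' -cD //; case: eqP.
have [||y2 hy2] := @squarefree_exact k m K (z - pd y - pd (els e')).
- move=> J F FJ FK; rewrite mcompB e'E //; case: eqP => [FN|FN].
    by rewrite -he // subrr.
  move/carried0: hy => -> //; first by rewrite subr0.
    by rewrite -K_T // ltn_neqAle K_dim // andbT; apply/eqP.
  by rewrite ltn_neqAle K_dim // andbT; apply/eqP.
- by rewrite !raddfB /= /pd !d_d !subr0.
exists (y + els e' + y2); rewrite !pdD !opprD !addrA; exact: hy2.
Qed.

End GolodCriterion.

(** * Nontrivial products *)

Section Witness.
Variables (k : comNzRingType) (m : nat).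
Implicit Types (A B F G J S V : {set 'I_m}) (KK : {set {set 'I_m}}) (x y : pkoszul k m).
Implicit Types (c : {set 'I_m} -> k).

Lemma elB J c c' : el J (fun F => c F - c' F) = el J c - el J c'.
Proof. by apply/ffunP => S; rewrite !ffunE; case: ifP => _; rewrite ?subr0 // scalerBl. Qed.

Lemma pd_el J c : pd (el J c) = el J (dc J c).
Proof.
apply/ffunP => S; apply/mpolyP => e.
have [/andP[SJ /eqP eE]|hn] := boolP ((S \subset J) && (e == mset (J :\: S))).
  have := mcomp_d (el J c) (subsetDl J S); rewrite /mcomp setDDsub // -eE => ->.
  rewrite ffunE SJ mcoeffZ mcoeffX -eE eqxx mulr1; apply: eq_dc => j jF.
  by rewrite -/(mcomp J (el J c) _) mcomp_el ?eqxx // (subset_trans (subsetDl _ _)) ?subsetDl.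
have -> : (el J (dc J c) S)@_e = 0.
  apply/eqP; apply: contraT => /el_coef[SJ eE _].
  by rewrite SJ eE eqxx in hn.
rewrite pd_coef big1 // => j /andP[jS ej].
have -> : (el J c (j |: S))@_(e - U_(j)) = 0; last by rewrite mulr0.
apply/eqP; apply: contraT => /el_coef[]; rewrite subUset sub1set => /andP[jJ SJ] eE _.
case/negP: hn; rewrite SJ /=; apply/eqP/mnmP => i; rewrite msetE.
move/mnmP/(_ i): eE; rewrite mnmBE mnm1E msetE !inE negb_or eq_sym.
by case: (eqVneq i j) => [->|_] /=; rewrite ?subn0 // jS jJ; lia.
Qed.

Definition vanish_on KK x := forall S e, mnm_supp e \in KK -> (x S)@_e = 0.

Lemma vanish_on_mcomp KK x J F : vanish_on KK x -> F \in KK -> mcomp J x F = 0.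
Proof. by move=> h FK; apply: h; rewrite mset_suppK. Qed.

(** A linear functional on the cohomology of the face ring in multidegree [V]; where it
    does not vanish, neither does the class. *)
Record dual_cycle KK V (zeta : pkoszul k m -> k) : Prop := DualCycle {
  dualB : forall x y, zeta (x - y) = zeta x - zeta y;
  dualZ : forall (r : k) x, zeta (ext_const m r%:MP * x) = r * zeta x;
  dual_d : forall x, zeta (pd x) = 0;
  dual_face : forall x, (forall F, F \in KK -> F \subset V -> mcomp V x F = 0) -> zeta x = 0
}.

(** The last conditions on [J2] make every member of [KK] with [N] vertices meet [J1];
    this is what subdivisions need, and what they preserve. *)
Definition nontrivial_product KK (V : {set 'I_m}) (N : nat) : Prop :=
  exists J1 J2 (al be : {set 'I_m} -> k) f1 f2 zeta,
  [/\ [/\ J1 :|: J2 = V, [disjoint J1 & J2], J1 != set0, J2 != set0 & J2 \notin KK /\ (#|J2| <= N)%N],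
      (forall F, al F != 0 -> #|F| = f1), (forall F, be F != 0 -> #|F| = f2),
      vanish_on KK (pd (el J1 al)) /\ vanish_on KK (pd (el J2 be)) &
      dual_cycle KK V zeta /\ zeta (el J1 al * el J2 be) != 0].

Lemma el_homog J c f : (forall F, c F != 0 -> #|F| = f) -> khomog (#|J| + f)%N (el J c).
Proof.
move=> h S e /el_coef[SJ -> /h <-]; rewrite mdeg_mset.
by rewrite -(cardsID S J) (setIidPr SJ); lia.
Qed.

Lemma nontrivial_product_not_golod (K : simplicial_complex m) V N :
  nontrivial_product (faces K) V N -> ~ golod k K.
Proof.
move=> [J1 [J2 [al [be [f1 [f2 [zeta [[_ _ J10 J20 _] h1 h2 [b1 b2] [dz ne]]]]]]]]] [triv _].
have coc J c f : J != set0 -> (forall F, c F != 0 -> #|F| = f) -> vanish_on (faces K) (pd (el J c)) ->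
    (0 < #|J| + f)%N /\ cocycle (@koszul_d k m K) (@koszul_homog k m K) (#|J| + f)%N (kproj K (el J c)).
  move=> J0 h b; split; first by rewrite ltn_addr // card_gt0.
  split; first exact: homog_kproj (el_homog h).
  rewrite -kproj_d (_ : 0 = kproj K 0); last by rewrite raddf0.
  by apply/kprojE; rewrite subr0; apply/kfaceP.
have [p1 c1] := coc _ _ _ J10 h1 b1; have [p2 c2] := coc _ _ _ J20 h2 b2.
have := triv _ _ _ _ p1 p2 c1 c2; rewrite -kprojM => /coboundary_kproj[y /kfaceP hy].
case/eqP: ne; have : zeta (el J1 al * el J2 be - pd y) = 0.
  by apply: (dual_face dz) => F FK _; exact: vanish_on_mcomp FK.
by rewrite (dualB dz) (dual_d dz) subr0.
Qed.

Section Join.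
Implicit Types P Q : {set 'I_m}.
Variables (KK : {set {set 'I_m}}) (A B : {set 'I_m}) (N : nat).
Hypotheses (A0 : A != set0) (B0 : B != set0) (dAB : [disjoint A & B]).
Hypotheses (nA : A \notin KK) (nB : B \notin KK) (cB : (#|B| <= N)%N).
Hypothesis joinK : forall i j, i \in A -> j \in B -> (A :\ i) :|: (B :\ j) \in KK.

Let X := fun j : 'I_m => 'X_j : {mpoly k[m]}.

Lemma ext_dIU (P Q : {set 'I_m}) (x : pkoszul k m) : [disjoint P & Q] ->
  ext_dI X (P :|: Q) x = ext_dI X P x + ext_dI X Q x.
Proof. by move=> d; rewrite /ext_dI (eq_bigl [predU P & Q]) ?bigU // => i; rewrite !inE. Qed.

(* Only additivity in the set of coordinates, anticommutation and vanishing squares count: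
   contracting twice along [A] or along [B] gives zero. *)
Let dI_dI_d_abs (D : {set 'I_m} -> pkoszul k m -> pkoszul k m) x :
  (forall P y, D P (- y) = - D P y) -> (forall P y z, D P (y + z) = D P y + D P z) ->
  (forall P Q y, D P (D Q y) = - D Q (D P y)) -> (forall P y, D P (D P y) = 0) ->
  (forall P Q y, [disjoint P & Q] -> D (P :|: Q) y = D P y + D Q y) ->
  D A (D B (D (A :|: B :|: ~: (A :|: B)) x)) = D (~: (A :|: B)) (D A (D B x)).
Proof.
move=> DN DD DC DK DU.
have D0 P : D P 0 = 0.
  by have /eqP := DD P 0 0; rewrite addr0 -subr_eq subrr => /eqP <-.
have dC : [disjoint A :|: B & ~: (A :|: B)] by rewrite disjoints_subset setCK.
rewrite !DU // !DD DK D0 addr0 (DC B A) DN DK oppr0 add0r.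
by rewrite (DC B (~: _)) DN (DC A (~: _)) opprK.
Qed.

Let dIN P (x : pkoszul k m) : ext_dI X P (- x) = - ext_dI X P x.
Proof. exact: raddfN. Qed.

Let dID P (x y : pkoszul k m) : ext_dI X P (x + y) = ext_dI X P x + ext_dI X P y.
Proof. exact: raddfD. Qed.

Let dI_dI_d x : ext_dI X A (ext_dI X B (ext_dI X (A :|: B :|: ~: (A :|: B)) x)) =
  ext_dI X (~: (A :|: B)) (ext_dI X A (ext_dI X B x)).
Proof.
exact: (@dI_dI_d_abs (ext_dI X) x dIN dID (dI_dIC X) (dI_dI X) (fun P Q y => @ext_dIU P Q y)).
Qed.

(* The fundamental cycle of the join of the two boundary spheres: contraction along [A]
   and along [B] takes the boundaries of the two simplices. *)
Let zeta (x : pkoszul k m) : k := mcomp (A :|: B) (ext_dI X A (ext_dI X B x)) (A :|: B).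

Let zeta_dual : dual_cycle KK (A :|: B) zeta.
Proof.
split.
- by move=> x y; rewrite /zeta !raddfB mcompB.
- move=> r x; rewrite /zeta !ext_constM_dI.
  by rewrite /mcomp ext_constM mcoeffCM.
- move=> x; rewrite /zeta /pd /ext_d -/(ext_dI X setT x).
  have -> : setT = (A :|: B) :|: ~: (A :|: B) by rewrite setUCr.
  rewrite dI_dI_d.
  rewrite /mcomp dI_coef big1 // => j /andP[jC /andP[_ ej]].
  by move: ej jC; rewrite msetE lt0b in_setC => ->.
- move=> x hx; rewrite /zeta /mcomp setDv dI_coef big1 // => i /andP[iA _].
  rewrite dI_coef big1 ?mulr0 // => j /andP[jB /andP[jS _]].
  have iB : i \notin B by rewrite (disjointFr dAB).
  have jA : j \notin A by rewrite (disjointFl dAB).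
  have := hx _ (joinK iA jB) (setUSS (subsetDl _ _) (subsetDl _ _)).
  have eF : A :\ i :|: B :\ j = (A :|: B) :\ i :\ j.
    apply/setP => z; rewrite !inE; case: (eqVneq z i) => [->|_] /=.
      by rewrite (negPf iB) !andbF.
    by case: (eqVneq z j) => [->|_] //=; rewrite (negPf jA).
  have eS : (A :|: B) :\: ((A :|: B) :\ i :\ j) = j |: (i |: set0).
    apply/setP => z; rewrite !inE orbF; case: (eqVneq z i) => [->|_] /=; first by rewrite iA /= ?andbF ?orbT.
    by case: (eqVneq z j) => [->|_] /=; [rewrite jB orbT|rewrite andNb].
  have ji : j != i by apply: contraNneq iB => <-.
  rewrite /mcomp eF eS -!msetD1 ?inE ?ji ?iA ?jB ?orbT //.
  by move=> ->; rewrite mulr0.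
Qed.

Let delta (P : {set 'I_m}) (i : 'I_m) F : k := (F == P :\ i)%:R.

Let el_delta P i : i \in P -> el P (delta P i) = ext_const m 'X_[mset (P :\ i)] * uvar {mpoly k[m]} i.
Proof.
move=> iP; apply/ffunP => S; rewrite ext_constM !ffunE /delta.
case: (eqVneq S [set i]) => [->|Si]; first by rewrite sub1set iP eqxx scale1r mulr1.
rewrite mulr0; case: ifP => // SP; case: eqP => [eS|]; last by rewrite scale0r.
case/eqP: Si; rewrite -(setDDsub SP) eS; apply: setDDsub; by rewrite sub1set.
Qed.

Let dI_uvar P i : ext_dI X P (uvar {mpoly k[m]} i) = if i \in P then ext_const m (X i) else 0.
Proof.
rewrite /ext_dI; case: ifP => iP.
  rewrite (sum_if1 (i := i)) //; first by rewrite iota_uvar eqxx mulr1.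
  by move=> j _ /negPf ji; rewrite iota_uvar ji mulr0.
rewrite big1 // => j jP; rewrite iota_uvar; case: eqP => [ji|]; last by rewrite mulr0.
by rewrite -ji jP in iP.
Qed.

Let dI_const P r : ext_dI X P (ext_const m r) = 0.
Proof. by rewrite /ext_dI big1 // => j _; rewrite iota_const mulr0. Qed.

Let delta_card P i F : i \in P -> delta P i F != 0 -> #|F| = #|P|.-1.
Proof.
move=> iP; rewrite /delta; case: (F =P P :\ i) => [->|_]; last by rewrite eqxx.
by rewrite (cardsD1 i P) iP.
Qed.

Let vanish_on_delta P i : P \notin KK -> i \in P -> vanish_on KK (pd (el P (delta P i))).
Proof.
move=> nP iP S e eK; apply/eqP; apply: contraNT nP; rewrite pd_el => /el_coef[_ eE h].
have [j [jF]] : exists j, j \in P :\: S /\ (P :\: S) :\ j = P :\ i.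
  apply/not_existsP => hn; move/eqP: h; apply; rewrite /dc big1 // => j jF.
  rewrite /delta; case: eqP => [e'|]; last by rewrite mulr0.
  by case: (hn j).
move=> eF; have <- : P :\: S = P; last by rewrite -[P :\: S]mset_suppK -eE.
apply/eqP; rewrite eqEsubset subsetDl /=; apply/subsetP => z zP.
have [->|zj] := eqVneq z j; first by [].
have [zi|zi] := eqVneq z i; last first.
  by have /setP/(_ z) := eF; rewrite !inE zj zi zP /= => /andP[->].
have jP : j \in P by move: jF; rewrite inE => /andP[].
have /setP/(_ j) := eF; rewrite !inE eqxx jP /= andbT => /esym/negbFE/eqP ji.
by case/eqP: zj; rewrite zi ji.
Qed.

(** The fundamental class of a join of two boundaries of simplices is the product of
    their fundamental classes. *)
Lemma join_nontrivial : nontrivial_product KK (A :|: B) N.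
Proof.
have /set0Pn[a0 a0A] := A0; have /set0Pn[b0 b0B] := B0.
exists A, B, (delta A a0), (delta B b0), #|A|.-1, #|B|.-1, zeta; split.
- by split.
- by move=> F; exact: delta_card.
- by move=> F; exact: delta_card.
- by split; exact: vanish_on_delta.
split; first exact: zeta_dual.
have a0B : a0 \notin B by rewrite (disjointFr dAB).
rewrite !el_delta //.
set p := 'X_[_]; set q := 'X_[mset (B :\ b0)].
have e1 : ext_dI X B (ext_const m p * uvar _ a0 * (ext_const m q * uvar _ b0)) =
   psi (ext_const m p * uvar _ a0) * (ext_const m q * ext_const m (X b0)).
  by rewrite ext_dIM !ext_constM_dI !dI_uvar b0B (negPf a0B) mulr0 mul0r add0r.
have e2 : ext_dI X A (ext_const m p * uvar _ a0) = ext_const m p * ext_const m (X a0).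
  by rewrite ext_constM_dI dI_uvar a0A.
have e3 : ext_dI X A (psi (ext_const m p * uvar _ a0)) = - (ext_const m p * ext_const m (X a0)).
  by apply: (can_inj (@opprK _)); rewrite -psi_dI e2 opprK rmorphM /= !psi_const.
rewrite /zeta e1 ext_dIM e3 ext_constM_dI dI_const !mulr0 addr0.
rewrite /mcomp setDv mulNr extNE -mulrA !ext_constM ffunE eqxx mcoeffN oppr_eq0.
rewrite -!mpolyXD mcoeffX.
suff -> : (mset (A :\ a0) + (U_(a0) + (mset (B :\ b0) + U_(b0))))%MM = mset (A :|: B).
  by rewrite eqxx oner_eq0.
apply/mnmP => z; rewrite !mnmDE !msetE !mnm1E !inE eq_sym [b0 == z]eq_sym.
have [->|_] := eqVneq z a0; first by rewrite a0A (negPf a0B) andbF; case: eqP => // e; rewrite e b0B in a0B.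
have [->|_] := eqVneq z b0; first by rewrite b0B (disjointFl dAB b0B).
by have [zA|] := boolP (z \in A); rewrite ?(disjointFr dAB zA) //= ?addn0.
Qed.

End Join.
End Witness.

(** * Stellar subdivision of nontrivial products *)

Section Stellar.
Variables (k : comNzRingType) (m : nat).
Implicit Types (F G J S : {set 'I_m}) (x y : pkoszul k m).
Implicit Types (c : {set 'I_m} -> k).
Variables (KK KK' : {set {set 'I_m}}) (V sigma : {set 'I_m}) (w : 'I_m) (N : nat).
Hypotheses (KK_sub : forall F G, F \subset G -> G \in KK -> F \in KK).
Hypotheses (KK_V : forall F, F \in KK -> F \subset V) (wV : w \notin V).
Hypotheses (sigmaK : sigma \in KK) (card_sigma : #|sigma| = N).
Hypothesis KK'out : forall F, w \notin F -> (F \in KK') = (F \in KK) && (F != sigma).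
Hypothesis KK'in : forall F, w \in F -> (F \in KK') = (F :\ w \proper sigma).

Let sV : sigma \subset V := KK_V sigmaK.
Let wS F : F \subset V -> w \notin F.
Proof. by move=> FV; apply: contra wV; exact: (subsetP FV). Qed.

Let mcompZ J r x F : mcomp J (ext_const m r%:MP * x) F = r * mcomp J x F.
Proof. by rewrite /mcomp ext_constM mcoeffCM. Qed.

Let pdZ (r : k) x : pd (ext_const m r%:MP * x) = ext_const m r%:MP * pd x.
Proof. exact: ext_constM_d. Qed.

Let pdB x y : pd (x - y) = pd x - pd y. Proof. exact: raddfB. Qed.
Let pd_pd x : pd (pd x) = 0. Proof. exact: d_d. Qed.
Let iotaB x y : iota_ w (x - y) = iota_ w x - iota_ w y. Proof. exact: raddfB. Qed.
Let iota_pd x : iota_ w (pd x) = - pd (iota_ w x). Proof. exact: iota_d. Qed.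

(* The orientation of the subdivided sphere: the old one, plus the boundary of the
   simplex on sigma and w, with the coefficient that cancels sigma. *)
Let zeta' (zeta : pkoszul k m -> k) x :=
  zeta (iota_ w x) - zeta (el V (fun F => (F == sigma)%:R)) * mcomp (w |: V) (pd x) (w |: sigma).

Let el_sigma (c : k) : el V (fun F => c * (F == sigma)%:R) =
  ext_const m c%:MP * el V (fun F => (F == sigma)%:R).
Proof.
apply/ffunP => S; rewrite ext_constM !ffunE; case: ifP; rewrite ?mulr0 // => _.
by rewrite -scalerA -mul_mpolyC.
Qed.

Let zeta_dual' zeta : dual_cycle KK V zeta -> dual_cycle KK' (w |: V) (zeta' zeta).
Proof.
move=> [zB zZ zd zV].
have zN x : zeta (- x) = - zeta x.
  by rewrite -sub0r zB -[in LHS](subrr x) zB subrr sub0r.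
split.
- by move=> x y; rewrite /zeta' iotaB zB pdB mcompB mulrBr !opprB [LHS](AC (2*2) ((1*4)*(3*2))).
- by move=> r x; rewrite /zeta' iota_constM zZ pdZ mcompZ mulrBr mulrCA.
- by move=> x; rewrite /zeta' iota_pd zN zd pd_pd mcomp0 mulr0 !oppr0 addr0.
move=> x hx; rewrite /zeta'; set y := iota_ w x.
have wF F : F \subset V -> (w |: V) :\: F = w |: (V :\: F).
  move=> FV; apply/setP => z; rewrite !inE; case: (eqVneq z w) => [->|] //=.
  by rewrite (negPf (wS FV)).
have yE F : F \subset V -> mcomp V y F = (-1) ^+ below (V :\: F) w * mcomp (w |: V) x F.
  move=> FV; rewrite /mcomp wF // ffunE in_setD (negPf wV) andbF /=.
  exact: mcoeff_sign.
have yF F : F \in KK -> F != sigma -> mcomp V y F = 0.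
  move=> FK Fs; have FV := KK_V FK; rewrite yE // hx ?mulr0 //.
    by rewrite KK'out ?wS // FK.
  by rewrite subsetU // FV orbT.
have -> : zeta y = mcomp V y sigma * zeta (el V (fun F => (F == sigma)%:R)).
  rewrite -zZ -el_sigma; apply/eqP; rewrite -subr_eq0 -zB; apply/eqP; apply: zV => F FK FV.
  rewrite mcompB mcomp_el // eqxx; case: eqP => [->|/eqP Fs]; first by rewrite mulr1 subrr.
  by rewrite mulr0 subr0 yF.
have swV : w |: sigma \subset w |: V by rewrite setUS.
rewrite mcomp_d // /dc (sum_if1 (i := w)) ?setU11 //; last first.
  move=> j jws jw; rewrite hx ?mulr0 ?(subset_trans (subsetDl _ _)) //.
  have js : j \in sigma by move: jws; rewrite !inE (negPf jw).
  rewrite KK'in ?inE ?eqxx ?orbT 1?eq_sym ?jw //.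
  have -> : (w |: sigma) :\ j :\ w = sigma :\ j.
    apply/setP => z; rewrite !inE; case: (eqVneq z w) => [->|] //=.
    by rewrite (negPf (wS sV)) andbF.
  exact: properD1.
rewrite setU1K ?wS // yE // /sg.
have -> : (w |: V) :\: (w |: sigma) = V :\: sigma.
  apply/setP => z; rewrite !inE; case: (eqVneq z w) => [->|] //=.
  by rewrite (negPf wV) andbF.
by rewrite mulrC subrr.
Qed.

Let uvar_el J c : J \subset V -> uvar {mpoly k[m]} w * el J c =
  el (w |: J) (fun F => if w \in F then 0 else (-1) ^+ below (J :\: F) w * c F).
Proof.
move=> JV; have wJ := wS JV; apply/ffunP => S; rewrite uvarM !ffunE.
case: ifPn => wS'; last first.
  case: ifP => // SJ; rewrite (_ : w \in _) ?scale0r //.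
  by rewrite !inE eqxx wS'.
have -> : (S :\ w \subset J) = (S \subset w |: J).
  by rewrite subDset.
case: ifP => SJ; last by rewrite mulr0.
have eJ : J :\: (S :\ w) = (w |: J) :\: S.
  apply/setP => z; rewrite !inE; case: (eqVneq z w) => [->|] //=.
  by rewrite wS' (negPf wJ).
rewrite eJ (_ : (w \in _) = false); last by rewrite !inE eqxx wS'.
have eS : J :\: ((w |: J) :\: S) = S :\ w.
  apply/setP => z; rewrite !inE; case: (eqVneq z w) => [->|zw] //=.
    by rewrite (negPf wJ) andbF.
  rewrite negb_and negbK; case: (boolP (z \in J)) => zJ /=; rewrite ?orbF ?andbT ?andbF //.
  by apply/esym/negP => zS; have := subsetP SJ z zS; rewrite !inE (negPf zw) (negPf zJ).
rewrite eS -scalerA -signr_odd mulr_sign -signr_odd.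
by case: (odd _); rewrite ?expr1 ?expr0 ?scaleN1r ?scale1r.
Qed.

Let el0 J c S : w \notin J -> w \in S -> el J c S = 0.
Proof. by move=> wJ wS1; rewrite ffunE ifN //; apply: contra wJ => /subsetP; apply. Qed.

Let iota_el J c : w \notin J -> iota_ w (el J c) = 0.
Proof.
move=> wJ; apply/ffunP => S; rewrite [LHS]ffunE ext0E; case: ifP => // _.
by rewrite el0 ?setU11 ?mulr0.
Qed.

Let pd_el_coef J c S e : (pd (el J c) S)@_e != 0 -> mnm_supp e \subset J.
Proof. by rewrite pd_el => /el_coef[_ -> _]; rewrite mset_suppK subsetDl. Qed.

Let vanish_on_el J c : J \subset V -> vanish_on KK (pd (el J c)) -> vanish_on KK' (pd (el J c)).
Proof.
move=> JV h S e eK; apply/eqP; apply: contraT => ne.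
have wE : w \notin mnm_supp e by apply: wS; apply: subset_trans JV; exact: pd_el_coef ne.
move: eK; rewrite (KK'out wE) => /andP[eK _].
by case/eqP: ne; exact: h.
Qed.

Let vanish_on_uvar_el J c c1 : J \subset V -> vanish_on KK (pd (el J c)) -> pd (el J c1) = pd (el J c) ->
  (forall F, F \subset J -> F \subset sigma -> c1 F = 0) ->
  vanish_on KK' (pd (uvar {mpoly k[m]} w * el J c1)).
Proof.
move=> JV h e1 h1 S e eK; rewrite /pd d_uvarM -/(pd _) extBE mcoeffB ext_constM.
have -> : ('X_w * el J c1 S)@_e = 0.
  apply/eqP; apply: contraTT eK; rewrite mcoeffXM; case: ifP => [ew|]; last by rewrite eqxx.
  move=> /el_coef[SJ eE cJ].
  have wE : w \in mnm_supp e by rewrite inE.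
  rewrite (KK'in wE); apply: contra cJ => /proper_sub sE; apply/eqP; apply: (h1 _ (subsetDl _ _)).
  apply: subset_trans sE; rewrite -[J :\: S]mset_suppK -eE.
  apply/subsetP => z; rewrite !inE mnmBE mnm1E; case: (eqVneq z w) => [->|_] /=; last by rewrite subn0.
  move/mnmP/(_ w): eE; rewrite msetE mnmBE mnm1E eqxx inE (negPf (wS JV)) andbF.
  by move=> ->.
rewrite sub0r; have -> : ((uvar {mpoly k[m]} w * pd (el J c1)) S)@_e = 0; last by rewrite oppr0.
rewrite uvarM; case: ifP => wS'; last by rewrite mcoeff0.
apply/eqP; apply: contraT => ne.
have {}ne : (pd (el J c1) (S :\ w))@_e != 0.
  by move: ne; rewrite -signr_odd mulr_sign; case: ifP; rewrite ?mcoeffN ?oppr_eq0.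
have wE : w \notin mnm_supp e by apply: wS; apply: subset_trans JV; exact: pd_el_coef ne.
move: eK; rewrite (KK'out wE) => /andP[eK _].
by case/eqP: ne; rewrite e1; exact: h.
Qed.

Let zeta'_uvar (zeta : pkoszul k m -> k) (c : pkoszul k m) : (forall S, w \in S -> c S = 0) -> iota_ w c = 0 ->
  mcomp V c sigma = 0 -> zeta' zeta (uvar {mpoly k[m]} w * c) = zeta c.
Proof.
move=> c0 ic cs; rewrite /zeta' iotaM iota_uvar eqxx mul1r ic mulr0 addr0.
rewrite (_ : mcomp _ _ _ = 0) ?mulr0 ?subr0 //.
have wVs : w \notin (w |: V) :\: (w |: sigma) by rewrite !inE eqxx.
rewrite /mcomp /pd d_uvarM extBE mcoeffB ext_constM uvarM (negPf wVs) mcoeff0 subr0.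
rewrite mcoeffXM msetE setU11 /= msetD1 ?setU11 // setU1K ?wS //.
have -> : (w |: V) :\: (w |: sigma) = V :\: sigma; last exact: cs.
apply/setP => z; rewrite !inE; case: (eqVneq z w) => [->|] //=.
by rewrite (negPf wV) andbF.
Qed.

Let mul_el0 J1 J2 c1 c2 S : J1 \subset V -> J2 \subset V -> w \in S ->
  (el J1 c1 * el J2 c2) S = 0.
Proof.
move=> J1V J2V wS1; rewrite extM big1 // => S1 _; have [wS2|wS2] := boolP (w \in S1).
  by rewrite (el0 c1 (wS J1V) wS2) mul0r mulr0.
by rewrite (el0 c2 (wS J2V)) ?mulr0 // inE wS2.
Qed.

Let mul_el_sigma J1 J2 c1 c2 :
  (forall F, F \subset J1 -> F \subset sigma -> c1 F = 0) ->
  mcomp V (el J1 c1 * el J2 c2) sigma = 0.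
Proof.
move=> h1; apply/eqP; apply: contraT => /(mcomp_mul sV)[K1 [K2 [F1 [F2 [[_ _ sF1 _] eF _ h _]]]]].
move: h; rewrite mcomp_el //; case: (K1 =P J1) => [e|_]; last by rewrite eqxx.
by rewrite h1 ?eqxx //; [rewrite -e|rewrite -eF subsetUl].
Qed.

(** The class on the side of [J1] is first moved off sigma, where it is exact;
    multiplied by [u_w], it then remains a cocycle after the subdivision. *)
Lemma stellar_nontrivial : nontrivial_product k KK V N -> nontrivial_product k KK' (w |: V) N.
Proof.
move=> [J1 [J2 [al [be [f1 [f2 [zeta]]]]]]].
move=> [[JV dJ J10 J20 [nJ2 cJ2]] hal hbe [bal bbe] [dz ne]].
have J1V : J1 \subset V by rewrite -JV subsetUl.
have J2V : J2 \subset V by rewrite -JV subsetUr.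
have [t tJ1 ts] : exists2 t, t \in J1 & t \in sigma.
  have /subsetPn[t ts tJ2] : ~~ (sigma \subset J2).
    apply: contra nJ2 => sJ2; have -> // : J2 = sigma.
    by apply/esym/eqP; rewrite eqEcard sJ2 card_sigma.
  by exists t => //; have := subsetP sV t ts; rewrite -JV inE (negPf tJ2) orbF.
pose P := [pred F : {set 'I_m} | F \subset sigma].
pose ga := cone J1 t P al; pose al1 F := al F - dc J1 ga F.
have al1s F : F \subset J1 -> F \subset sigma -> al1 F = 0.
  move=> FJ Fs; have [tF|tF] := boolP (t \in F); first by rewrite /al1 dc_cone ?subrr.
  have tJ : t |: F \subset J1 by rewrite subUset sub1set tJ1.
  have tS : t |: F \subset sigma by rewrite subUset sub1set ts.
  apply: (@dc_eq0 _ _ J1 t al1) => //.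
    rewrite dcB dc_dc // subr0; have := vanish_on_mcomp J1 bal (KK_sub tS sigmaK).
    by rewrite mcomp_d // => <-; apply: eq_dc => j jF; rewrite mcomp_el ?eqxx // (subset_trans (subsetDl _ _)).
  move=> j jF; have tj : t != j by apply: contraNneq tF => ->.
  rewrite /al1 dc_cone ?subrr //; first by rewrite !inE tj eqxx.
  exact: (subset_trans (subsetDl _ _) tS).
have hal1 F : al1 F != 0 -> #|F| = f1.
  rewrite /al1; have [-> h|/hal //] := eqVneq (al F) 0.
  have [j [jF]] : exists j, j \in F /\ ga (F :\ j) != 0.
    apply/not_existsP => hn; move: h; rewrite sub0r oppr_eq0 => /eqP; apply.
    rewrite /dc big1 // => j jF; have [->|gj] := eqVneq (ga (F :\ j)) 0; first by rewrite mulr0.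
    by case: (hn j).
  rewrite /ga /cone; case: ifP => [/andP[tF _] gj|]; last by rewrite eqxx.
  have aj : al (t |: F :\ j) != 0 by apply: contra_neq gj => ->; rewrite mulr0.
  rewrite -(hal _ aj) cardsU1 tF (cardsD1 j F) jF //.
set a := el J1 al in bal ne; set b := el J2 be in bbe ne.
have a1E : el J1 al1 = a - pd (el J1 ga) by rewrite /al1 elB pd_el.
set a1 := el J1 al1 in a1E.
have pda1 : pd a1 = pd a by rewrite a1E pdB pd_pd subr0.
pose c := a1 * b.
have zc : zeta c != 0.
  suff -> : zeta c = zeta (a * b) by [].
  have e : pd (el J1 ga * b) = pd (el J1 ga) * b + psi (el J1 ga) * pd b by exact: ext_dM.
  have z0 : zeta 0 = 0 by have := dualB dz 0 0; rewrite subr0 subrr.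
  have zN u : zeta (- u) = - zeta u by have := dualB dz 0 u; rewrite z0 !sub0r.
  have zD u v : zeta (u + v) = zeta u + zeta v.
    by have := dualB dz u (- v); rewrite zN !opprK.
  have z1 : zeta (psi (el J1 ga) * pd b) = 0.
    apply: (dual_face dz) => F FK FV; apply/eqP; apply: contraT => /(mcomp_mul FV).
    move=> [K1 [K2 [F1 [F2 [_ eF _ _ /eqP h]]]]]; case: h; apply: (vanish_on_mcomp _ bbe).
    by apply: KK_sub FK; rewrite -eF subsetUr.
  have zB := dualB dz.
  have z2 : zeta (pd (el J1 ga) * b) = 0.
    by have := congr1 zeta e; rewrite (dual_d dz) zD z1 addr0.
  rewrite /c a1E mulrBl zB; apply: etrans (congr1 (fun r => zeta (a * b) - r) z2) (subr0 _).
have wJ1 := wS J1V; have wJ2 := wS J2V.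
have ic : iota_ w c = 0.
  by rewrite /c iotaM (iota_el al1 wJ1) (iota_el be wJ2) mul0r mulr0 addr0.
have c0 S : w \in S -> c S = 0 by exact: mul_el0.
have cs : mcomp V c sigma = 0 by exact: mul_el_sigma.
pose al' F := if w \in F then 0 else (-1) ^+ below (J1 :\: F) w * al1 F.
have eal : uvar {mpoly k[m]} w * a1 = el (w |: J1) al' := uvar_el al1 J1V.
have p1 : zeta' zeta (el (w |: J1) al' * b) != 0.
  have -> : el (w |: J1) al' * b = uvar {mpoly k[m]} w * c.
    exact: etrans (congr1 (fun z => z * b) (esym eal)) (esym (mulrA _ _ _)).
  by rewrite (zeta'_uvar zeta c0 ic cs).
have p2 : vanish_on KK' (pd (el (w |: J1) al')).
  by rewrite -eal; exact: vanish_on_uvar_el J1V bal pda1 al1s.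
have p3 F : al' F != 0 -> #|F| = f1.
  rewrite /al'; case: ifP => _; first by rewrite eqxx.
  by move=> h; apply: hal1; apply: contra_neq h => ->; rewrite mulr0.
have q1 : w |: J1 :|: J2 = w |: V by rewrite -setUA JV.
have q2 : [disjoint w |: J1 & J2].
  rewrite disjoints_subset subUset sub1set in_setC wJ2 -disjoints_subset; exact: dJ.
have q3 : w |: J1 != set0 by rewrite -card_gt0 cardsU1 wJ1.
have q4 : J2 \notin KK' by rewrite (KK'out wJ2) negb_and nJ2.
exists (w |: J1), J2, al', be, f1, f2, (zeta' zeta).
exact: (And5 (And5 q1 q2 q3 J20 (conj q4 cJ2)) p3 hbe (conj p2 (vanish_on_el J2V bbe)) (conj (zeta_dual' dz) p1)).
Qed.

End Stellar.

(** * Pseudomanifolds and stellar subdivision at a facet *)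

Local Close Scope ring_scope.

Lemma imset_D1 (T T' : finType) (f : T -> T') (F : {set T}) x : injective f ->
  f @: (F :\ x) = (f @: F) :\ f x.
Proof.
move=> f_inj; apply/setP => y; rewrite !inE; apply/imsetP/andP => [[z]|[yx /imsetP[z zF e]]].
  by rewrite !inE => /andP[zx zF] ->; rewrite mem_imset // (inj_eq f_inj).
by exists z; rewrite // !inE zF andbT; apply: contra yx => /eqP zx; rewrite e zx.
Qed.

Lemma subset_D1 (T : finType) (R F : {set T}) : R \subset F -> #|R|.+1 = #|F| ->
  exists2 x, x \in F & R = F :\ x.
Proof.
move=> RF cR; have /properP[_ [x xF xR]] : R \proper F by rewrite properEcard RF -cR ltnSn.
exists x => //; apply/eqP; rewrite eqEcard subsetD1 RF xR /=.
by have := cardsD1 x F; rewrite xF -cR => -[->].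
Qed.

Section Facets.
Variables (I : finType) (Fc : {set {set I}}) (N : nat).
Implicit Types F G H R : {set I}.

Definition faces_of : {set {set I}} := [set F : {set I} | [exists G in Fc, F \subset G]].

Lemma faces_ofP F : reflect (exists2 G, G \in Fc & F \subset G) (F \in faces_of).
Proof. by rewrite inE; exact: exists_inP. Qed.

Definition adjacent : rel {set I} :=
  [rel G H : {set I} | [&& G \in Fc, H \in Fc & [exists x in G, G :\ x \subset H]]].

(** The condition on [N] in [pm_cover] is for the boundary of a segment, whose
    subdivisions leave vertices behind that are in no facet. *)
Record pseudomanifold : Prop := Pseudomanifold {
  pm_card : forall G, G \in Fc -> #|G| = N;
  pm_other : forall G x, G \in Fc -> x \in G -> exists2 H, H \in Fc & H != G /\ G :\ x \subset H;
  pm_two : forall R G H H', #|R|.+1 = N -> G \in Fc -> H \in Fc -> H' \in Fc ->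
    R \subset G -> R \subset H -> R \subset H' -> G != H -> G != H' -> H = H';
  pm_conn : forall G H, G \in Fc -> H \in Fc -> connect adjacent G H;
  pm_cover : (1 < N)%N -> forall x, exists2 G, G \in Fc & x \in G
}.

End Facets.

Section Cut.
Variables (I : finType) (Fc : {set {set I}}) (sigma : {set I}).
Implicit Types (F G H R : {set I}) (A B : {set option I}).

(** The stellar subdivision at the facet [sigma], with new vertex [None]. *)
Definition cut_facets : {set {set option I}} :=
  [set Some @: (G : {set I}) | G in Fc :\ sigma] :|:
  [set None |: Some @: (sigma :\ x) | x in sigma].

Definition base_part A : {set I} := Some @^-1: A.

Lemma base_partE A x : (x \in base_part A) = (Some x \in A).
Proof. by rewrite inE. Qed.

Lemma mem_SomeI F x : (Some x \in Some @: F) = (x \in F).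
Proof. exact: (mem_imset _ _ Some_inj). Qed.

Lemma None_notin F : (None \in Some @: F) = false.
Proof. by apply/imsetP => -[]. Qed.

Lemma base_partK F : base_part (Some @: F) = F.
Proof. by apply/setP => x; rewrite base_partE mem_SomeI. Qed.

Lemma base_partU1 F : base_part (None |: Some @: F) = F.
Proof. by apply/setP => x; rewrite base_partE in_setU1 mem_SomeI. Qed.

Lemma base_part_None A : None \notin A -> Some @: base_part A = A.
Proof.
by move=> nA; apply/setP => -[x|]; rewrite ?mem_SomeI ?base_partE // None_notin (negPf nA).
Qed.

Lemma base_part_U1 A : None \in A -> None |: Some @: base_part A = A.
Proof.
by move=> nA; apply/setP => -[x|]; rewrite in_setU1 ?mem_SomeI ?base_partE // nA.
Qed.

Lemma sub_Some A F : None \notin A -> (A \subset Some @: F) = (base_part A \subset F).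
Proof.
move=> nA; apply/subsetP/subsetP => h x; first by rewrite base_partE => /h; rewrite mem_SomeI.
by case: x => [x xA|xA]; [rewrite mem_SomeI h // base_partE|rewrite xA in nA].
Qed.

Lemma sub_U1 A F : (A \subset None |: Some @: F) = (base_part A \subset F).
Proof.
apply/subsetP/subsetP => h x; first by rewrite base_partE => /h; rewrite in_setU1 mem_SomeI.
by case: x => [x xA|_]; rewrite in_setU1 ?eqxx // mem_SomeI h // base_partE.
Qed.

Lemma card_Some F : #|Some @: F| = #|F|. Proof. exact: card_imset Some_inj. Qed.

Lemma card_U1 F : #|None |: Some @: F| = #|F|.+1.
Proof. by rewrite cardsU1 None_notin card_Some. Qed.

Lemma cut_facetsP A : reflect
  ((exists G, [/\ G \in Fc, G != sigma & A = Some @: G]) \/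
   (exists2 x, x \in sigma & A = None |: Some @: (sigma :\ x))) (A \in cut_facets).
Proof.
rewrite inE; apply: (iffP orP) => -[].
- by move/imsetP => [G]; rewrite !inE => /andP[? ?] ->; left; exists G.
- by move/imsetP => [x ? ->]; right; exists x.
- by move=> [G [? ? ->]]; left; apply/imsetP; exists G; rewrite // !inE; apply/andP.
- by move=> [x ? ->]; right; apply/imsetP; exists x.
Qed.

Variable N : nat.
Hypotheses (pm : pseudomanifold Fc N) (sigmaF : sigma \in Fc) (N_gt0 : (0 < N)%N).

Lemma cut_face_out A : None \notin A ->
  (A \in faces_of cut_facets) = (base_part A \in faces_of Fc) && (base_part A != sigma).
Proof.
move=> nA; apply/faces_ofP/andP => [[B /cut_facetsP[[G [GF Gs ->]]|[x xs ->]]]|].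
- rewrite sub_Some // => AG; split; first by apply/faces_ofP; exists G.
  apply: contra_neq Gs => e; apply/esym/eqP.
  by rewrite eqEcard -{1}e AG (pm_card pm GF) (pm_card pm sigmaF) leqnn.
- rewrite sub_U1 => As; split.
    by apply/faces_ofP; exists sigma; rewrite // (subset_trans As) // subsetDl.
  apply: contraTneq xs => e; apply/negP => xs.
  by have := subsetP As x; rewrite e xs => /(_ isT); rewrite !inE eqxx.
- move=> [/faces_ofP[G GF AG] As]; have [e|Gs] := eqVneq G sigma; last first.
    exists (Some @: G); last by rewrite sub_Some.
    by apply/cut_facetsP; left; exists G.
  subst G; have /subsetPn[x xs xA] : ~~ (sigma \subset base_part A).
    by apply: contra As => sA; rewrite eqEsubset AG.
  exists (None |: Some @: (sigma :\ x)); first by apply/cut_facetsP; right; exists x.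
  by rewrite sub_U1 subsetD1 AG.
Qed.

Lemma cut_face_in A : None \in A ->
  (A \in faces_of cut_facets) = (base_part A \proper sigma).
Proof.
move=> nA; apply/faces_ofP/idP => [[B /cut_facetsP[[G [_ _ ->]]|[x xs ->]]]|/properP[As [x xs xA]]].
- by move/subsetP/(_ None nA); rewrite None_notin.
- by rewrite sub_U1 => As; apply: sub_proper_trans As _; exact: properD1.
exists (None |: Some @: (sigma :\ x)); first by apply/cut_facetsP; right; exists x.
by rewrite sub_U1 subsetD1 As.
Qed.

Lemma card_cut : #|cut_facets| = (#|Fc|.-1 + N)%N.
Proof.
rewrite cardsU (_ : _ :&: _ = set0) ?cards0 ?subn0; last first.
  apply/setP => A; rewrite !inE; apply/negP => /andP[/imsetP[G _ ->] /imsetP[x _ /setP/(_ None)]].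
  by rewrite None_notin in_setU1 eqxx.
rewrite card_imset; last exact: imset_inj Some_inj.
rewrite card_in_imset; first by rewrite (pm_card pm sigmaF) (cardsD1 sigma Fc) sigmaF.
move=> x y xs ys /(congr1 base_part); rewrite !base_partU1 => /setP/(_ x).
by rewrite !inE eqxx xs; case: (x =P y).
Qed.

Let sub_ridge R G : #|R|.+1 = N -> R \subset G -> G \in Fc -> exists2 x, x \in G & R = G :\ x.
Proof. by move=> cR RG GF; apply: subset_D1; rewrite // (pm_card pm GF). Qed.

Let cut_adj1 G H : G \in Fc -> H \in Fc -> G != sigma -> H != sigma -> adjacent Fc G H ->
  adjacent cut_facets (Some @: G) (Some @: H).
Proof.
move=> GF HF Gs Hs /and3P[_ _ /exists_inP[x xG GH]]; apply/and3P; split.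
- by apply/cut_facetsP; left; exists G.
- by apply/cut_facetsP; left; exists H.
- apply/exists_inP; exists (Some x); first by rewrite mem_SomeI.
  rewrite sub_Some; last by rewrite in_setD1 None_notin andbF.
  by apply: subset_trans GH; apply/subsetP => y; rewrite base_partE !inE mem_SomeI.
Qed.

Let cut_adj2 x y : x \in sigma -> y \in sigma ->
  adjacent cut_facets (None |: Some @: (sigma :\ x)) (None |: Some @: (sigma :\ y)).
Proof.
move=> xs ys; apply/and3P; split.
- by apply/cut_facetsP; right; exists x.
- by apply/cut_facetsP; right; exists y.
have [<-|xy] := eqVneq x y.
  by apply/exists_inP; exists None; rewrite ?in_setU1 ?eqxx // subsetDl.
apply/exists_inP; exists (Some y); first by rewrite in_setU1 mem_SomeI in_setD1 ys [y == x]eq_sym xy orbT.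
rewrite sub_U1; apply/subsetP => z; rewrite base_partE !inE /= mem_SomeI !inE.
by move=> /and3P[zy _ ->]; rewrite andbT; apply: contra zy => /eqP->.
Qed.

Let cut_adj3 G x : G \in Fc -> G != sigma -> x \in sigma -> sigma :\ x \subset G ->
  adjacent cut_facets (Some @: G) (None |: Some @: (sigma :\ x)) /\
  adjacent cut_facets (None |: Some @: (sigma :\ x)) (Some @: G).
Proof.
move=> GF Gs xs sG.
have G1 : Some @: G \in cut_facets by apply/cut_facetsP; left; exists G.
have G2 : None |: Some @: (sigma :\ x) \in cut_facets by apply/cut_facetsP; right; exists x.
have [y yG e] : exists2 y, y \in G & sigma :\ x = G :\ y.
  apply: sub_ridge => //; have := cardsD1 x sigma; rewrite xs (pm_card pm sigmaF); lia.
split; apply/and3P; split=> //; apply/exists_inP.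
  exists (Some y); first by rewrite mem_SomeI.
  rewrite sub_U1 e; apply/subsetP => z; rewrite base_partE !inE mem_SomeI => /andP[zy ->].
  by rewrite andbT; apply: contra zy => /eqP->.
exists None; first by rewrite in_setU1 eqxx.
rewrite setU1K ?None_notin // sub_Some ?None_notin // base_partK //.
Qed.

(** The new facets form a punctured sphere with the ridges of [sigma] as boundary, so they
    take over its neighbours and keep the facets connected. *)
Lemma cut_pseudomanifold : pseudomanifold cut_facets N.
Proof.
have cs x : x \in sigma -> (#|sigma :\ x|.+1 = N)%N.
  by move=> xs; have := cardsD1 x sigma; rewrite xs (pm_card pm sigmaF) => ->.
have [x0 x0s] : exists x, x \in sigma by apply/set0Pn; rewrite -card_gt0 (pm_card pm sigmaF).
split.
- move=> A /cut_facetsP[[G [GF _ ->]]|[x xs ->]]; first by rewrite card_Some (pm_card pm GF).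
  by rewrite card_U1 cs.
- move=> A a /cut_facetsP[[G [GF Gs ->]]|[x xs ->]].
    move=> /imsetP[x xG ->]; have [H HF [HG GH]] := pm_other pm GF xG.
    have [e|Hs] := eqVneq H sigma; last first.
      exists (Some @: H); first by apply/cut_facetsP; left; exists H.
      split; first by apply: contra_neq HG => /(congr1 base_part); rewrite !base_partK.
      rewrite sub_Some; last by rewrite in_setD1 None_notin andbF.
      by apply: subset_trans GH; apply/subsetP => y; rewrite base_partE !inE mem_SomeI.
    subst H; have [y ys e] : exists2 y, y \in sigma & G :\ x = sigma :\ y.
      by apply: sub_ridge => //; have := cardsD1 x G; rewrite xG (pm_card pm GF) => ->.
    exists (None |: Some @: (sigma :\ y)); first by apply/cut_facetsP; right; exists y.
    split; first by apply/eqP => /setP/(_ None); rewrite None_notin in_setU1 eqxx.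
    rewrite sub_U1 -e; apply/subsetP => z; rewrite base_partE !inE mem_SomeI => /andP[zy ->].
    by rewrite andbT; apply: contra zy => /eqP->.
  rewrite in_setU1 => /orP[/eqP->|/imsetP[y]].
    have [H HF [Hs sH]] := pm_other pm sigmaF xs.
    exists (Some @: H); first by apply/cut_facetsP; left; exists H.
    split; first by apply/eqP => /setP/(_ None); rewrite None_notin in_setU1 eqxx.
    by rewrite setU1K ?None_notin // imsetS.
  rewrite !inE => /andP[yx ys] ->.
  exists (None |: Some @: (sigma :\ y)); first by apply/cut_facetsP; right; exists y.
  split.
    apply/eqP => /(congr1 base_part); rewrite !base_partU1 => /setP/(_ y).
    by rewrite !inE eqxx yx ys.
  rewrite sub_U1; apply/subsetP => z; rewrite base_partE !inE /= mem_SomeI !inE.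
  by move=> /and3P[zy _ ->]; rewrite andbT; apply: contra zy => /eqP->.
- move=> R A B C cR; have [nR|nR] := boolP (None \in R).
    (* Only the new facets contain None; they are indexed by sigma minus R. *)
    have cR' : (#|base_part R|.+2 = N)%N.
      by rewrite -cR -{2}(base_part_U1 nR) card_U1.
    have new D : D \in cut_facets -> R \subset D -> exists x,
        [/\ x \in sigma, D = None |: Some @: (sigma :\ x), base_part R \subset sigma & x \notin base_part R].
      move=> /cut_facetsP[[G [_ _ ->]] /subsetP/(_ None nR)|[x xs ->]]; first by rewrite None_notin.
      by rewrite sub_U1 subsetD1 => /andP[? ?]; exists x.
    move=> AF BF CF RA RB RC AB AC.
    have [a [as_ Aa Rs aR]] := new A AF RA; have [b [bs Bb _ bR]] := new B BF RB.
    have [c [cs' Cc _ cR'']] := new C CF RC.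
    have ab : a != b by apply: contraNneq AB => ab; rewrite Aa Bb ab.
    have ac : a != c by apply: contraNneq AC => ac; rewrite Aa Cc ac.
    rewrite Bb Cc; have [->//|bc] := eqVneq b c.
    have : (#|a |: (b |: (c |: base_part R))| <= #|sigma|)%N.
      by apply: subset_leq_card; rewrite !subUset !sub1set as_ bs cs'.
    rewrite !cardsU1 !in_setU1 (negPf ab) (negPf ac) (negPf bc) (negPf aR) (negPf bR) (negPf cR'') /=.
    by rewrite (pm_card pm sigmaF) -cR' !add1n ltnn.
  have cR' : (#|base_part R|.+1 = N)%N by rewrite -cR -[in RHS](base_part_None nR) card_Some.
  have old D : D \in cut_facets -> R \subset D -> exists G, [/\ G \in Fc, base_part R \subset G &
      if G == sigma then exists2 x, x \in sigma & D = None |: Some @: (sigma :\ x) /\ base_part R = sigma :\ x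
      else D = Some @: G].
    move=> /cut_facetsP[[G [GF Gs ->]]|[x xs ->]].
      by rewrite sub_Some // => RG; exists G; rewrite (negPf Gs).
    rewrite sub_U1 => Rs; exists sigma; split=> //; first by rewrite (subset_trans Rs) // subsetDl.
    rewrite eqxx; exists x => //; split=> //; apply/eqP; rewrite eqEcard Rs /=.
    by rewrite -ltnS cs // cR'.
  move=> AF BF CF RA RB RC AB AC.
  have [G [GF RG hG]] := old A AF RA; have [H [HF RH hH]] := old B BF RB.
  have [H' [HF' RH' hH']] := old C CF RC.
  have same D D' E : (if E == sigma then exists2 x, x \in sigma & D = None |: Some @: (sigma :\ x) /\ base_part R = sigma :\ x
      else D = Some @: E) -> (if E == sigma then exists2 x, x \in sigma & D' = None |: Some @: (sigma :\ x) /\ base_part R = sigma :\ x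
      else D' = Some @: E) -> D = D'.
    case: eqP => _; last by move=> -> ->.
    by move=> [x _ [-> e]] [y _ [-> e']]; rewrite -e -e'.
  have GH : G != H by apply: contraNneq AB => e; apply/eqP; apply: same hG _; rewrite e.
  have GH' : G != H' by apply: contraNneq AC => e; apply/eqP; apply: same hG _; rewrite e.
  have e := pm_two pm cR' GF HF HF' RG RH RH' GH GH'.
  by apply: same hH _; rewrite e.
- have key G : G \in Fc -> G != sigma ->
     connect (adjacent cut_facets) (Some @: G) (None |: Some @: (sigma :\ x0)) /\
     connect (adjacent cut_facets) (None |: Some @: (sigma :\ x0)) (Some @: G).
    move=> GF Gs; have /connectP[p + e] := pm_conn pm GF sigmaF.
    elim: p G GF Gs e => [|H p IH] G GF Gs /=; first by move=> e; rewrite e eqxx in Gs.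
    move=> e /andP[GH pH]; have /and3P[_ HF /exists_inP[x xG sH]] := GH.
    have [Hs|Hs] := eqVneq H sigma.
      subst H; have [y ys e'] : exists2 y, y \in sigma & G :\ x = sigma :\ y.
        by apply: sub_ridge => //; have := cardsD1 x G; rewrite xG (pm_card pm GF) => ->.
      have sG : sigma :\ y \subset G by rewrite -e' subsetDl.
      have [c1 c2] := cut_adj3 GF Gs ys sG.
      split; first exact: connect_trans (connect1 c1) (connect1 (cut_adj2 ys x0s)).
      exact: connect_trans (connect1 (cut_adj2 x0s ys)) (connect1 c2).
    have [c1 c2] := IH H HF Hs e pH; split.
      by apply: connect_trans c1; apply: connect1; exact: cut_adj1.
    apply: connect_trans c2 (connect1 _); apply: cut_adj1 => //; apply/and3P; split=> //.
    have [y yH e'] : exists2 y, y \in H & G :\ x = H :\ y.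
      by apply: sub_ridge => //; have := cardsD1 x G; rewrite xG (pm_card pm GF) => ->.
    by apply/exists_inP; exists y; rewrite // -e' subsetDl.
  have key' A : A \in cut_facets ->
     connect (adjacent cut_facets) A (None |: Some @: (sigma :\ x0)) /\
     connect (adjacent cut_facets) (None |: Some @: (sigma :\ x0)) A.
    move=> /cut_facetsP[[G [GF Gs ->]]|[x xs ->]]; first exact: key.
    by split; apply: connect1; exact: cut_adj2.
  by move=> A B /key'[h _] /key'[_ h']; exact: connect_trans h h'.
- move=> N_gt1; case=> [x|]; last first.
    exists (None |: Some @: (sigma :\ x0)); last by rewrite in_setU1 eqxx.
    by apply/cut_facetsP; right; exists x0.
  have [G GF xG] := pm_cover pm N_gt1 x; have [e|Gs] := eqVneq G sigma; last first.
    by exists (Some @: G); rewrite ?mem_SomeI //; apply/cut_facetsP; left; exists G.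
  have /set0Pn[y] : G :\ x != set0 by rewrite -card_gt0 e -ltnS cs // -e.
  rewrite e !inE => /andP[yx ys].
  exists (None |: Some @: (sigma :\ y)); first by apply/cut_facetsP; right; exists y.
  by rewrite in_setU1 mem_SomeI in_setD1 -e xG [x == y]eq_sym yx orbT.
Qed.

End Cut.

(** * Stacked complexes *)

Section Pullback.
Variables (I J : finType) (th : J -> I).
Hypothesis th_inj : injective th.

Definition pull (TT : {set {set I}}) : {set {set J}} := [set F : {set J} | th @: F \in TT].

Lemma mem_pull TT F : (F \in pull TT) = (th @: F \in TT). Proof. by rewrite inE. Qed.

Lemma elimination_pull rk lk EE T N : elimination rk lk EE T N ->
  elimination (rk \o th) (fun w => th @^-1: lk (th w)) (pull EE) (pull T) N.
Proof.
move=> el; have im (F : {set J}) x : (th x \in th @: F) = (x \in F) by rewrite mem_imset.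
have imS (F G : {set J}) : (th @: F \subset th @: G) = (F \subset G).
  apply/idP/idP => [/subsetP h|]; last exact: imsetS.
  by apply/subsetP => x; rewrite -!im => /h.
have card (F : {set J}) : #|th @: F| = #|F| by exact: card_imset.
split.
- by move=> w w' w0 /(el_inj el w0)/th_inj.
- by move=> w y w0; rewrite inE => /(el_lk el w0).
- by move=> F G FG; rewrite !mem_pull; apply: (el_sub el); exact: imsetS.
- move=> F F0; have th0 y : y \in th @: F -> rk y = 0 by move=> /imsetP[x xF ->]; exact: F0.
  rewrite mem_pull; split=> [/(el_base el th0)|]; last move=> h; last apply/(el_base el th0).
  + by move=> h E; rewrite mem_pull => /h; rewrite imS.
  + move=> E EEE; apply/negP => EF; have e : E = th @: (th @^-1: E).
      apply/setP => y; apply/idP/imsetP => [yE|[x]]; last by rewrite inE => xE ->.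
      by have /imsetP[x xF e] := subsetP EF y yE; exists x; rewrite // inE -e.
    have := h (th @^-1: E); rewrite mem_pull -e => /(_ EEE)/negP; apply.
    by rewrite -imS -e.
- move=> F w wF w0 h; rewrite mem_pull (el_top el (w := th w)) ?im //; last first.
    by move=> _ /imsetP[x xF ->]; exact: h.
  rewrite -(imset_D1 _ _ th_inj); apply/subsetP/subsetP => hs x; first by move=> xF; rewrite inE; apply: hs; rewrite im.
  by move=> /imsetP[y yF ->]; have := hs y yF; rewrite inE.
- by move=> E x; rewrite mem_pull => EEE xE; apply: (el_EE el EEE); rewrite im.
- by move=> E; rewrite mem_pull => /(el_gt1 el); rewrite card.
- move=> E E'; rewrite !mem_pull => h h' ne.
  have [|d c] := el_disj el h h'; first by apply: contra_neq ne => /(imset_inj th_inj).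
  rewrite !card in c; split=> //; rewrite -setI_eq0; apply/eqP/setP => x; rewrite !inE.
  by apply/negP => /andP[xE xE']; have := disjointFr d (x := th x); rewrite !im xE xE' => /(_ isT).
Qed.

End Pullback.

(** Faces of size less than [N] cannot tell an iterated stellar subdivision at
    facets from the complex to which the cones have been added without removing
    the facets. *)
Definition stacked (I : finType) (Fc : {set {set I}}) N := exists rk lk EE T,
  [/\ elimination rk lk EE T N, Fc \subset T &
      forall F : {set I}, #|F| < N -> (F \in faces_of Fc) = (F \in T)].

Section CutStacked.
Variables (I : finType) (Fc : {set {set I}}) (sigma : {set I}) (N : nat).
Hypotheses (pm : pseudomanifold Fc N) (sigmaF : sigma \in Fc).

(** The new vertex gets the highest rank and the simplex [sigma] as link. *)
Lemma cut_stacked : stacked Fc N -> stacked (cut_facets Fc sigma) N.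
Proof.
move=> [rk [lk [EE [T [el FT TF]]]]].
pose rk' (a : option I) := if a is Some x then rk x else (\max_x rk x).+1.
pose lk' (a : option I) := if a is Some x then Some @: lk x else Some @: sigma.
pose EE' : {set {set option I}} := [set Some @: (E : {set I}) | E in EE].
pose T' : {set {set option I}} := [set A : {set option I} |
  if None \in A then base_part A \subset sigma else base_part A \in T].
have rkmax x : rk x <= \max_x rk x by exact: leq_bigmax.
have sigmaT : sigma \in T by exact: (subsetP FT).
have bS (A B : {set option I}) : A \subset B -> base_part A \subset base_part B.
  by move/subsetP=> AB; apply/subsetP => x; rewrite !base_partE => /AB.
exists rk', lk', EE', T'; split.
- split.
  + case=> [w|] [w'|] //=; first by move=> w0 /(el_inj el w0)->.
      by move=> _ e; have := rkmax w; rewrite e ltnn.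
    by move=> _ e; have := rkmax w'; rewrite -e ltnn.
  + case=> [w|] [y|] //=; rewrite ?mem_SomeI ?None_notin //; first exact: (el_lk el).
    by move=> _ _; rewrite ltnS; exact: rkmax.
  + move=> A B AB; rewrite !inE; case: ifP => nB; last first.
      by rewrite (contraFF (subsetP AB None) nB); apply: (el_sub el); exact: bS.
    case: ifP => nA h; first exact: subset_trans (bS _ _ AB) h.
    by apply: (el_sub el _ sigmaT); exact: subset_trans (bS _ _ AB) h.
  + move=> A A0; have nA : None \notin A by apply/negP => /A0.
    have b0 x : x \in base_part A -> rk x = 0 by rewrite base_partE => /A0.
    rewrite inE (negPf nA); split=> [/(el_base el b0)|h]; last apply/(el_base el b0).
    * move=> h _ /imsetP[E EEE ->]; apply: contra (h E EEE).
      by move/bS; rewrite base_partK.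
    * move=> E EEE; apply: contra (h _ (imset_f _ EEE)) => EA.
      by rewrite -(base_part_None nA) imsetS.
  + move=> A [w|] wA w0 hA; rewrite inE; last first.
      rewrite wA; have -> : A :\ None = Some @: base_part A.
        by apply/setP => -[x|]; rewrite !inE ?eqxx ?None_notin // mem_SomeI base_partE.
      by rewrite sub_Some ?None_notin // base_partK.
    have nA : None \notin A.
      by apply/negP => /hA /=; rewrite ltnNge rkmax.
    rewrite (negPf nA) (el_top el (w := w)) ?base_partE //; last first.
      by move=> x; rewrite base_partE => /hA.
    rewrite sub_Some; last by rewrite !inE (negPf nA) andbF.
    by rewrite (_ : base_part (A :\ Some w) = base_part A :\ w) //; apply/setP => x; rewrite !inE.
  + by move=> _ x /imsetP[E EEE ->] /imsetP[y yE ->]; exact: (el_EE el EEE).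
  + by move=> _ /imsetP[E EEE ->]; rewrite card_Some; exact: (el_gt1 el).
  + move=> _ _ /imsetP[E EEE ->] /imsetP[E' EEE' ->] ne.
    have [|d c] := el_disj el EEE EEE'; first by apply: contra_neq ne => ->.
    rewrite !card_Some; split=> //; rewrite -setI_eq0; apply/eqP/setP => -[x|]; last first.
      by rewrite inE !None_notin inE.
    rewrite inE !mem_SomeI inE; apply/negP => /andP[xE xE'].
    by rewrite (disjointFr d xE) in xE'.
- apply/subsetP => A /cut_facetsP[[G [GF _ ->]]|[x xs ->]]; rewrite inE.
    by rewrite None_notin base_partK; exact: (subsetP FT).
  by rewrite in_setU1 eqxx base_partU1 subsetDl.
- move=> A AN; rewrite [RHS]inE; case: ifP => nA.
    rewrite cut_face_in // properEcard (pm_card pm sigmaF) andb_idr // => As.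
    apply: ltn_trans AN.
    by have := card_U1 (base_part A); rewrite (base_part_U1 nA) => ->.
  have cA : #|base_part A| = #|A| by have := card_Some (base_part A); rewrite (base_part_None (negbT nA)).
  rewrite (cut_face_out pm sigmaF) ?nA // TF ?cA // andb_idr // => _.
  by apply: contraTneq AN => e; rewrite -cA e (pm_card pm sigmaF) ltnn.
Qed.

End CutStacked.

(** * Joins of two boundaries of simplices *)

Section Push.
Variables (I : finType) (m : nat) (g : I -> 'I_m).
Hypothesis g_inj : injective g.
Implicit Types (TT : {set {set I}}) (F : {set I}).

Definition push (TT : {set {set I}}) : {set {set 'I_m}} := [set g @: (F : {set I}) | F in TT].

Lemma preim_imsetK (F : {set I}) : g @^-1: (g @: F) = F.
Proof. by apply/setP => x; rewrite inE mem_imset. Qed.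

Lemma imset_preimK (A : {set 'I_m}) : A \subset g @: setT -> g @: (g @^-1: A) = A.
Proof.
move=> /subsetP As; apply/setP => y; apply/imsetP/idP => [[x]|yA]; first by rewrite inE => h ->.
by have /imsetP[x _ e] := As y yA; exists x; rewrite // inE -e.
Qed.

Lemma mem_push TT A : (A \in push TT) = (A \subset g @: setT) && (g @^-1: A \in TT).
Proof.
apply/imsetP/andP => [[F FT ->]|[As AT]]; first by rewrite preim_imsetK imsetS ?subsetT.
by exists (g @^-1: A); rewrite ?imset_preimK.
Qed.

Lemma push_imset TT F : (g @: F \in push TT) = (F \in TT).
Proof. by rewrite mem_push preim_imsetK imsetS ?subsetT. Qed.

End Push.

Lemma faces_of_sub (I : finType) (Fc : {set {set I}}) (F G : {set I}) :
  F \subset G -> G \in faces_of Fc -> F \in faces_of Fc.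
Proof. by move=> FG /faces_ofP[H HF GH]; apply/faces_ofP; exists H => //; exact: subset_trans GH. Qed.

Section Detect.
Variable k : comNzRingType.

(** Embedding the vertices into ['I_m] makes this independent of a numbering of [I]. *)
Definition detects (I : finType) (Fc : {set {set I}}) N := forall m (g : I -> 'I_m),
  injective g -> nontrivial_product k (push g (faces_of Fc)) (g @: setT) N.

Lemma cut_detects (I : finType) (Fc : {set {set I}}) (sigma : {set I}) N :
  pseudomanifold Fc N -> sigma \in Fc -> detects Fc N -> detects (cut_facets Fc sigma) N.
Proof.
move=> pm sF det m g g_inj; pose gs := g \o Some.
have gs_inj : injective gs by move=> x y /g_inj[].
have -> : g @: setT = g None |: gs @: setT.
  apply/setP => y; rewrite in_setU1; apply/imsetP/orP => [[[x|] _ ->]|[/eqP->|/imsetP[x _ ->]]].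
  - by right; apply/imsetP; exists x.
  - by left.
  - by exists None.
  - by exists (Some x).
have bpE (A : {set 'I_m}) : base_part (g @^-1: A) = gs @^-1: A by apply/setP => x; rewrite !inE.
have wV : g None \notin gs @: setT by apply/imsetP => -[x _ /g_inj].
have sub1 (A : {set 'I_m}) : g None \notin A -> (A \subset g @: setT) = (A \subset gs @: setT).
  move=> wA; apply/idP/idP => /subsetP h; apply/subsetP => y yA.
    have /imsetP[[x|] _ e] := h y yA; last by rewrite -e yA in wA.
    by apply/imsetP; exists x.
  by have /imsetP[x _ ->] := h y yA; apply/imsetP; exists (Some x).
have eqs (A : {set 'I_m}) : A \subset gs @: setT -> (A == gs @: sigma) = (gs @^-1: A == sigma).
  move=> As; apply/eqP/eqP => [->|<-]; first exact: preim_imsetK.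
  by rewrite imset_preimK.
apply: (@stellar_nontrivial k m (push gs (faces_of Fc)) (push g (faces_of (cut_facets Fc sigma)))
   (gs @: setT) (gs @: sigma) (g None) N).
- move=> F G FG; rewrite !mem_push // => /andP[GT Gf].
  rewrite (subset_trans FG GT) /=; apply: faces_of_sub Gf; exact: preimsetS.
- by move=> F; rewrite mem_push // => /andP[].
- exact: wV.
- by rewrite push_imset //; apply/faces_ofP; exists sigma.
- by rewrite card_imset // (pm_card pm sF).
- move=> F wF; rewrite !mem_push // sub1 //; case: (boolP (F \subset _)) => //= Fs.
  by rewrite (cut_face_out pm sF) ?inE // bpE eqs.
- move=> F wF; rewrite mem_push // cut_face_in ?inE // bpE.
  have e : gs @^-1: (F :\ g None) = gs @^-1: F.
    by apply/setP => x; rewrite !inE; case: eqP => // /g_inj.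
  apply/andP/idP => [[Fs Fp]|].
    have Fs' : F :\ g None \subset gs @: setT.
      by rewrite -sub1 ?inE ?eqxx // (subset_trans (subsetDl _ _)).
    rewrite properEneq eqs // e; move: Fp; rewrite properEneq => /andP[-> /= Fp].
    by rewrite -(imset_preimK Fs') e imsetS.
  move=> Fp; have Fs' : F :\ g None \subset gs @: setT.
    by apply: subset_trans (proper_sub Fp) _; rewrite imsetS ?subsetT.
  split.
    apply/subsetP => y yF; have [->|yw] := eqVneq y (g None); first by rewrite imset_f.
    have : y \in F :\ g None by rewrite !inE yw.
    by move=> /(subsetP Fs')/imsetP[x _ ->]; rewrite /gs /= imset_f.
  move: Fp; rewrite !properEneq eqs // e => /andP[-> /= Fp].
  by rewrite -e -(preim_imsetK gs_inj sigma); exact: preimsetS.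
- exact: det.
Qed.

Lemma join_detects (I : finType) (Fc : {set {set I}}) (A B : {set I}) N :
  A :|: B = setT -> [disjoint A & B] -> A != set0 -> B != set0 ->
  A \notin faces_of Fc -> B \notin faces_of Fc -> #|B| <= N ->
  (forall x y, x \in A -> y \in B -> (A :\ x) :|: (B :\ y) \in faces_of Fc) ->
  detects Fc N.
Proof.
move=> AB dAB A0 B0 nA nB cB h m g g_inj; rewrite -AB imsetU.
apply: join_nontrivial; rewrite ?push_imset ?card_imset //.
- by rewrite -card_gt0 card_imset // card_gt0.
- by rewrite -card_gt0 card_imset // card_gt0.
- rewrite -setI_eq0; apply/eqP/setP => y; rewrite !inE; apply/negP => /andP[/imsetP[x xA ->]].
  by rewrite mem_imset // (disjointFr dAB xA).
- by move=> _ _ /imsetP[x xA ->] /imsetP[y yB ->]; rewrite -!imset_D1 // -imsetU push_imset // h.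
Qed.

Lemma detects_not_golod (I : finType) (Fc : {set {set I}}) N m (K : simplicial_complex m)
    (g : I -> 'I_m) : injective g -> faces K = push g (faces_of Fc) -> detects Fc N -> ~ golod k K.
Proof.
by move=> g_inj KE det; apply: (@nontrivial_product_not_golod k m K (g @: setT) N); rewrite KE; exact: det.
Qed.

End Detect.

(** A join of two boundaries of simplices on part of the vertices, of too small a
    dimension to be touched by cuts. *)
Definition spare_join (I : finType) (Fc : {set {set I}}) N := exists (A B : {set I}) (v : I),
  [/\ [/\ [disjoint A & B], v \notin A :|: B, A != set0, B != set0 & #|A| + #|B| < N + 2],
      A \notin faces_of Fc, B \notin faces_of Fc &
      forall x y, x \in A -> y \in B -> (A :\ x) :|: (B :\ y) \in faces_of Fc].

Lemma cut_spare_join (I : finType) (Fc : {set {set I}}) (sigma : {set I}) N :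
  pseudomanifold Fc N -> sigma \in Fc -> spare_join Fc N -> spare_join (cut_facets Fc sigma) N.
Proof.
move=> pm sF [A [B [v [[dAB vAB A0 B0 cAB] nA nB h]]]].
exists (Some @: A), (Some @: B), (Some v).
have cs := pm_card pm sF.
split.
- split.
  + rewrite -setI_eq0; apply/eqP/setP => -[x|]; last by rewrite !inE None_notin.
    rewrite inE !mem_SomeI inE; apply/negP => /andP[xA]; by rewrite (disjointFr dAB xA).
  + by rewrite -imsetU mem_SomeI.
  + by rewrite -card_gt0 card_Some card_gt0.
  + by rewrite -card_gt0 card_Some card_gt0.
  + by rewrite !card_Some.
- by rewrite (cut_face_out pm sF) ?None_notin // base_partK (negPf nA).
- by rewrite (cut_face_out pm sF) ?None_notin // base_partK (negPf nB).
move=> _ _ /imsetP[x xA ->] /imsetP[y yB ->].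
rewrite -!(imset_D1 _ _ Some_inj) -imsetU (cut_face_out pm sF) ?None_notin // base_partK h //=.
apply: contraTneq cAB => e; rewrite -leqNgt -cs -e.
have := cardsD1 x A; have := cardsD1 y B; rewrite xA yB => -> ->.
rewrite addn2 add1n add1n addSn addnS !ltnS cardsU; exact: leq_subr.
Qed.

(** * Deletion of a vertex *)

Section TopCohomology.
Variables (k : comNzRingType) (I : finType) (Fc : {set {set I}}) (N m : nat).
Variables (th : 'I_m -> I) (i0 : I).
Hypotheses (pm : pseudomanifold Fc N) (N_gt1 : 1 < N) (th_inj : injective th).
Hypothesis th_i0 : forall u, th u != i0.
Implicit Types (F G J R : {set 'I_m}) (c e : {set 'I_m} -> k).

Let L := pull th (faces_of Fc).

Let LP F : F \in L -> #|F| = N -> th @: F \in Fc.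
Proof.
rewrite mem_pull => /faces_ofP[G GF FG] FN; have -> // : th @: F = G.
by apply/eqP; rewrite eqEcard FG card_imset // FN (pm_card pm GF) leqnn.
Qed.

Let exact_at J F := exists e, forall F', F' \in L -> #|F'| = N -> F' \subset J ->
  ((F' == F)%:R = dc J e F')%R.

Let dc_comb J (a b : k) c e F :
  (dc J (fun X => a * c X + b * e X) F = a * dc J c F + b * dc J e F)%R.
Proof.
rewrite /dc !mulr_sumr -big_split; apply: eq_bigr => j _.
by rewrite mulrDr !(mulrCA (sg _ _ _ _)).
Qed.

(* By induction on the path from [G] to a facet through [i0], which is not a facet of the
   punctured complex: the coboundary of the ridge crossed first relates the indicator
   cochain of [G] to that of its neighbour, or kills it if the neighbour is not there. *)
Let path_exact J (H : {set I}) : i0 \in H -> forall (p : seq {set I}) (G : {set I}), path (adjacent Fc) G p -> H = last G p ->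
  forall F, G = th @: F -> F \subset J -> #|F| = N -> G \in Fc -> exact_at J F.
Proof.
move=> i0H; elim=> [|G1 p IH] G /=.
  move=> _ HG F GF; move: i0H; rewrite HG GF => /imsetP[u _ e].
  by have := th_i0 u; rewrite e eqxx.
move=> /andP[/and3P[_ G1F /exists_inP[x xG GG1]] pG1] Hp F GF FJ FN GFc.
have [e1|G1G] := eqVneq G G1; first by apply: (IH G1) => //; rewrite -e1.
have /imsetP[u uF xu] : x \in th @: F by rewrite -GF.
pose R := F :\ u.
have imR : th @: R = G :\ x by rewrite GF xu -imset_D1.
have cR : (#|R|.+1)%N = N by have := cardsD1 u F; rewrite uF FN => ->.
have RG : th @: R \subset G by rewrite imR subsetDl.
have RG1 : th @: R \subset G1 by rewrite imR.
pose del R' X : k := ((X == R')%:R)%R.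
have facet (F' : {set 'I_m}) : F' \in L -> #|F'| = N -> R \subset F' -> F' != F -> th @: F' = G1.
  move=> F'L F'N RF' F'F; apply/esym; apply: (pm_two pm (R := th @: R) (G := G)) => //.
  - by rewrite card_imset.
  - exact: LP.
  - exact: imsetS.
  - by rewrite GF; apply: contra_neq F'F => /(imset_inj th_inj).
have dF' (F' : {set 'I_m}) : F' \subset J -> #|F'| = N -> ~~ (R \subset F') -> dc J (del R) F' = 0%R.
  move=> F'J F'N nR; rewrite /dc big1 // => j jF'; rewrite /del; case: eqP => [e|]; last by rewrite mulr0.
  by case/negP: nR; rewrite -e subsetDl.
have dF (X : {set 'I_m}) y : y \in X -> X :\ y = R -> dc J (del R) X = sg k J X y.
  move=> yX e; rewrite /dc (sum_if1 (i := y)) //; first by rewrite /del e eqxx mulr1.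
  move=> j jX jy; rewrite /del -e; case: eqP => [e'|]; last by rewrite mulr0.
  by have /setP/(_ j) := e'; rewrite !inE eqxx jX jy.
have [/existsP[F1 /and3P[/eqP F1G F1J F1N]]|no] :=
    boolP [exists F1 : {set 'I_m}, [&& th @: F1 == G1, F1 \subset J & #|F1| == N]].
  move/eqP in F1N; have [e1 he1] := IH G1 pG1 Hp F1 (esym F1G) F1J F1N G1F.
  have F1F : F1 != F by apply: contra_neq G1G => ff; rewrite GF -F1G ff.
  have RF1 : R \subset F1.
    by apply/subsetP => z zR; rewrite -(mem_imset _ _ th_inj) F1G (subsetP RG1) // imset_f.
  have [y yF1 e] : exists2 y, y \in F1 & F1 :\ y = R.
    by have [|y yF1 e] := @subset_D1 _ R F1 RF1; [rewrite cR|exists y].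
  exists (fun X => sg k J F u * del R X + - (sg k J F u * sg k J F1 y) * e1 X)%R => F' F'L F'N F'J.
  rewrite dc_comb -he1 //; have [->|F'F] := eqVneq F' F.
    by rewrite (dF F u) // sgM [F == F1]eq_sym (negPf F1F) mulr0 addr0.
  have [->|F'F1] := eqVneq F' F1; first by rewrite (dF F1 y) // mulr1 subrr.
  rewrite dF' //; first by rewrite !mulr0 addr0.
  apply/negP => RF'; have := facet F' F'L F'N RF' F'F; rewrite -F1G => /(imset_inj th_inj) ff.
  by rewrite ff eqxx in F'F1.
exists (fun X => sg k J F u * del R X + 0 * 0)%R => F' F'L F'N F'J.
rewrite (dc_comb J _ _ _ (fun=> 0%R)) mul0r addr0.
have [->|F'F] := eqVneq F' F; first by rewrite (dF F u) // sgM.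
rewrite dF' ?mulr0 //; apply/negP => RF'; case/negP: no; apply/existsP; exists F'.
by rewrite (facet F') // F'J F'N !eqxx.
Qed.

(** The vertex [i0] punctures the pseudomanifold, so its top cohomology vanishes:
    a facet is cohomologous to its neighbours, and eventually to one through [i0]. *)
Lemma top_cohomology J c : exists e, forall F, F \in L -> #|F| = N -> F \subset J -> c F = dc J e F.
Proof.
have hF (F : {set 'I_m}) : exists e, F \in L -> #|F| = N -> F \subset J ->
    forall F', F' \in L -> #|F'| = N -> F' \subset J -> ((F' == F)%:R = dc J e F')%R.
  have [/and3P[FL /eqP FN FJ]|hn] := boolP [&& F \in L, #|F| == N & F \subset J]; last first.
    by exists (fun=> 0%R) => h1 h2 h3; rewrite h1 h2 h3 eqxx in hn.
  have [H HF i0H] := pm_cover pm N_gt1 i0; have GF := LP FL FN.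
  have /connectP[p pG eH] := pm_conn pm GF HF.
  by have [e he] := path_exact i0H pG eH erefl FJ FN GF; exists e.
have [e he] := choice hF.
exists (fun X => \sum_(F | [&& F \in L, #|F| == N & F \subset J]) c F * e F X)%R => F FL FN FJ.
rewrite /dc; under eq_bigr => j _ do rewrite mulr_sumr.
rewrite exchange_big /= (sum_if1 (i := F)); last first.
- move=> F1 /and3P[F1L /eqP F1N F1J] F1F.
  under eq_bigr => j _ do rewrite mulrCA.
  rewrite -mulr_sumr -/(dc J (e F1) F) -(he F1) //; by rewrite eq_sym (negPf F1F) mulr0.
- by rewrite FL FN eqxx.
under eq_bigr => j _ do rewrite mulrCA.
by rewrite -mulr_sumr -/(dc J (e F) F) -(he F) // eqxx mulr1.
Qed.

End TopCohomology.

Section Deletion.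
Variables (k : comNzRingType) (I : finType) (Fc : {set {set I}}) (N m : nat).
Variables (K : simplicial_complex m) (g : I -> 'I_m).
Hypotheses (pm : pseudomanifold Fc N) (N_gt1 : 1 < N) (g_bij : bijective g).
Hypothesis KE : faces K = push g (faces_of Fc).

(** Without [v] there is no top cohomology left, and the stacked structure restricts to
    the remaining vertices. *)
Lemma del_golod v : stacked Fc N -> golod k (del_vertex K v).
Proof.
move=> [rk [lk [EE [T [el FT TF]]]]].
have [h gK hK] := g_bij.
pose th := h \o lift v.
have th_inj : injective th by move=> x y /(can_inj hK)/lift_inj.
have th_i0 u : th u != h v.
  by apply/eqP => /(can_inj hK) e; have := neq_lift v u; rewrite e eqxx.
have g_inj := can_inj gK.
have LE (F : {set 'I_m.-1}) : (F \in faces (del_vertex K v)) = (F \in pull th (faces_of Fc)).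
  rewrite inE KE mem_push // mem_pull; have -> : g @^-1: (lift v @: F) = th @: F.
    apply/setP => x; rewrite inE; apply/imsetP/imsetP => [[y yF e]|[y yF ->]].
      by exists y; rewrite // /th /= -e gK.
    by exists y; rewrite // /th /= hK.
  rewrite andb_idl // => _; apply/subsetP => y _; apply/imsetP; exists (h y); rewrite ?hK //.
have elp := elimination_pull th_inj el.
have cth (F : {set 'I_m.-1}) : #|th @: F| = #|F| by rewrite card_imset.
apply: (golod_criterion N_gt1 elp).
- by move=> F FN; rewrite LE !mem_pull TF // cth.
- move=> u; rewrite LE mem_pull imset_set1; have [G GF uG] := pm_cover pm N_gt1 (th u).
  by apply/faces_ofP; exists G; rewrite ?sub1set.
- move=> F; rewrite LE mem_pull => /faces_ofP[G GF FG].
  by rewrite -cth -(pm_card pm GF) subset_leq_card.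
- move=> J c; have [e he] := @top_cohomology k I Fc N m.-1 th (h v) pm N_gt1 th_inj th_i0 J c.
  by exists e => F; rewrite LE; exact: he.
Qed.

Lemma vertex_face v : [set v] \in faces K.
Proof.
have [h gK hK] := g_bij; have [G GF vG] := pm_cover pm N_gt1 (h v).
rewrite KE -(hK v) -imset_set1 push_imset; last exact: can_inj gK.
by apply/faces_ofP; exists G; rewrite ?sub1set.
Qed.

(** The full subcomplex on the two blocks survives the deletion of a vertex outside. *)
Lemma spare_join_del : spare_join Fc N -> exists v, ~ golod k (del_vertex K v).
Proof.
move=> [A [B [v [[dAB vAB A0 B0 cAB] nA nB hj]]]]; have [h gK hK] := g_bij.
have g_inj := can_inj gK.
exists (g v); pose lf (S : {set I}) : {set 'I_m.-1} := (fun u => h (lift (g v) u)) @^-1: S.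
have liftE (S : {set I}) : v \notin S -> lift (g v) @: lf S = g @: S.
  move=> vS; apply/setP => y; apply/imsetP/imsetP => [[u uS ->]|[x xS ->]].
    by exists (h (lift (g v) u)); rewrite ?hK //; rewrite inE in uS.
  have [u eu] : exists u, g x = lift (g v) u.
    have := unlift_none (g v); case: (unliftP (g v) (g x)) => [u ->|/g_inj e]; first by exists u.
    by rewrite -e xS in vS.
  by exists u; rewrite // inE -eu gK.
have faceE (S : {set I}) : v \notin S -> (lf S \in faces (del_vertex K (g v))) = (S \in faces_of Fc).
  by move=> vS; rewrite inE liftE // KE push_imset.
have [vA vB] : v \notin A /\ v \notin B by move: vAB; rewrite inE negb_or => /andP.
have clf (S : {set I}) : v \notin S -> #|lf S| = #|S|.
  by move=> vS; rewrite -(card_imset _ (@lift_inj _ (g v))) liftE // card_imset.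
have lfD (S : {set I}) u : lf S :\ u = lf (S :\ h (lift (g v) u)).
  apply/setP => z; rewrite !inE; congr (~~ _ && _).
  by rewrite (inj_eq (can_inj hK)) (inj_eq lift_inj).
have lfU (S S' : {set I}) : lf S :|: lf S' = lf (S :|: S') by apply/setP => z; rewrite !inE.
apply: (@nontrivial_product_not_golod k m.-1 (del_vertex K (g v)) (lf A :|: lf B) #|lf B|).
apply: join_nontrivial => //.
- by rewrite -card_gt0 clf // card_gt0.
- by rewrite -card_gt0 clf // card_gt0.
- rewrite -setI_eq0; apply/eqP/setP => u; rewrite !inE; apply/negP => /andP[uA].
  by rewrite (disjointFr dAB uA).
- by rewrite faceE.
- by rewrite faceE.
move=> u w uA wB; rewrite !lfD lfU faceE; first by rewrite !inE in uA wB; exact: hj.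
by rewrite in_setU !in_setD1 (negPf vA) (negPf vB) !andbF.
Qed.

End Deletion.

(** The only missing face contains all the vertices, so its class has no partner.  With
    [N] the number of vertices, no face has [N] of them. *)
Lemma simplex_golod (k : comNzRingType) m (K : simplicial_complex m) : 1 < m ->
  (forall F : {set 'I_m}, (F \in faces K) = (F != setT)) -> golod k K.
Proof.
move=> m1 KE; pose T : {set {set 'I_m}} := [set F : {set 'I_m} | F != setT].
have el : elimination (fun=> 0) (fun=> set0) [set setT] T m.
  split=> //.
  - by move=> F G FG; rewrite !inE; apply: contra_neq => e; apply/eqP; rewrite -subTset -e.
  - move=> F _; rewrite inE; split=> [FT E|/(_ setT)]; rewrite inE.
      by move=> /eqP->; rewrite subTset.
    by rewrite eqxx subTset; apply.
  - by move=> E; rewrite inE => /eqP->; rewrite cardsT card_ord.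
  - by move=> E E'; rewrite !inE => /eqP-> /eqP->; rewrite eqxx.
apply: (golod_criterion m1 el).
- by move=> F _; rewrite KE inE.
- move=> v; rewrite KE; apply/eqP => /(congr1 (fun F : {set 'I_m} => #|F|)).
  by rewrite cards1 cardsT card_ord => e; rewrite -e in m1.
- by move=> F _; rewrite -[X in _ <= X]card_ord max_card.
- move=> J c; exists (fun=> 0%R) => F; rewrite KE => FT FN; case/eqP: FT; apply/eqP.
  by rewrite eqEcard subsetT cardsT card_ord FN leqnn.
Qed.

(** * Boundaries of products of simplices *)

(** The facets of a product of simplices are pairs of a factor and a facet of that
    factor; its vertices choose in every factor the one facet that they avoid. *)
Section ProductBoundary.
Variables (r : nat) (n : 'I_r -> nat).

Definition pfacet := {i : 'I_r & 'I_(n i).+1}.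
Definition choices := {dffun forall i : 'I_r, 'I_(n i).+1}.

Implicit Types (f h : choices) (x y : pfacet) (i : 'I_r) (F R : {set pfacet}).

Definition avoided f i : pfacet := Tagged (fun i => 'I_(n i).+1) (f i).
Definition corner f : {set pfacet} := [set x | avoided f (tag x) != x].
Definition product_facets : {set {set pfacet}} := [set corner f | f : choices].
Definition block i : {set pfacet} := [set x : pfacet | tag x == i].

Lemma avoided_inj f h i : avoided f i = avoided h i -> f i = h i.
Proof. by move/eqP; rewrite eq_Tagged => /eqP. Qed.

Lemma in_corner f x : (x \in corner f) = (avoided f (tag x) != x).
Proof. by rewrite inE. Qed.

Lemma in_cornerE f x : (x \in corner f) = (f (tag x) != tagged x).
Proof. by case: x => i j; rewrite in_corner /avoided eq_Tagged. Qed.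

Lemma avoided_corner f h i : (avoided h i \in corner f) = (f i != h i).
Proof.
rewrite in_corner /=; congr (~~ _); apply/eqP/eqP => [/avoided_inj //|].
by rewrite /avoided => ->.
Qed.

Lemma corner_inj : injective corner.
Proof.
move=> f h e; apply/ffunP => i; apply/eqP/negPn.
by rewrite -avoided_corner e avoided_corner eqxx.
Qed.

Definition change f x : choices := finfun (dfwith f (tagged x)).

Lemma avoided_change f x : avoided (change f x) (tag x) = x.
Proof. by rewrite /avoided ffunE dfwith_in; case: x. Qed.

Lemma changeN f x i : tag x != i -> change f x i = f i.
Proof. by move=> h; rewrite ffunE dfwith_out. Qed.

Lemma corner_change f x : corner f :\ x \subset corner (change f x).
Proof.
apply/subsetP => y; rewrite !inE => /andP[yx yf].
have [e|xy] := eqVneq (tag x) (tag y); first by rewrite -e avoided_change eq_sym.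
by rewrite /avoided (changeN _ xy).
Qed.

Lemma card_corner f : #|corner f| = \sum_(i < r) n i.
Proof.
have cN : #|~: corner f| = r.
  rewrite -[RHS]card_ord -cardsT -(card_imset (f := avoided f)); last by move=> i j /(congr1 tag).
  apply: eq_card => x; rewrite !inE negbK; apply/eqP/imsetP => [<-|[i _ ->]] //.
  by exists (tag x).
have := cardsC (corner f); rewrite cN card_tagged sumnE big_map big_enum /=.
under eq_bigr => i _ do rewrite card_ord -addn1.
by rewrite big_split /= sum1_card card_ord => /addIn.
Qed.

Lemma card_block i : #|block i| = (n i).+1.
Proof.
rewrite -[RHS]card_ord -cardsT -(card_imset (f := Tagged (fun i => 'I_(n i).+1) (i := i))).
  apply: eq_card => x; rewrite inE; apply/eqP/imsetP => [<-|[j _ ->]] //.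
  by exists (tagged x); case: x.
by move=> j j' /eqP; rewrite eq_Tagged => /eqP.
Qed.

(** The product is dual to a join of boundaries of simplices. *)
Lemma product_faceP F : (F \in faces_of product_facets) = [forall i, ~~ (block i \subset F)].
Proof.
apply/faces_ofP/forallP => [[_ /imsetP[f _ ->] Ff] i|h].
  apply/negP => iF; have : avoided f i \in block i by rewrite inE.
  by move/(subsetP iF)/(subsetP Ff); rewrite avoided_corner eqxx.
have {}h i : [exists j : 'I_(n i).+1, Tagged (fun i => 'I_(n i).+1) j \notin F].
  have /subsetPn[[i' j] ij xF] := h i; rewrite inE /= in ij; move/eqP: ij => ij; subst i'.
  by apply/existsP; exists j.
pose f : choices := finfun (fun i => xchoose (existsP (h i))).
exists (corner f); first by exact: imset_f.
apply/subsetP => x xF; rewrite in_corner; apply: contraTneq xF => <-.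
by rewrite /avoided ffunE; exact: (xchooseP (existsP (h (tag x)))).
Qed.

Hypothesis n_gt0 : forall i, 0 < n i.

Let N := \sum_(i < r) n i.

Lemma product_cover x : exists2 G, G \in product_facets & x \in G.
Proof.
have fc f : corner f \in product_facets by exact: imset_f.
case: x => i j; pose x : pfacet := Tagged (fun i => 'I_(n i).+1) (inord (j == ord0) : 'I_(n i).+1).
pose f0 : choices := finfun (fun i : 'I_r => ord0 : 'I_(n i).+1).
exists (corner (change f0 x)); first exact: fc.
rewrite in_corner -[tag _]/(tag x) avoided_change /x eq_Tagged /=.
apply/eqP => /(congr1 val); rewrite /= inordK; last by case: (_ == _); rewrite // ltnS n_gt0.
by have [->|j0] := eqVneq j ord0 => // e; case/eqP: j0; apply: val_inj.
Qed.

Lemma product_pseudomanifold : pseudomanifold product_facets N.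
Proof.
have fc f : corner f \in product_facets by exact: imset_f.
split.
- by move=> _ /imsetP[f _ ->]; rewrite card_corner.
- move=> _ x /imsetP[f _ ->] xf; exists (corner (change f x)); first exact: fc.
  split; last exact: corner_change.
  apply/eqP => /setP/(_ x); rewrite xf in_corner avoided_change eqxx //.
- move=> R _ _ _ cR /imsetP[f _ ->] /imsetP[h _ ->] /imsetP[h' _ ->] Rf Rh Rh' fh fh'.
  have [x0 x0f Rx0] : exists2 x0, x0 \in corner f & R = corner f :\ x0.
    by apply: subset_D1; rewrite // card_corner.
  have key f' : R \subset corner f' -> corner f != corner f' -> f' = change f x0.
    move=> Rf' ff'; have off i : f' i != f i -> avoided f' i = x0.
      move=> ne; apply/eqP/negPn/negP => ne'; have : avoided f' i \in R.
        by rewrite Rx0 in_setD1 ne' avoided_corner eq_sym.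
      by move/(subsetP Rf'); rewrite avoided_corner eqxx.
    have [i0 ni0] : exists i, f' i != f i.
      apply/existsP; apply: contraNT ff' => /existsPn same.
      by apply/eqP; congr corner; apply/ffunP => i; have := same i; rewrite negbK => /eqP.
    have t0 : tag x0 = i0 by rewrite -(off i0 ni0).
    apply/ffunP => i; have [e|xi] := eqVneq (tag x0) i.
      by apply: avoided_inj; rewrite -e avoided_change; apply: off; rewrite e -t0 e in ni0 *.
    rewrite changeN //; apply/eqP; apply: contraNT xi => /off e.
    by rewrite -e.
  by rewrite (key h) // (key h').
- move=> _ _ /imsetP[f _ ->] /imsetP[h _ ->].
  have [k] := ubnP #|[set i | f i != h i]|; elim: k f => // k IH f.
  have [e _|/set0Pn[i]] := eqVneq [set i | f i != h i] set0.
    suff -> : f = h by [].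
    by apply/ffunP => i; apply/eqP/negPn; have /setP/(_ i) := e; rewrite !inE => ->.
  rewrite inE ltnS => fhi ck; pose x := avoided h i.
  have xf : x \in corner f by rewrite avoided_corner.
  apply: (@connect_trans _ _ (corner (change f x))).
    apply: connect1; apply/and3P; split; [exact: fc|exact: fc|].
    by apply/exists_inP; exists x; [exact: xf|exact: corner_change].
  apply: IH; apply: leq_trans ck; apply: proper_card; apply/properP; split.
    apply/subsetP => j; rewrite !inE; have [<-|ij] := eqVneq i j.
      by rewrite fhi.
    by rewrite changeN.
  exists i; rewrite !inE ?fhi // negbK; apply/eqP/avoided_inj.
  exact: (avoided_change f x).
by move=> _ x; exact: product_cover.
Qed.

(** Before any cut there are no vertices of positive rank.  Two blocks are only large
    enough to satisfy [el_disj] if there is no third one. *)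
Lemma product_stacked : r <= 2 -> stacked product_facets N.
Proof.
move=> r2; exists (fun=> 0), (fun=> set0), [set block i | i : 'I_r], (faces_of product_facets).
split=> //.
- split=> //.
  + by move=> F G FG; exact: faces_of_sub.
  + move=> F _; rewrite product_faceP; split=> [/forallP h _ /imsetP[i _ ->] //|h].
    by apply/forallP => i; apply: h; exact: imset_f.
  + by move=> _ /imsetP[i _ ->]; rewrite card_block ltnS n_gt0.
  + move=> _ _ /imsetP[i _ ->] /imsetP[i' _ ->] ne.
    have ii' : i != i' by apply: contra_neq ne => ->.
    split.
      by rewrite -setI_eq0; apply/eqP/setP => x; rewrite !inE; case: eqP => // ->; exact/negbTE.
    rewrite !card_block /N (bigD1 i) //= (bigD1 i') ?(eq_sym i') //= big1 ?addn0 => [|j /andP[ji ji']].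
      by rewrite addn2 addSn addnS.
    move: ii' ji ji'; rewrite -!val_eqE /=.
    by have := ltn_ord i; have := ltn_ord i'; have := ltn_ord j; clear -r2; lia.
- by apply/subsetP => F FF; apply/faces_ofP; exists F.
Qed.

Lemma block_join i j : i != j ->
  [/\ [disjoint block i & block j], block i != set0, block j != set0,
      block i \notin faces_of product_facets & block j \notin faces_of product_facets].
Proof.
move=> ij; split.
- by rewrite -setI_eq0; apply/eqP/setP => x; rewrite !inE; case: eqP => // ->; exact/negbTE.
- by rewrite -card_gt0 card_block.
- by rewrite -card_gt0 card_block.
- by rewrite product_faceP; apply/forallPn; exists i; rewrite subxx.
- by rewrite product_faceP; apply/forallPn; exists j; rewrite subxx.
Qed.

Lemma block_join_faces i j x y : i != j -> x \in block i -> y \in block j ->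
  (block i :\ x) :|: (block j :\ y) \in faces_of product_facets.
Proof.
move=> ij xb yb; have /eqP xi : tag x == i by rewrite inE in xb.
have /eqP yj : tag y == j by rewrite inE in yb.
rewrite product_faceP; apply/forallP => l.
have [<-|il] := eqVneq i l.
  by apply/subsetPn; exists x; rewrite !inE ?eqxx /= ?xi ?eqxx //= (negPf ij) andbF.
have [<-|jl] := eqVneq j l.
  by apply/subsetPn; exists y; rewrite !inE ?eqxx /= ?yj ?eqxx //= orbF (eq_sym j i) (negPf ij) andbF.
apply/subsetPn; exists (Tagged (fun i => 'I_(n i).+1) (ord0 : 'I_(n l).+1)); rewrite !inE //=.
by rewrite (eq_sym l i) (eq_sym l j) (negPf il) (negPf jl) !andbF.
Qed.

(** A third block leaves room between the dimension of the join of two blocks and that of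
    the whole complex. *)
Lemma product_spare_join : 2 < r -> spare_join product_facets N.
Proof.
move=> r3; have r1 := ltnW r3; have r0 := ltnW r1.
pose i0 := Ordinal r0; pose i1 := Ordinal r1; pose i2 := Ordinal r3.
have [d b0 b1 f0 f1] := @block_join i0 i1 isT.
exists (block i0), (block i1), (Tagged (fun i => 'I_(n i).+1) (ord0 : 'I_(n i2).+1)).
split=> //; last by move=> x y; exact: block_join_faces.
split=> //; first by rewrite !inE.
rewrite !card_block /N (bigD1 i0) //= (bigD1 i1) //= (bigD1 i2) //=.
by have := n_gt0 i2; lia.
Qed.

Lemma product_detects (k : comNzRingType) : r = 2 -> detects k product_facets N.
Proof.
move=> r2; have r1 : 1 < r by rewrite r2.
have r0 := ltnW r1; pose i0 := Ordinal r0; pose i1 := Ordinal r1.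
have [d b0 b1 f0 f1] := @block_join i0 i1 isT.
apply: (@join_detects k _ _ (block i0) (block i1)) => //.
- apply/setP => x; rewrite !inE; have := ltn_ord (tag x).
  by rewrite -!val_eqE [X in _ < X]r2 /=; case: (val _) => [|[|]].
- by rewrite card_block /N (bigD1 i0) //= (bigD1 i1) //=; have := n_gt0 i0; lia.
- by move=> x y; exact: block_join_faces.
Qed.

Lemma card_product_facets : r = 1 -> #|product_facets| = N.+1.
Proof.
move=> r1; have r0 : 0 < r by rewrite r1.
pose i0 := Ordinal r0; have e0 i : i = i0 by apply: val_inj; case: i => -[|i] //=; rewrite [X in _ < X]r1.
rewrite card_imset; last exact: corner_inj.
rewrite card_dep_ffun /N (bigD1 i0) //= big1 ?addn0; last by move=> i; rewrite (e0 i) eqxx.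
rewrite foldrE big_image (bigD1 i0) //= big1 ?muln1 ?card_ord // => i.
by rewrite (e0 i) eqxx.
Qed.

End ProductBoundary.

(** A simplex cut at a vertex is a prism. *)
Lemma cut_simplex_detects (k : comNzRingType) (I : finType) (Fc : {set {set I}}) (x0 : I) N :
  pseudomanifold Fc N -> 0 < N -> [set~ x0] \in Fc ->
  (forall F, F != setT -> F \in faces_of Fc) -> detects k (cut_facets Fc [set~ x0]) N.
Proof.
move=> pm N0 sF full; have cs := pm_card pm sF.
apply: (@join_detects k _ _ [set None; Some x0] (Some @: [set~ x0])).
- apply/setP => -[x|]; rewrite !inE // mem_SomeI !inE -[Some x == Some x0]/(x == x0).
  by case: (x =P x0).
- rewrite -setI_eq0; apply/eqP/setP => -[x|]; rewrite !inE ?None_notin ?andbF //.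
  by rewrite mem_SomeI !inE -[Some x == Some x0]/(x == x0) /=; case: (x =P x0).
- by apply/set0Pn; exists None; rewrite !inE.
- by rewrite -card_gt0 card_Some cs.
- rewrite cut_face_in ?inE //; apply/negP => /proper_sub/subsetP/(_ x0).
  by rewrite !inE !eqxx orbT => /(_ isT).
- by rewrite (cut_face_out pm sF) ?None_notin // base_partK eqxx andbF.
- by rewrite card_Some cs.
move=> x y + /imsetP[z zs ->].
have zx0 : z != x0 by rewrite !inE in zs.
have zn (F : {set I}) : z \notin F -> F != setT by apply: contraNneq => ->; rewrite inE.
move=> /set2P[]->; last first.
  rewrite cut_face_in ?inE //; apply/properP; split.
    by apply/subsetP => u; rewrite !inE mem_SomeI !inE -[Some u == Some x0]/(u == x0); case: (u =P x0); rewrite ?andbF.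
  exists z => //; rewrite !inE mem_SomeI -[Some z == Some x0]/(z == x0) !eqxx (negPf zx0) //.
rewrite (cut_face_out pm sF); last by rewrite !inE None_notin.
apply/andP; split.
  by apply/full/zn; rewrite !inE -[Some z == Some x0]/(z == x0) (negPf zx0) !eqxx andbF.
by apply/eqP => /setP/(_ x0); rewrite !inE !eqxx.
Qed.

Lemma product_cut_detects (k : comNzRingType) r (n : 'I_r -> nat) sigma :
  (forall i, 0 < n i) -> r = 1 -> sigma \in product_facets n ->
  detects k (cut_facets (product_facets n) sigma) (\sum_(i < r) n i).
Proof.
move=> n_gt0 r1; have r0 : 0 < r by rewrite r1.
pose i0 := Ordinal r0; have e0 i : i = i0 by apply: val_inj; case: i => -[|i] //=; rewrite [X in _ < X]r1.
move=> /[dup] sF /imsetP[f _ sf].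
have es : sigma = [set~ avoided f i0].
  by apply/setP => x; rewrite sf !inE (e0 (tag x)) eq_sym.
rewrite es in sF *; apply: cut_simplex_detects => //.
- exact: product_pseudomanifold.
- by rewrite (bigD1 i0) //= addn_gt0 n_gt0.
- move=> F; apply: contraR; rewrite product_faceP => /forallPn[i]; rewrite negbK => h.
  by rewrite -subTset; apply: subset_trans h; apply/subsetP => x _; rewrite inE; apply/eqP; exact: etrans (e0 _) (esym (e0 _)).
Qed.

(** * Convex hulls *)

Local Open Scope ring_scope.

Section Hull.
Variables (R : realType) (N : nat).
Implicit Types (x y z v : 'rV[R]_N) (c d : 'cV[R]_N).

Lemma dotrDl x y c : dotr (x + y) c = dotr x c + dotr y c.
Proof. by rewrite /dotr mulmxDl mxE. Qed.

Lemma dotrBl x y c : dotr (x - y) c = dotr x c - dotr y c.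
Proof. by rewrite /dotr mulmxBl !mxE. Qed.

Lemma dotrZl (t : R) x c : dotr (t *: x) c = t * dotr x c.
Proof. by rewrite /dotr -scalemxAl mxE. Qed.

Lemma dotr0l c : dotr 0 c = 0. Proof. by rewrite /dotr mul0mx mxE. Qed.

Lemma dotr_suml (T : Type) (s : seq T) (P : pred T) (F : T -> 'rV[R]_N) c :
  dotr (\sum_(t <- s | P t) F t) c = \sum_(t <- s | P t) dotr (F t) c.
Proof. by rewrite /dotr mulmx_suml summxE. Qed.

Lemma dotr_sumr (T : Type) (s : seq T) (P : pred T) x (F : T -> 'cV[R]_N) :
  dotr x (\sum_(t <- s | P t) F t) = \sum_(t <- s | P t) dotr x (F t).
Proof. by rewrite /dotr mulmx_sumr summxE. Qed.

Definition hull (T : finType) (S : {set T}) (p : T -> 'rV[R]_N) x := exists w : T -> R,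
  [/\ forall t, 0 <= w t, \sum_(t in S) w t = 1 & x = \sum_(t in S) w t *: p t].

Lemma hull_point (T : finType) (S : {set T}) (p : T -> 'rV[R]_N) t : t \in S -> hull S p (p t).
Proof.
move=> tS; exists (fun u => (u == t)%:R); split=> [u||]; first by case: (u == t).
  rewrite (bigD1 t) //= eqxx big1 ?addr0 // => u /andP[_ ut].
  by rewrite (negPf ut).
rewrite (bigD1 t) //= eqxx scale1r big1 ?addr0 // => u /andP[_ ut].
by rewrite (negPf ut) scale0r.
Qed.

Lemma hull_convex (T T' : finType) (S : {set T}) (S' : {set T'}) (p : T -> 'rV[R]_N)
    (q : T' -> 'rV[R]_N) x : hull S' q x -> (forall t, t \in S' -> hull S p (q t)) -> hull S p x.
Proof.
move=> [w [w0 w1 ->]] h.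
have /choice[u hu] (t : T') : exists u : T -> R, t \in S' ->
    [/\ forall s, 0 <= u s, \sum_(s in S) u s = 1 & q t = \sum_(s in S) u s *: p s].
  by have [/h[u hu]|tS] := boolP (t \in S'); [exists u | exists (fun=> 0)].
exists (fun s => \sum_(t in S') w t * u t s); split=> [s||].
- by apply: sumr_ge0 => t /hu[u0 _ _]; exact: mulr_ge0.
- rewrite exchange_big -[RHS]w1; apply: eq_bigr => t /hu[_ u1 _].
  by rewrite -mulr_sumr u1 mulr1.
under [RHS]eq_bigr => s _ do rewrite scaler_suml.
rewrite exchange_big; apply: eq_bigr => t /hu[_ _ ->].
by rewrite scaler_sumr; apply: eq_bigr => s _; rewrite scalerA.
Qed.

Lemma hull_segment (T : finType) (S : {set T}) (p : T -> 'rV[R]_N) (t : R) x y :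
  0 <= t <= 1 -> hull S p x -> hull S p y -> hull S p (x + t *: (y - x)).
Proof.
move=> /andP[t0 t1] hx hy.
apply: (@hull_convex _ _ S setT p (fun b : bool => if b then y else x)); last by case.
exists (fun b : bool => if b then t else 1 - t); split.
- by case=> //; rewrite subr_ge0.
- by rewrite (eq_bigl predT) ?big_bool /= => [|b]; rewrite ?inE // addrC subrK.
rewrite (eq_bigl predT) => [|b]; rewrite ?inE // big_bool /=.
by rewrite scalerBr scalerBl scale1r addrCA.
Qed.

Lemma hull_le (T : finType) (S : {set T}) (p : T -> 'rV[R]_N) c (m : R) x :
  hull S p x -> (forall t, t \in S -> dotr (p t) c <= m) -> dotr x c <= m.
Proof.
move=> [w [w0 w1 ->]] h; rewrite dotr_suml -[m]mul1r -w1 mulr_suml.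
by apply: ler_sum => t tS; rewrite dotrZl ler_wpM2l // h.
Qed.

(** The nonnegative slacks of the generators average to zero. *)
Lemma hull_max (T : finType) (S : {set T}) (p : T -> 'rV[R]_N) (w : T -> R) c (m : R) :
  (forall t, 0 <= w t) -> \sum_(t in S) w t = 1 ->
  (forall t, t \in S -> dotr (p t) c <= m) -> dotr (\sum_(t in S) w t *: p t) c = m ->
  forall t, t \in S -> w t != 0 -> dotr (p t) c = m.
Proof.
move=> w0 w1 le e t tS wt.
have /psumr_eq0P h : \sum_(t in S) w t * (m - dotr (p t) c) = 0.
  under eq_bigr => u _ do rewrite mulrBr.
  rewrite sumrB -mulr_suml w1 mul1r -[in X in X - _]e dotr_suml.
  by under eq_bigr => u _ do rewrite dotrZl; rewrite subrr.
have /eqP := h (fun u uS => mulr_ge0 (w0 u) (etrans (subr_ge0 _ _) (le u uS))) t tS.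
by rewrite mulf_eq0 (negPf wt) subr_eq0 => /eqP.
Qed.

End Hull.

(** A family of vectors and a family of functionals that are dual up to scaling are bases. *)
Lemma dual_decomposition (R : realType) N (I : finType) (S : {set I}) (e : I -> 'rV[R]_N)
    (a : I -> 'cV[R]_N) z : #|S| = N ->
  (forall x y, x \in S -> y \in S -> y != x -> dotr (e x) (a y) = 0) ->
  (forall x, x \in S -> dotr (e x) (a x) != 0) ->
  z = \sum_(x in S) (dotr z (a x) / dotr (e x) (a x)) *: e x.
Proof.
move=> cS; case: N / cS e a z => e a z e0 e1; rewrite big_enum_val /=.
pose t (k : 'I_#|S|) : I := enum_val k.
have tS k : t k \in S by exact: enum_valP.
pose E := \matrix_k e (t k); pose A := \matrix_(i, k) a (t k) i 0.
have dA x k : (x *m A) 0 k = dotr x (a (t k)).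
  by rewrite /dotr !mxE; apply: eq_bigr => i _; rewrite !mxE.
pose D := diag_mx (\row_k (dotr (e (t k)) (a (t k)))^-1).
have EAD : E *m (A *m D) = 1%:M.
  apply/matrixP => k l; rewrite mulmxA mul_mx_diag !mxE.
  have -> : \sum_j E k j * A j l = dotr (e (t k)) (a (t l)).
    by rewrite /dotr !mxE; apply: eq_bigr => j _; rewrite !mxE.
  have [->|kl] := eqVneq k l; first by rewrite mulfV ?e1.
  by rewrite e0 ?mul0r // (inj_eq enum_val_inj) eq_sym.
have {1}-> : z = z *m (A *m D) *m E by rewrite -mulmxA (mulmx1C EAD) mulmx1.
rewrite mulmx_sum_row; apply: eq_bigr => k _; rewrite rowK mulmxA mul_mx_diag mxE dA mxE //.
Qed.

(** Matrices of points with a prescribed order of rows are only used to match [is_facet]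
    and [is_simplex]; here is the passage from families indexed by a finite set. *)
Lemma affine_family (R : realType) N q (T : finType) (S : {set T}) (p : T -> 'rV[R]_N) :
  #|S| = q ->
  (forall c : T -> R, \sum_(t in S) c t = 0 -> \sum_(t in S) c t *: p t = 0 ->
     forall t, t \in S -> c t = 0) ->
  exists V : 'M[R]_(q, N), [/\ affinely_free V, forall k, exists2 t, t \in S & row k V = p t &
    forall x, conv_rows V x <-> hull S p x].
Proof.
move=> cS; case: q / cS => free; pose t (k : 'I_#|S|) : T := enum_val k.
have tS k : t k \in S by exact: enum_valP.
pose V := \matrix_k p (t k); exists V; split.
- apply: inj_row_free => v; rewrite mul_mx_row => e.
  pose c (u : T) : R := \sum_k v 0 k * (t k == u)%:R.
  have ct k : c (t k) = v 0 k.
    rewrite /c (bigD1 k) //= eqxx mulr1 big1 ?addr0 // => l lk.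
    by rewrite (inj_eq enum_val_inj) (negPf lk) mulr0.
  have [e1 e2] : v *m const_mx 1 = 0 :> 'cV_1 /\ v *m V = 0.
    by apply: eq_row_mx; rewrite e row_mx0.
  apply/rowP => k; rewrite -ct mxE; apply: free (tS k).
    rewrite big_enum_val /=; under eq_bigr => l _ do rewrite ct.
    have := congr1 (fun M : 'M_1 => M 0 0) e1; rewrite !mxE => h.
    by rewrite -[RHS]h; apply: eq_bigr => l _; rewrite mxE mulr1.
  rewrite big_enum_val /=; under eq_bigr => l _ do rewrite ct.
  rewrite -[RHS]e2 mulmx_sum_row; apply: eq_bigr => l _; by rewrite rowK.
- by move=> k; exists (t k); rewrite ?rowK.
move=> x; split=> [[w [w0 w1 ->]]|[w [w0 w1 ->]]].
  rewrite mulmx_sum_row; apply: (@hull_convex _ _ _ _ S setT p (fun k => p (t k))).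
    exists (fun k => w 0 k); split=> //; first by rewrite -[RHS]w1; apply: eq_bigl => k; rewrite inE.
    by apply: eq_big => k; rewrite ?inE ?rowK.
  by move=> k _; exact: hull_point.
exists (\row_k w (t k)); split=> [k||]; first by rewrite mxE.
  by rewrite -[RHS]w1 [RHS]big_enum_val; apply: eq_bigr => k _; rewrite mxE.
by rewrite mulmx_sum_row [LHS]big_enum_val; apply: eq_bigr => k _; rewrite mxE rowK.
Qed.

(** * Vertices, edges and facets of realized polytopes *)

(** [P] is the convex hull of points indexed by [Fc], and the inequalities indexed by
    [I] are tight on them exactly as prescribed by membership: [P] is a simple
    polytope whose dual boundary has the facets [Fc]. *)
Record realizes (R : realType) N (I : finType) (Fc : {set {set I}}) (P : set 'rV[R]_N)
    (vert : {set I} -> 'rV[R]_N) (a : I -> 'cV[R]_N) (b : I -> R) : Prop := Realizes {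
  rz_hull : forall x, P x <-> hull Fc vert x;
  rz_le : forall G i, G \in Fc -> dotr (vert G) (a i) <= b i;
  rz_eq : forall G i, G \in Fc -> (dotr (vert G) (a i) == b i) = (i \in G)
}.

Section Realization.
Variables (R : realType) (N : nat) (I : finType) (Fc : {set {set I}}) (P : set 'rV[R]_N).
Variables (vert : {set I} -> 'rV[R]_N) (a : I -> 'cV[R]_N) (b : I -> R).
Hypotheses (rz : realizes Fc P vert a b) (pm : pseudomanifold Fc N).
Implicit Types (G H : {set I}) (x y z : 'rV[R]_N) (i j : I).

Lemma rz_vert G : G \in Fc -> P (vert G).
Proof. by move=> GF; apply/(rz_hull rz); exact: hull_point. Qed.

Lemma rz_valid x i : P x -> dotr x (a i) <= b i.
Proof. by move=> /(rz_hull rz) h; apply: hull_le h _ => G; exact: (rz_le rz). Qed.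

Lemma rz_tight G i : G \in Fc -> i \in G -> dotr (vert G) (a i) = b i.
Proof. by move=> GF iG; apply/eqP; rewrite (rz_eq rz). Qed.

Lemma rz_lt G i : G \in Fc -> i \notin G -> dotr (vert G) (a i) < b i.
Proof. by move=> GF iG; rewrite lt_neqAle (rz_eq rz) // iG (rz_le rz). Qed.

Let sub_facet G H : G \in Fc -> H \in Fc -> G \subset H -> G = H.
Proof.
by move=> GF HF GH; apply/eqP; rewrite eqEcard GH (pm_card pm GF) (pm_card pm HF) leqnn.
Qed.

Lemma vert_inj G H : G \in Fc -> H \in Fc -> vert G = vert H -> G = H.
Proof. by move=> GF HF e; apply/setP => i; rewrite -!(rz_eq rz) // e. Qed.

(** Any vertex that occurs in a convex combination for [x] lies on every face through [x]. *)
Lemma tight_facet x : P x -> exists2 G, G \in Fc & forall c m,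
  (forall H, H \in Fc -> dotr (vert H) c <= m) -> dotr x c = m -> dotr (vert G) c = m.
Proof.
move=> /(rz_hull rz)[w [w0 w1 ->]].
have [G GF wG] : exists2 G, G \in Fc & w G != 0.
  apply/exists_inP; apply: contra_eqT w1 => /exists_inPn h.
  by rewrite big1 1?eq_sym ?oner_neq0 // => G /h; rewrite negbK => /eqP.
by exists G => // c m h e; exact: (hull_max w0 w1 h e).
Qed.

Lemma vertex_unique x G : G \in Fc -> P x -> (forall i, i \in G -> dotr x (a i) = b i) -> x = vert G.
Proof.
move=> GF /(rz_hull rz)[w [w0 w1 ex]] h.
rewrite ex -[vert G]scale1r -w1 scaler_suml; apply: eq_bigr => H HF.
have [->|wH] := eqVneq (w H) 0; first by rewrite !scale0r.
congr (_ *: vert _); apply/esym/sub_facet => //; apply/subsetP => i iG.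
rewrite -(rz_eq rz) //; apply/eqP; apply: (hull_max w0 w1 _ _ HF wH).
  by move=> K KF; exact: (rz_le rz).
by rewrite -ex h.
Qed.

(** The sum of the functionals tight at [vert G] exposes it, by [vertex_unique]. *)
Lemma is_vertexP v : is_vertex P v <-> exists2 G, G \in Fc & v = vert G.
Proof.
split=> [[Pv [c hc]]|[G GF ->]].
  have [G GF hG] := tight_facet Pv; exists G => //; apply/eqP/negPn/negP => /eqP ne.
  have le H : H \in Fc -> dotr (vert H) c <= dotr v c.
    move=> HF; have [->//|/eqP Hv] := eqVneq (vert H) v; apply/ltW/hc => //; exact: rz_vert.
  by have := hc (vert G) (rz_vert GF) (fun e => ne (esym e)); rewrite (hG c _ le) // ltxx.
split; first exact: rz_vert.
exists (\sum_(i in G) a i) => x Px /eqP xG; rewrite !dotr_sumr.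
have le i : i \in G -> dotr x (a i) <= dotr (vert G) (a i).
  by move=> iG; rewrite rz_tight //; exact: rz_valid.
rewrite lt_neqAle ler_sum // andbT; apply: contra xG => /eqP e.
apply/eqP/vertex_unique => // i iG; rewrite -(rz_tight GF iG).
have /psumr_eq0P h : \sum_(i in G) (dotr (vert G) (a i) - dotr x (a i)) = 0.
  by rewrite sumrB e subrr.
by apply/esym/eqP; rewrite -subr_eq0 h // => j jG; rewrite subr_ge0 le.
Qed.

(** The other end of the edge at the vertex [G] that leaves the facet [i]. *)
Definition neighbor G i : {set I} :=
  odflt G [pick H in Fc | (H != G) && (G :\ i \subset H)].

Definition edge G i := vert (neighbor G i) - vert G.

Lemma neighborP G i : G \in Fc -> i \in G ->
  [/\ neighbor G i \in Fc, neighbor G i != G & forall j, j \in G -> (j \in neighbor G i) = (j != i)].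
Proof.
move=> GF iG; rewrite /neighbor; case: pickP => [H /and3P[HF HG sH]|h] /=; last first.
  by have [H HF [HG sH]] := pm_other pm GF iG; have := h H; rewrite HF HG sH.
split=> // j jG; have [->|ji] := eqVneq j i; last by rewrite (subsetP sH) // !inE ji.
apply: contra_neqF HG => iH; apply/esym/sub_facet => //; apply/subsetP => l lG.
by have [->|li] := eqVneq l i; rewrite // (subsetP sH) // !inE li.
Qed.

Lemma edge_flat G i j : G \in Fc -> i \in G -> j \in G -> j != i -> dotr (edge G i) (a j) = 0.
Proof.
move=> GF iG jG ji; have [HF _ h] := neighborP GF iG.
by rewrite dotrBl !rz_tight ?subrr // h.
Qed.

Lemma edge_neg G i : G \in Fc -> i \in G -> dotr (edge G i) (a i) < 0.
Proof.
move=> GF iG; have [HF _ h] := neighborP GF iG.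
by rewrite dotrBl (rz_tight GF iG) subr_lt0 rz_lt // h // eqxx.
Qed.

(** The edges at a simple vertex are dual, up to scaling, to the facets through it. *)
Lemma edge_decomposition G z : G \in Fc ->
  z = \sum_(i in G) (dotr z (a i) / dotr (edge G i) (a i)) *: edge G i.
Proof.
move=> GF; apply: dual_decomposition; first exact: pm_card pm _ GF.
  by move=> i j iG jG ji; exact: edge_flat.
by move=> i iG; rewrite lt_eqF // edge_neg.
Qed.

Definition facet i : set 'rV[R]_N := [set x | P x /\ dotr x (a i) = b i]%classic.

(** The vertices are then [G] and its neighbours, and each facet through [G] misses exactly
    one of them, which makes them affinely independent. *)
Lemma few_vertices_simplex : Fc != set0 -> #|Fc| = N.+1 -> is_simplex P.
Proof.
move=> /set0Pn[G GF] cF.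
have nbG i : i \in G -> (neighbor G i \in Fc) /\ neighbor G i != G.
  by move=> iG; have [? ? _] := neighborP GF iG.
have nb_inj : {in G &, injective (neighbor G)}.
  move=> i j iG jG e; have [_ _ /(_ i iG)] := neighborP GF jG.
  have [_ _ /(_ i iG)] := neighborP GF iG; rewrite e eqxx => ->.
  by have [->|] := eqVneq i j.
have FE : Fc = G |: (neighbor G @: G).
  apply/esym/eqP; rewrite eqEcard; apply/andP; split.
    by apply/subsetP => H /setU1P[->//|/imsetP[i iG ->]]; case: (nbG i iG).
  rewrite cardsU1 card_in_imset // (pm_card pm GF) cF.
  suff -> : G \notin neighbor G @: G by [].
  by apply/imsetP => -[i iG e]; have [_] := nbG i iG; rewrite -e eqxx.
have [c c0 cv|V [Vfree _ VP]] := affine_family (p := vert) cF; last first.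
  by exists V => //; apply/predeqP => x; rewrite (rz_hull rz) VP.
have cnb i : i \in G -> c (neighbor G i) = 0.
  move=> iG; have [HF _ hi] := neighborP GF iG.
  have : \sum_(H in Fc) c H * (dotr (vert H) (a i) - b i) = 0.
    under eq_bigr => H _ do rewrite mulrBr.
    rewrite sumrB -mulr_suml c0 mul0r subr0.
    under eq_bigr => H _ do rewrite -dotrZl.
    by rewrite -dotr_suml cv dotr0l.
  rewrite (bigD1 (neighbor G i)) //= big1 ?addr0; last first.
    rewrite FE => H /andP[/setU1P[->|/imsetP[j jG ->]] ne].
      by rewrite rz_tight // subrr mulr0.
    have ji : i != j by apply: contra_neq ne => ->.
    by have [H'F _ hj] := neighborP GF jG; rewrite rz_tight ?subrr ?mulr0 // hj.
  move/eqP; rewrite mulf_eq0 => /orP[/eqP //|]; rewrite subr_eq0 (rz_eq rz) //.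
  by rewrite hi // eqxx.
move=> H; rewrite FE => /setU1P[->|/imsetP[i iG ->]]; last exact: cnb.
rewrite -[RHS]c0 (bigD1 G) //= big1 ?addr0 // => K /andP[]; rewrite FE.
by move=> /setU1P[->|/imsetP[i iG -> _]]; rewrite ?eqxx // cnb.
Qed.

Hypothesis cover : forall i, exists2 G, G \in Fc & i \in G.

(** If all the vertices on [i] were on another facet [j], leaving [j] at one of them would
    not leave [i]. *)
Lemma facet_inj : injective facet.
Proof.
move=> i j e; have [G GF iG] := cover i; have jG H : H \in Fc -> (i \in H) = (j \in H).
  have key l : H \in Fc -> l \in H <-> facet l (vert H).
    move=> HF; split=> [lH|[_ /eqP]]; last by rewrite (rz_eq rz).
    by split; [exact: rz_vert|exact: rz_tight].
  by move=> HF; apply/idP/idP => /(key _ HF); rewrite (e, esym e) => /(key _ HF).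
apply/eqP/negPn/negP => ij; have jG' : j \in G by rewrite -jG.
have [HF _ h] := neighborP GF jG'; have := jG _ HF.
by rewrite h // ij h // eqxx.
Qed.

(** The facet [i] is spanned by one of its vertices and the neighbours along its edges. *)
Lemma facet_is_facet i : is_facet P (facet i).
Proof.
have [G GF iG] := cover i; exists (a i), (b i); split=> //.
- apply/eqP => ai; have := edge_neg GF iG.
  by rewrite ai /dotr mulmx0 mxE ltxx.
- by move=> x; exact: rz_valid.
pose p j := if j == i then vert G else vert (neighbor G j).
have [c c0 cp|V [Vfree Vp _]] := affine_family (p := p) (pm_card pm GF); last first.
  exists V => // k; have [j jG ->] := Vp k; rewrite /p; case: eqVneq => [_|ji].
    by split; [exact: rz_vert|exact: rz_tight].
  have [HF _ h] := neighborP GF jG.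
  by split; [exact: rz_vert|apply: rz_tight; rewrite // h // eq_sym].
have cj j : j \in G -> j != i -> c j = 0.
  move=> jG ji; have : \sum_(l in G) c l * (dotr (p l) (a j) - b j) = 0.
    under eq_bigr => l _ do rewrite mulrBr.
    rewrite sumrB -mulr_suml c0 mul0r subr0.
    under eq_bigr => l _ do rewrite -dotrZl.
    by rewrite -dotr_suml cp dotr0l.
  have [HF _ h] := neighborP GF jG.
  rewrite (bigD1 j) //= big1 ?addr0; last first.
    move=> l /andP[lG lj]; rewrite /p; case: eqVneq => [_|li]; first by rewrite rz_tight ?subrr ?mulr0.
    by have [H'F _ h'] := neighborP GF lG; rewrite rz_tight ?subrr ?mulr0 // h' // eq_sym.
  rewrite /p (negPf ji) => /eqP; rewrite mulf_eq0 => /orP[/eqP //|]; rewrite subr_eq0 (rz_eq rz) //.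
  by rewrite h // eqxx.
move=> j jG; have [->|ji] := eqVneq j i; last exact: cj.
by rewrite -[RHS]c0 (bigD1 i) //= big1 ?addr0 // => l /andP[lG li]; exact: cj.
Qed.

(** A supporting functional is a nonnegative combination of the functionals tight at
    a vertex where it is maximal; two of them with positive coefficients would cut the
    face down to codimension two. *)
Lemma is_facetP F : (0 < N)%N -> is_facet P F -> exists i, F = facet i.
Proof.
move=> N_gt0 [c [m [c0 cm FE [V Vfree VF]]]].
have [G GF hG] : exists2 G, G \in Fc & dotr (vert G) c = m.
  have := VF (Ordinal N_gt0); rewrite FE => -[/tight_facet[G GF h] e].
  by exists G => //; apply: h e => H HF; apply: cm; exact: rz_vert.
pose l i := dotr (edge G i) c / dotr (edge G i) (a i).
have l0 i : i \in G -> 0 <= l i.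
  move=> iG; have [HF _ _] := neighborP GF iG.
  rewrite /l -mulrNN -invrN; apply: divr_ge0; rewrite oppr_ge0 ?(ltW (edge_neg GF iG)) //.
  by rewrite dotrBl hG subr_le0 cm //; exact: rz_vert.
have expand y : dotr y c - m = \sum_(i in G) l i * (dotr y (a i) - b i).
  rewrite -hG -dotrBl [in LHS](edge_decomposition (y - vert G) GF) dotr_suml.
  apply: eq_bigr => i iG; rewrite dotrZl dotrBl (rz_tight GF iG) /l.
  by rewrite mulrAC [RHS]mulrAC; congr (_ / _); exact: mulrC.
have Fl y i : F y -> i \in G -> l i != 0 -> dotr y (a i) = b i.
  rewrite FE => -[Py ey] iG li.
  have /psumr_eq0P h : \sum_(i in G) l i * (b i - dotr y (a i)) = 0.
    have e0 : dotr y c - m = 0 by rewrite ey subrr.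
    apply/eqP; rewrite -oppr_eq0 -sumrN -[X in _ == X]e0 expand; apply/eqP.
    by apply: eq_bigr => j _; rewrite -mulrN opprB.
  have /eqP := h (fun j jG => mulr_ge0 (l0 j jG) (etrans (subr_ge0 _ _) (rz_valid j Py))) i iG.
  by rewrite mulf_eq0 (negPf li) subr_eq0 => /eqP.
have [i iG li] : exists2 i, i \in G & l i != 0.
  apply/exists_inP; apply: contraNT c0 => /exists_inPn h; apply/eqP.
  have dc0 z : dotr z c = 0.
    rewrite [z](edge_decomposition z GF) dotr_suml big1 // => i iG; rewrite dotrZl.
    have := h i iG; rewrite negbK mulf_eq0 invr_eq0 [X in _ || X]lt_eqF ?edge_neg // orbF.
    by move=> /eqP->; rewrite mulr0.
  apply/colP => k; have := dc0 (delta_mx 0 k).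
  by rewrite /dotr -rowE !mxE.
have uniq j : j \in G -> j != i -> l j = 0.
  move=> jG ji; apply/eqP/negPn/negP => lj.
  pose M : 'M[R]_(N, 1 + N) := row_mx (const_mx 1) V.
  pose B : 'M[R]_(1 + N, 1 + 1) := block_mx (const_mx (- b i)) (const_mx (- b j)) (a i) (a j).
  have MB : M *m B = 0.
    apply/matrixP => k q; rewrite /M /B mul_row_block mxE.
    have V0 u : u \in G -> l u != 0 -> (const_mx 1 : 'cV_N) *m (const_mx (- b u) : 'M_1) + V *m a u = 0.
      move=> uG lu; apply/colP => k'; rewrite !mxE big_ord1 !mxE mul1r.
      have := Fl _ u (VF k') uG lu; rewrite /dotr -row_mul !mxE => ->; exact: addNr.
    by case: split => q'; rewrite V0 // !mxE.
  have := mulmx0_rank_max MB; rewrite (eqP Vfree).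
  pose C : 'M[R]_(1 + 1, 1 + N) := block_mx 0 (edge G i) 0 (edge G j).
  have CB : C *m B = diag_mx (row_mx (const_mx (dotr (edge G i) (a i))) (const_mx (dotr (edge G j) (a j)))).
    have d1 (x : 'rV[R]_N) (d : 'cV[R]_N) : x *m d = (dotr x d)%:M by apply: mx11_scalar.
    have s0 : (0 : R)%:M = 0 :> 'M_1 by apply/matrixP => p q; rewrite !mxE mul0rn.
    rewrite /C /B mulmx_block !mul0mx !add0r diag_mx_row !d1 !diag_const_mx.
    by rewrite (edge_flat GF iG jG ji) (edge_flat GF jG iG) ?s0 // eq_sym.
  have rC : \rank (C *m B) = 2%N.
    rewrite CB; apply/eqP; rewrite -[_ == _]/(row_free _) row_free_unit unitmxE det_diag.
    rewrite unitfE; apply/prodf_neq0 => q _; rewrite mxE.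
    by case: split => q'; rewrite mxE lt_eqF // edge_neg.
  by have := mxrankM_maxr C B; rewrite rC; clear; lia.
exists i; rewrite FE; apply/predeqP => y; split=> -[Py e]; split=> //.
  by apply: Fl; rewrite // FE.
apply/eqP; rewrite -subr_eq0 expand (bigD1 i) //= e subrr mulr0 add0r big1 // => j /andP[jG ji].
by rewrite uniq ?mul0r.
Qed.

End Realization.

(** * Nerves and vertex cuts *)

(** Every intersection of facets contains a vertex, and so lies under some [G] in [Fc]. *)
Lemma nerve_push (R : realType) N (I : finType) (Fc : {set {set I}}) (P : set 'rV[R]_N) vert a b
    m (F : 'I_m -> set 'rV[R]_N) :
  realizes Fc P vert a b -> pseudomanifold Fc N -> (0 < N)%N -> Fc != set0 ->
  (forall i, exists2 G, G \in Fc & i \in G) -> facet_numbering P F ->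
  exists2 g : I -> 'I_m, bijective g & faces (nerve F) = push g (faces_of Fc).
Proof.
move=> rz pm N0 /set0Pn[G0 G0F] cover [F_inj FP].
have /choice[g gP] i : exists j, F j = facet P a b i by apply/FP; exact: facet_is_facet rz pm cover i.
have /choice[h hP] j : exists i, F j = facet P a b i.
  by apply: (is_facetP rz pm) => //; apply/FP; exists j.
have gK : cancel g h by move=> i; apply: (facet_inj rz pm cover); rewrite -hP gP.
have hK : cancel h g by move=> j; apply: F_inj; rewrite gP -hP.
exists g; first by exists h.
apply/setP => A; rewrite mem_push; last exact: can_inj gK.
have -> /= : A \subset g @: setT by apply/subsetP => j _; apply/imsetP; exists (h j).
rewrite inE; apply/orP/faces_ofP => [[/eqP->|/asboolP[x xA]]|[G GF AG]].
- by exists G0 => //; apply/subsetP => i; rewrite !inE.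
- have [->|[j jA]] := set_0Vmem A; first by exists G0 => //; apply/subsetP => i; rewrite !inE.
  have Px : P x by have := xA j jA; rewrite hP => -[].
  have [G GF hG] := tight_facet rz Px; exists G => //; apply/subsetP => i; rewrite inE => iA.
  rewrite -(rz_eq rz) //; apply/eqP; apply: hG => [H HF|]; first exact: (rz_le rz).
  by have := xA _ iA; rewrite gP => -[].
right; apply/asboolP; exists (vert G) => j jA; rewrite hP.
have hG : h j \in G by apply: (subsetP AG); rewrite inE hK.
by split; [exact: (rz_vert rz)|exact: (rz_tight rz)].
Qed.

Section Cut.
Variables (R : realType) (N : nat) (I : finType) (Fc : {set {set I}}) (P Q : set 'rV[R]_N).
Variables (vert : {set I} -> 'rV[R]_N) (a : I -> 'cV[R]_N) (b : I -> R).
Variables (sigma : {set I}) (c : 'cV[R]_N) (m : R).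
Hypotheses (rz : realizes Fc P vert a b) (pm : pseudomanifold Fc N) (sF : sigma \in Fc).
Hypotheses (sm : m < dotr (vert sigma) c).
Hypothesis other : forall G, G \in Fc -> G != sigma -> dotr (vert G) c < m.
Hypothesis QE : forall x, Q x <-> P x /\ dotr x c <= m.

Let v := vert sigma.
Let ed := edge Fc vert sigma.

Let ratio i := (m - dotr v c) / dotr (ed i) c.

(* Where the edge at [sigma] that leaves the facet [i] meets the cutting hyperplane. *)
Let cutpoint i := v + ratio i *: ed i.

Let edc i : i \in sigma -> dotr (ed i) c < m - dotr v c.
Proof.
move=> iS; have [HF Hs _] := neighborP pm sF iS.
by rewrite dotrBl ltrD2r; exact: other.
Qed.

Let mv : m - dotr v c < 0. Proof. by rewrite subr_lt0. Qed.

Let ratioP i : i \in sigma -> 0 < ratio i < 1.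
Proof.
move=> iS; have e := edc iS; have e0 := lt_trans e mv.
rewrite /ratio -mulrNN -invrN divr_gt0 ?oppr_gt0 //=.
by rewrite ltr_pdivrMr ?oppr_gt0 // mul1r ltrN2.
Qed.

Let cutpoint_c i : i \in sigma -> dotr (cutpoint i) c = m.
Proof.
move=> iS; have e0 := lt_trans (edc iS) mv.
by rewrite dotrDl dotrZl /ratio divfK ?lt_eqF // addrC subrK.
Qed.

Let cutpoint_tight i j : i \in sigma -> (dotr (cutpoint i) (a j) == b j) = (j \in sigma) && (j != i).
Proof.
move=> iS; have [HF _ h] := neighborP pm sF iS; have /andP[t0 t1] := ratioP iS.
have eh : (j \in sigma) && (j != i) = (j \in sigma) && (j \in neighbor Fc sigma i).
  by case: (boolP (j \in sigma)) => // jS; rewrite h.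
rewrite eh -!(rz_eq rz) // dotrDl dotrZl /ed dotrBl -/v.
have := rz_le rz j sF; have := rz_le rz j HF; rewrite -/v.
move: (dotr v _) (dotr _ (a j)) (b j) (ratio i) t0 t1 => x y z t t0 t1 yz xz.
apply/eqP/andP => [e|[/eqP-> /eqP->]]; last by rewrite subrr mulr0 addr0.
split; apply/eqP; nra.
Qed.

Let cutpoint_P i : i \in sigma -> P (cutpoint i).
Proof.
move=> iS; apply/(rz_hull rz); have [HF _ _] := neighborP pm sF iS; have /andP[t0 t1] := ratioP iS.
by apply: hull_segment; rewrite ?ltW //; exact: hull_point.
Qed.

Let vert' (A : {set option I}) : 'rV[R]_N :=
  if None \in A then odflt v (omap cutpoint [pick i in sigma :\: base_part A]) else vert (base_part A).

Let vert'_Some (G : {set I}) : vert' (Some @: G) = vert G.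
Proof. by rewrite /vert' None_notin base_partK. Qed.

Let vert'_None i : i \in sigma -> vert' (None |: Some @: (sigma :\ i)) = cutpoint i.
Proof.
move=> iS; rewrite /vert' in_setU1 eqxx base_partU1; case: pickP => [j|/(_ i)]; last first.
  by rewrite !inE eqxx iS.
rewrite !inE => /andP[+ jS]; rewrite jS andbT negbK => /eqP-> //.
Qed.

(* The cone at the vertex [sigma] is spanned by its edges, so its section is the simplex
   spanned by the [cutpoint]s. *)
Let section_hull z : P z -> dotr z c = m -> hull (cut_facets Fc sigma) vert' z.
Proof.
move=> Pz zc; pose w i := dotr (z - v) (a i) / dotr (ratio i *: ed i) (a i).
have ea i : i \in sigma -> dotr (ratio i *: ed i) (a i) < 0.
  by move=> iS; have /andP[t0 _] := ratioP iS; rewrite dotrZl pmulr_rlt0 // (edge_neg rz pm).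
have ez : z - v = \sum_(i in sigma) w i *: (ratio i *: ed i).
  apply: dual_decomposition; first exact: pm_card pm _ sF.
    by move=> i j iS jS ji; rewrite dotrZl (edge_flat rz pm) ?mulr0.
  by move=> i iS; rewrite lt_eqF // ea.
have w0 i : i \in sigma -> 0 <= w i.
  move=> iS; rewrite /w -mulrNN -invrN; apply: divr_ge0; rewrite oppr_ge0 ?(ltW (ea i iS)) //.
  by rewrite dotrBl (rz_tight rz) // subr_le0 (rz_valid rz).
have w1 : \sum_(i in sigma) w i = 1.
  have ne : m - dotr v c != 0 by rewrite lt_eqF.
  apply: (mulIf ne); rewrite mul1r -[in RHS]zc -dotrBl ez dotr_suml mulr_suml.
  apply: eq_bigr => i iS; rewrite dotrZl; congr (_ * _).
  by rewrite -[in LHS](cutpoint_c iS) dotrDl addrC addKr.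
apply: (@hull_convex _ _ _ _ _ sigma _ cutpoint); last first.
  move=> i iS; rewrite -(vert'_None iS); apply: hull_point.
  by apply/cut_facetsP; right; exists i.
exists (fun i => if i \in sigma then w i else 0); split.
- by move=> i; case: ifP => // /w0.
- by rewrite -[RHS]w1; apply: eq_bigr => i ->.
have -> : z = (z - v) + v by rewrite subrK.
rewrite ez -[v in LHS]scale1r -w1 scaler_suml -big_split; apply: eq_bigr => i iS.
by rewrite /= iS -scalerDr addrC.
Qed.

(** A point [x] on the right side lies between the hull of the vertices other than [sigma]
    and the section by the hyperplane: on the segment from [vert sigma] through [x] to
    that hull, the section is met before [x]. *)
Lemma cut_realizes : exists vert' a' b', realizes (cut_facets Fc sigma) Q vert' a' b'.
Proof.
exists vert', (fun o => if o is Some i then a i else c), (fun o => if o is Some i then b i else m).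
have old G : G \in Fc -> G != sigma -> Some @: G \in cut_facets Fc sigma.
  by move=> GF Gs; apply/cut_facetsP; left; exists G.
split.
- move=> x; rewrite QE; split=> [[Px xm]|hx].
    have /(rz_hull rz)[w [w0 w1 ex]] := Px.
    have ws : w sigma < 1.
      rewrite ltNge; apply/negP => ws.
      have rest : \sum_(G in Fc :\ sigma) w G = 0.
        apply/eqP; rewrite eq_le sumr_ge0 // andbT -(lerD2l (w sigma)) addr0.
        by rewrite -big_setD1 // w1.
      have wG G : G \in Fc :\ sigma -> w G = 0 by have /psumr_eq0P := rest; apply.
      have ws1 : w sigma = 1 by rewrite -[RHS]w1 (big_setD1 sigma) //= rest addr0.
      move: xm; rewrite ex (big_setD1 sigma) //= big1 ?addr0 => [|G /wG->]; last by rewrite scale0r.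
      by rewrite ws1 scale1r leNgt sm.
    have u0 : 0 < 1 - w sigma by rewrite subr_gt0.
    pose y := \sum_(G in Fc :\ sigma) (w G / (1 - w sigma)) *: vert G.
    have yh : hull (Fc :\ sigma) vert y.
      exists (fun G => w G / (1 - w sigma)); split=> // [G|].
        by rewrite divr_ge0 // ltW.
      have e1 : 1 - w sigma = \sum_(G in Fc :\ sigma) w G.
        by rewrite -w1 (big_setD1 sigma) //= addrAC subrr add0r.
      by rewrite -mulr_suml -e1 divff // lt0r_neq0.
    have yh' : hull (cut_facets Fc sigma) vert' y.
      apply: hull_convex yh _ => G /setD1P[Gs GF]; rewrite -vert'_Some; apply: hull_point; exact: old.
    have exy : x = y + w sigma *: (v - y).
      rewrite scalerBr addrCA addrC -{1}[y]scale1r -scalerBl ex (big_setD1 sigma) //= addrC.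
      congr (_ + _); rewrite /y scaler_sumr; apply: eq_bigr => G _.
      by rewrite scalerA mulrC divfK // lt0r_neq0.
    have yc : dotr y c <= m by apply: hull_le yh _ => G /setD1P[Gs GF]; exact/ltW/other.
    have vy : 0 < dotr v c - dotr y c by rewrite subr_gt0; exact: le_lt_trans yc sm.
    pose u := (m - dotr y c) / (dotr v c - dotr y c).
    have us : w sigma <= u.
      by rewrite ler_pdivlMr // -dotrBl -dotrZl lerBrDl -dotrDl -exy.
    have u1 : u <= 1 by rewrite ler_pdivrMr // mul1r lerD2r; exact: ltW.
    have /(rz_hull rz) Py : hull Fc vert y.
      by apply: hull_convex yh _ => G /setD1P[_ GF]; exact: hull_point.
    pose z := y + u *: (v - y).
    have Pz : P z.
      apply/(rz_hull rz); apply: hull_segment; [|exact/(rz_hull rz)|exact: hull_point].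
      by rewrite u1 (le_trans (w0 sigma)).
    have zc : dotr z c = m.
      by rewrite dotrDl dotrZl dotrBl /u divfK ?lt0r_neq0 // addrC subrK.
    have hz := section_hull Pz zc.
    have -> : x = y + (w sigma / u) *: (z - y).
      rewrite /z (addrC y (u *: _)) addrK scalerA; have [u00|un0] := eqVneq u 0.
        rewrite u00 mulr0 scale0r addr0 exy.
        have -> : w sigma = 0 by apply/eqP; rewrite eq_le w0 -u00 us.
        by rewrite scale0r addr0.
      by rewrite divfK.
    apply: hull_segment => //; have ug : 0 <= u := le_trans (w0 sigma) us.
    rewrite divr_ge0 //=; have [u00|un0] := eqVneq u 0; first by rewrite u00 invr0 mulr0 ler01.
    by rewrite ler_pdivrMr ?mul1r // lt0r un0.
  split.
    apply/(rz_hull rz); apply: hull_convex hx _ => A /cut_facetsP[[G [GF _ ->]]|[i iS ->]].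
      by rewrite vert'_Some; exact: hull_point.
    by rewrite vert'_None //; apply/(rz_hull rz); exact: cutpoint_P.
  apply: hull_le hx _ => A /cut_facetsP[[G [GF Gs ->]]|[i iS ->]].
    by rewrite vert'_Some; apply/ltW/other.
  by rewrite vert'_None // cutpoint_c.
- move=> A [j|] /cut_facetsP[[G [GF Gs ->]]|[i iS ->]]; rewrite ?vert'_Some ?vert'_None //.
  + exact: (rz_le rz).
  + by apply: (rz_valid rz); exact: cutpoint_P.
  + exact/ltW/other.
  + by rewrite cutpoint_c.
move=> A [j|] /cut_facetsP[[G [GF Gs ->]]|[i iS ->]]; rewrite ?vert'_Some ?vert'_None //.
- by rewrite mem_SomeI (rz_eq rz).
- by rewrite cutpoint_tight // in_setU1 mem_SomeI !inE andbC.
- by rewrite None_notin lt_eqF //; exact: other.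
- by rewrite cutpoint_c // eqxx in_setU1 eqxx.
Qed.

End Cut.

(** * Simplices and their products *)

(** The functionals are, up to sign, the barycentric coordinates. *)
Lemma simplex_coordinates (R : realType) n (D : set 'rV[R]_n) : is_simplex D ->
  exists t : ('I_n.+1 -> 'rV[R]_n) * ('I_n.+1 -> 'cV[R]_n) * ('I_n.+1 -> R),
    (forall x, D x <-> hull setT t.1.1 x) /\
    forall i j, dotr (t.1.1 j) (t.1.2 i) = t.2 i - (j == i)%:R.
Proof.
move=> [V Vfree ->]; pose M : 'M[R]_(n.+1) := row_mx (const_mx 1 : 'cV_(n.+1)) V.
have uM : M \in unitmx by rewrite -row_free_unit.
pose W : 'M[R]_(1 + n, n.+1) := invmx M.
have e : (const_mx 1 : 'cV_(n.+1)) *m usubmx W + V *m dsubmx W = 1%:M.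
  by rewrite -mul_row_col vsubmxK; exact: mulmxV uM.
exists (fun j => row j V, fun i => - col i (dsubmx W), fun i => usubmx W 0 i) => /=; split.
- move=> x; split=> [[w [w0 w1 ->]]|[w [w0 w1 ->]]].
    exists (fun j => w 0 j); split=> //; first by rewrite -[RHS]w1; apply: eq_bigl => j; rewrite inE.
    by rewrite mulmx_sum_row; apply: eq_bigl => j; rewrite inE.
  exists (\row_j w j); split=> [j||]; first by rewrite mxE.
    by rewrite -[RHS]w1; apply: eq_big => j; rewrite ?inE ?mxE.
  by rewrite mulmx_sum_row; apply: eq_big => j; rewrite ?inE ?mxE.
move=> i j; have := congr1 (fun A : 'M_n.+1 => A j i) e.
rewrite !mxE big_ord1 !mxE mul1r => <-; rewrite opprD addNKr /dotr mulmxN mxE; congr (- _).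
by rewrite !mxE; apply: eq_bigr => l _; rewrite !mxE.
Qed.

Lemma submxrow_sum (R : realType) r (n : 'I_r -> nat) (T : finType) (S : {set T}) (w : T -> R)
    (B : T -> 'rV[R]_(\sum_(i < r) n i)) i :
  submxrow (\sum_(t in S) w t *: B t) i = \sum_(t in S) w t *: submxrow (B t) i.
Proof.
by apply/rowP => j; rewrite mxE !summxE; apply: eq_bigr => t _; rewrite !mxE.
Qed.

Section Product.
Variables (r : nat) (n : 'I_r -> nat).

Definition corner_choice (A : {set pfacet n}) : choices n :=
  odflt (finfun (fun i => ord0 : 'I_(n i).+1)) [pick f | corner f == A].

Lemma corner_choiceK f : corner_choice (corner f) = f.
Proof.
rewrite /corner_choice; case: pickP => [h /eqP/corner_inj //|/(_ f)].
by rewrite eqxx.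
Qed.

(** The blocks of a point are replaced one at a time by vertices of their simplices; [k]
    counts the blocks still to be replaced. *)
Lemma product_realizes (R : realType) (D : forall i, set 'rV[R]_(n i)) :
  (forall i, is_simplex (D i)) ->
  exists vert a b, realizes (product_facets n) (prod_set D) vert a b.
Proof.
move=> hD; pose t i := sval (cid (simplex_coordinates (hD i))).
have tP i := svalP (cid (simplex_coordinates (hD i))); rewrite -/(t _) in tP.
pose p i := (t i).1.1; pose al i := (t i).1.2; pose be i := (t i).2.
have Dp i y : D i y <-> hull setT (p i) y by have [h _] := tP i; exact: h.
have pal i j l : dotr (p i j) (al i l) = be i l - (j == l)%:R by have [_ h] := tP i; exact: h.
pose vert A := \mxrow_i p i (corner_choice A i).
pose a (x : pfacet n) := \mxcol_i dfwith (fun i => 0 : 'cV[R]_(n i)) (al (tag x) (tagged x)) i.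
have dota y x : dotr y (a x) = dotr (submxrow y (tag x)) (al (tag x) (tagged x)).
  rewrite -{1}[y]submxrowK /dotr mul_mxrow_mxcol (bigD1 (tag x)) //= dfwith_in big1 ?addr0 // => i ix.
  by rewrite dfwith_out ?mulmx0 // eq_sym.
exists vert, a, (fun x => be (tag x) (tagged x)).
have tight f x : dotr (vert (corner f)) (a x) = be (tag x) (tagged x) - (f (tag x) == tagged x)%:R.
  by rewrite dota mxrowK corner_choiceK pal.
split.
- move=> x; split=> [hx|[w [w0 w1 ->]] i].
    have [k] := ubnP #|[set i | [forall j, submxrow x i != p i j]]|.
    elim: k x hx => // k IH x hx; rewrite ltnS => ck.
    have [e0|/set0Pn[i]] := eqVneq [set i | [forall j, submxrow x i != p i j]] set0.
      have ex i : [exists j, submxrow x i == p i j].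
        have /setP/(_ i) := e0; rewrite !inE => /negbT; rewrite negb_forall => /existsP[j].
        by rewrite negbK => h; apply/existsP; exists j.
      pose f : choices n := finfun (fun i => xchoose (existsP (ex i))).
      have -> : x = vert (corner f).
        rewrite -[x]submxrowK; apply/eq_mxrowP => i; rewrite corner_choiceK ffunE.
        exact/eqP/(xchooseP (existsP (ex i))).
      by apply: hull_point; exact: imset_f.
    rewrite inE => /forallP hi; have /Dp[w [w0 w1 ei]] := hx i.
    pose q (j : 'I_(n i).+1) := \mxrow_l dfwith (fun l => submxrow x l) (p i j) l.
    apply: (@hull_convex _ _ _ _ _ setT _ q).
      exists w; split=> //; apply/mxrowP => l; rewrite submxrow_sum.
      have [<-|il] := eqVneq i l; first by rewrite ei; apply: eq_bigr => j _; rewrite mxrowK dfwith_in.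
      rewrite -[LHS]scale1r -w1 scaler_suml; apply: eq_bigr => j _.
      by rewrite mxrowK dfwith_out.
    move=> j _; apply: IH.
      move=> l; rewrite mxrowK; case: dfwithP => [|l' _]; last exact: hx.
      by apply/Dp; exact: hull_point.
    apply: leq_trans ck; apply: proper_card; apply/properP; split.
      apply/subsetP => l; rewrite !inE mxrowK; case: dfwithP => // /forallP/(_ j).
      by rewrite eqxx.
    exists i; first by rewrite inE; exact/forallP.
    by rewrite inE mxrowK dfwith_in; apply/forallPn; exists j; rewrite eqxx.
  apply/Dp; rewrite submxrow_sum.
  apply: (@hull_convex _ _ _ _ _ (product_facets n) _ (fun A => submxrow (vert A) i)).
    by exists w.
  by move=> A _; rewrite mxrowK; exact: hull_point.
- by move=> _ x /imsetP[f _ ->]; rewrite tight gerBl ler0n.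
move=> _ x /imsetP[f _ ->]; rewrite tight in_cornerE -subr_eq0 addrAC subrr add0r oppr_eq0.
by rewrite pnatr_eq0 eqb0.
Qed.

End Product.

(** A product with one factor, but in the space of that factor. *)
Lemma simplex_realizes (R : realType) N (P : set 'rV[R]_N) : is_simplex P ->
  exists vert a b, realizes (product_facets (fun _ : 'I_1 => N)) P vert a b.
Proof.
move=> /simplex_coordinates[[[p al] be] /= [hP pal]]; pose n1 := fun _ : 'I_1 => N.
pose vert (A : {set pfacet n1}) := p (corner_choice A ord0).
exists vert, (fun x : pfacet n1 => al (tagged x)), (fun x : pfacet n1 => be (tagged x)).
have tight (f : choices n1) (x : pfacet n1) : dotr (vert (corner f)) (al (tagged x)) =
    be (tagged x) - (f (tag x) == tagged x)%:R.
  by case: x => i j; rewrite /= /vert corner_choiceK pal (ord1 i).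
split.
- move=> x; rewrite hP; split=> h; apply: hull_convex h _; last by move=> A _; exact: hull_point.
  move=> j _.
  pose f : choices n1 := finfun (fun _ : 'I_1 => j).
  have -> : p j = vert (corner f) by rewrite /vert corner_choiceK ffunE.
  by apply: hull_point; exact: imset_f.
- by move=> _ x /imsetP[f _ ->]; rewrite tight gerBl ler0n.
move=> _ x /imsetP[f _ ->]; rewrite tight in_cornerE -subr_eq0 addrAC subrr add0r oppr_eq0.
by rewrite pnatr_eq0 eqb0.
Qed.

(** * Iterated vertex cuts *)

Lemma vertex_cut_realizes (R : realType) N (I : finType) (Fc : {set {set I}})
    (P Q : set 'rV[R]_N) vert a b :
  realizes Fc P vert a b -> pseudomanifold Fc N -> vertex_cut P Q ->
  exists2 sigma, sigma \in Fc & exists vert' a' b', realizes (cut_facets Fc sigma) Q vert' a' b'.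
Proof.
move=> rz pm [v [c [m [/(is_vertexP rz pm)[sigma sF ->] sm other QE]]]].
exists sigma => //; apply: (cut_realizes rz pm sF sm) => [G GF Gs|x]; last by rewrite QE.
apply: other; first by apply/(is_vertexP rz pm); exists G.
by move=> /(vert_inj rz GF sF) e; rewrite e eqxx in Gs.
Qed.

Section Tower.
Variables (k : comNzRingType) (R : realType) (r : nat) (n : 'I_r -> nat).
Variable D : forall i : 'I_r, set 'rV[R]_(n i).
Arguments D i : clear implicits.
Hypotheses (r_gt0 : (0 < r)%N) (n_gt0 : forall i, (0 < n i)%N) (hD : forall i, is_simplex (D i)).

Let N := (\sum_(i < r) n i)%N.

Lemma dim_gt0 : (0 < N)%N.
Proof. by rewrite /N (bigD1 (Ordinal r_gt0)) //= addn_gt0 n_gt0. Qed.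

(** What is needed of the dual of [P], in a form that cuts preserve.  A simplex carries no
    nontrivial product, but its first cut does; in dimension 1 a cut only gives another
    segment. *)
Record cut_product l (I : finType) (Fc : {set {set I}}) : Prop := CutProduct {
  cp_pm : pseudomanifold Fc N;
  cp_ex : Fc != set0;
  cp_stacked : (r <= 2)%N -> stacked Fc N;
  cp_spare : (2 < r)%N -> spare_join Fc N;
  cp_two : r = 2%N -> detects k Fc N;
  cp_one : r = 1%N -> if l is 0%N then #|Fc| = N.+1 /\
      forall sigma, sigma \in Fc -> detects k (cut_facets Fc sigma) N
    else detects k Fc N;
  cp_segment : N = 1%N -> #|Fc| = 2%N
}.

Lemma iter_cut_realizes l P : iter_vertex_cut l (prod_set D) P -> exists (I : finType) (Fc : {set {set I}}),
  cut_product l Fc /\ exists vert a b, realizes Fc P vert a b.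
Proof.
elim: l P => [P /= ->|l IH P /= [P' /IH[I [Fc [cp [vert [a [b rz]]]]]] cut]].
  exists (pfacet n), (product_facets n); split; last exact: product_realizes.
  have pm := product_pseudomanifold n_gt0.
  have r1N : N = 1%N -> r = 1%N.
    move=> N1; apply/eqP; rewrite eqn_leq r_gt0 andbT -[X in (_ <= X)%N]N1 /N.
    rewrite -[X in (X <= _)%N]card_ord -sum1_card; apply: leq_sum => i _; exact: n_gt0.
  split=> //.
  - have [G GF _] := product_cover n_gt0 (Tagged (fun i => 'I_(n i).+1) (ord0 : 'I_(n (Ordinal r_gt0)).+1)).
    by apply/set0Pn; exists G.
  - exact: product_stacked.
  - exact: product_spare_join.
  - exact: product_detects.
  - by move=> r1; split; [exact: card_product_facets|move=> sigma; exact: product_cut_detects].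
  - by move=> N1; rewrite (card_product_facets n (r1N N1)) -/N N1.
have pm := cp_pm cp; have [sigma sF rz'] := vertex_cut_realizes rz pm cut.
have N0 := dim_gt0.
exists (option I : finType), (cut_facets Fc sigma); split=> //; split.
- exact: cut_pseudomanifold.
- by rewrite -card_gt0 (card_cut pm sF) addn_gt0 N0 orbT.
- by move=> r2; apply: cut_stacked => //; exact: cp_stacked cp r2.
- by move=> r2; apply: cut_spare_join => //; exact: cp_spare cp r2.
- by move=> r2; apply: cut_detects => //; exact: cp_two cp r2.
- move=> r1; have := cp_one cp r1; case: (l) => [[_ h]|_ h]; first exact: h.
  by apply: cut_detects.
- by move=> N1; rewrite (card_cut pm sF) (cp_segment cp N1) N1.
Qed.

End Tower.

Lemma simplex_nerve_golod (k : comNzRingType) (R : realType) N (P : set 'rV[R]_N) m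
    (F : 'I_m -> set 'rV[R]_N) :
  (0 < N)%N -> is_simplex P -> facet_numbering P F -> golod k (nerve F).
Proof.
move=> N0 /simplex_realizes[vert [a [b rz]]] hF; pose n1 := fun _ : 'I_1 => N.
have pm : pseudomanifold (product_facets n1) N.
  by have := @product_pseudomanifold 1 n1 (fun _ => N0); rewrite big_ord1.
have cover := @product_cover 1 n1 (fun _ => N0).
have ex : product_facets n1 != set0.
  have [G GF _] := cover (Tagged (fun i => 'I_(n1 i).+1) (ord0 : 'I_(n1 ord0).+1)).
  by apply/set0Pn; exists G.
have [g g_bij KE] := nerve_push rz pm N0 ex cover hF.
have [h gK hK] := g_bij; have g_inj := can_inj gK.
apply: simplex_golod.
  rewrite -(card_ord m); apply: leq_trans (leq_card g g_inj).
  by apply: leq_trans (max_card (mem (@block 1 n1 ord0))); rewrite card_block.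
move=> A; rewrite KE mem_push //.
have -> /= : A \subset g @: setT by apply/subsetP => j _; apply/imsetP; exists (h j).
rewrite product_faceP; have bT i : @block 1 n1 i = setT.
  by apply/setP => x; rewrite !inE (ord1 i) (ord1 (tag x)).
apply/forallP/idP => [/(_ ord0)|AT i]; rewrite bT subTset.
  by apply: contra_neq => ->; apply/setP => x; rewrite !inE.
apply: contra_neq AT => e; apply/setP => j; rewrite -(hK j).
by have /setP/(_ (h j)) := e; rewrite !inE.
Qed.

Theorem theorem3p2 (k : comNzRingType) (hk : coefficient_ring k) (R : realType)
    (r : nat) (n : 'I_r -> nat) (l : nat)
    (r_gt0 : (0 < r)%N) (n_gt0 : forall i, (0 < n i)%N)
    (n_decr : forall i j : 'I_r, (i <= j)%N -> (n j <= n i)%N)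
    (D : forall i : 'I_r, set 'rV[R]_(n i)) (hD : forall i, is_simplex (D i))
    (P : set 'rV[R]_(\sum_(i < r) n i))
    (hP : iter_vertex_cut l (prod_set D) P)
    (m : nat) (F : 'I_m -> set 'rV[R]_(\sum_(i < r) n i))
    (hF : facet_numbering P F) :
  minimally_non_golod k (nerve F) <-> (r = 1%N \/ r = 2%N) /\ ~ is_simplex P.
Proof.
have N0 := dim_gt0 r_gt0 n_gt0; set N := (\sum_(i < r) n i)%N in N0 P hP F hF *.
have simplex_golodP : is_simplex P -> golod k (nerve F).
  by move=> Ps; exact: simplex_nerve_golod hF.
have [I [Fc [cp [vert [a [b rz]]]]]] := iter_cut_realizes k r_gt0 n_gt0 hD hP.
have pm := cp_pm cp; have ex := cp_ex cp.
have [N1|N1] := leqP N 1.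
  have eN : N = 1%N by apply/eqP; rewrite eqn_leq N1.
  have Ps : is_simplex P.
    by apply: (few_vertices_simplex rz pm ex); rewrite (cp_segment cp eN) -/N eN.
  by split=> [[ng _]|[_ ns]]; [case: ng; exact: simplex_golodP|case: ns].
have [g g_bij KE] := nerve_push rz pm N0 ex (pm_cover pm N1) hF.
split=> [[ng del]|[r12 ns]].
  split; last by move=> /simplex_golodP.
  have [r2|r3] := leqP r 2.
    by move: r2 r_gt0; case: (r) => [|[|[|]]] //; [left|right].
  have [v ngv] := spare_join_del k g_bij KE (cp_spare cp r3).
  by case: ngv; apply: del; exact: (vertex_face pm N1 g_bij KE).
have r2 : (r <= 2)%N by case: r12 => ->.
split.
  apply: (detects_not_golod (bij_inj g_bij) KE (N := N)).
  case: r12 => [r1|]; last exact: (cp_two cp).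
  have := cp_one cp r1; case: (l) => // -[cF _].
  by case: ns; exact: (few_vertices_simplex rz pm ex).
by move=> v _; apply: (del_golod k pm N1 g_bij KE); exact: (cp_stacked cp).
Qed.
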